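(* Let $n\geq 3$, $k\in\{1,\dots,n-1\}$, and let $M$ be a $(2n-k)$-dimensional connected submanifold in $\mathbb{C}H^n$ with totally real normal bundle $\nu M\subset T\mathbb{C}H^n$. Assume that there exists a unit vector field $Z$ tangent to the maximal holomorphic subbundle of $TM\subset T\mathbb{C}H^n$ such that the second fundamental form $I\!I$ of $M$ is given by the trivial bilinear extension of $2\,I\!I(Z,J\xi)=\xi$ for all $\xi\in\Gamma(\nu M)$. Then $M$ is holomorphically congruent to an open part of the ruled minimal submanifold $W^{2n-k}$.
   Context: $\mathbb{C}H^n$ is the $n$-dimensional complex hyperbolic space with its Fubini-Study metric of constant holomorphic sectional curvature $-1$ and complex structure $J$. The second fundamental form of $M$ is defined by $\bar\nabla_XY=\nabla_XY+I\!I(X,Y)$, with $\bar\nabla,\nabla$ the Levi Civita connections of $\mathbb{C}H^n$ and $M$. Totally real normal bundle means $J(\nu_pM)\perp\nu_pM$, i.e. $J(\nu_pM)\subset T_pM$, for all $p\in M$. The maximal holomorphic subbundle $\mathfrak{D}$ of $TM$ is the orthogonal complement of $J(\nu M)$ in $TM$, so $TM=\mathfrak{D}\oplus J(\nu M)$. That $I\!I$ is the trivial bilinear extension of $2I\!I(Z,J\xi)=\xi$ means: $I\!I$ is symmetric bilinear, $I\!I(Z,J\xi)=I\!I(J\xi,Z)=\tfrac12\xi$ for all $\xi\in\nu M$, and $I\!I(Z,Z)=0$, $I\!I(J\xi,J\eta)=0$ for all $\xi,\eta\in\nu M$, and $I\!I(X,\cdot)=0$ for all $X\in\mathfrak{D}\ominus\mathbb{R}Z$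 (where $\ominus$ denotes orthogonal complement). Two submanifolds are holomorphically congruent if one is mapped onto the other by a holomorphic isometry of $\mathbb{C}H^n$. Definition of $W^{2n-k}$, $k\in\{1,\dots,n-1\}$: consider a totally geodesic, totally real $\mathbb{R}H^{k+1}\subset\mathbb{C}H^n$ and a horosphere $H$ in $\mathbb{R}H^{k+1}$ (a horocycle if $k=1$). At each point $p\in H$ attach the totally geodesic complex hyperbolic space $\mathbb{C}H^{n-k}\subset\mathbb{C}H^n$ through $p$ which is tangent to the orthogonal complement in $T_p\mathbb{C}H^n$ of the complex span of $T_pH$. The union is the $(2n-k)$-dimensional ruled minimal submanifold $W^{2n-k}$; it is unique up to holomorphic congruence. Equivalently (up to holomorphic congruence): let $KAN$ be an Iwasawa decomposition of $SU(1,n)$, $o$ the fixed point of $K$, $\mathfrak{n}=\mathfrak{z}\oplus\mathfrak{v}$ the orthogonal decomposition of the Lie algebra of $N$ with one-dimensional center $\mathfrak{z}$, $\mathfrak{v}\cong\mathbb{C}^{n-1}$, and $\mathfrak{w}$ the orthogonal complement in $\mathfrak{v}$ of a $k$-dimensional real (i.e. totally real) subspace of $\mathfrak{v}$; then $W^{2n-k}$ is the orbit through $o$ of the connected subgroup of $AN$ with Lie algebra $\mathfrak{a}\oplus\mathfrak{z}\oplus\mathfrak{w}$. *)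

(* Defs.v *)
From HB Require Import structures.
From mathcomp Require Import all_boot all_order all_algebra.
From mathcomp Require Import all_classical all_reals all_analysis.
From mathcomp Require Import ring.
Set Implicit Arguments.
Unset Strict Implicit.
Unset Printing Implicit Defensive.
Import Order.TTheory GRing.Theory Num.Theory.
Import numFieldNormedType.Exports.
Local Open Scope classical_set_scope.
Local Open Scope ring_scope.

(* C^n as a real normed space: the pair (x, y) stands for x + iy. *)
Notation Cvec R n := ('rV[R]_n * 'rV[R]_n)%type.

Section HermitianSpace.
Variables (R : realType) (n : nat).
Implicit Types z u v w : Cvec R n.

Definition dotv (x y : 'rV[R]_n) : R := \sum_(i < n) x ord0 i * y ord0 i.

Definition J z : Cvec R n := (- z.2, z.1).

(* real and imaginary parts of <z, w> = \sum_i z_i * conj (w_i) *)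
Definition rdot z w : R := dotv z.1 w.1 + dotv z.2 w.2.
Definition idot z w : R := rdot z (J w).

(* (a + ib) z *)
Definition cscale (a b : R) z : Cvec R n := a *: z + b *: J z.

End HermitianSpace.

(* Complex hyperbolic n-space is modelled on the open unit ball of C^n with its
   complex structure J and the metric
     4 Re (<u,v> / (1 - |z|^2) + <u,z><z,v> / (1 - |z|^2)^2),
   of constant holomorphic sectional curvature -1: for n = 1 this is
   4 |dz|^2 / (1 - |z|^2)^2, of Gauss curvature -1. *)
Section ComplexHyperbolicSpace.
Variables (R : realType) (n : nat).
Implicit Types z u v w : Cvec R n.

Definition CH : set (Cvec R n) := [set z | rdot z z < 1].

Definition metric z u v : R :=
  4 * (rdot u v / (1 - rdot z z)
       + (rdot u z * rdot v z + idot u z * idot v z) / (1 - rdot z z) ^+ 2).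

(* In the global chart CH of the vector space C^n, a linear connection is
   nabla_u Y = D_u Y + Gamma(u, Y).  Levi-Civita: torsion-free and metric. *)
Definition levi_civita (Gamma : Cvec R n -> Cvec R n -> Cvec R n -> Cvec R n)
  : Prop :=
  forall z, CH z ->
  [/\ forall u v, Gamma z u v = Gamma z v u,
      forall (a : R) u v w,
        Gamma z u (a *: v + w) = a *: Gamma z u v + Gamma z u w &
      forall u v w, is_derive z u (fun x => metric x v w)
        (metric z (Gamma z u v) w + metric z v (Gamma z u w))].

(* (<u,z> v + <v,z> u) / (1 - |z|^2) *)
Definition christoffel z u v : Cvec R n :=
  (1 - rdot z z)^-1 *: (cscale (rdot u z) (idot u z) v
                        + cscale (rdot v z) (idot v z) u).

Definition holomorphic_isometry (F : Cvec R n -> Cvec R n) : Prop :=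
  set_bij CH CH F /\
  forall z, CH z ->
  [/\ differentiable F z,
      forall v, 'd F z (J v) = J ('d F z v) &
      forall u v, metric (F z) ('d F z u) ('d F z v) = metric z u v].

End ComplexHyperbolicSpace.

Section LeviCivita.
Variables (R : realType) (n : nat).
Implicit Types z u v w : Cvec R n.

Let dotvC (x y : 'rV[R]_n) : dotv x y = dotv y x.
Proof. by apply: eq_bigr => i _; rewrite mulrC. Qed.

Let dotvDl (x y t : 'rV[R]_n) : dotv (x + y) t = dotv x t + dotv y t.
Proof.
by rewrite /dotv -big_split; apply: eq_bigr => i _; rewrite mxE mulrDl.
Qed.

Let dotvZl a (x t : 'rV[R]_n) : dotv (a *: x) t = a * dotv x t.
Proof.
by rewrite /dotv mulr_sumr; apply: eq_bigr => i _; rewrite mxE mulrA.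
Qed.

Let dotvNl (x t : 'rV[R]_n) : dotv (- x) t = - dotv x t.
Proof. by rewrite -scaleN1r dotvZl mulN1r. Qed.

Lemma rdotC z w : rdot z w = rdot w z.
Proof. by rewrite /rdot dotvC [dotv z.2 _]dotvC. Qed.

Lemma rdotDl z w u : rdot (z + w) u = rdot z u + rdot w u.
Proof. by rewrite /rdot /= !dotvDl addrACA. Qed.

Lemma rdotZl a z u : rdot (a *: z) u = a * rdot z u.
Proof. by rewrite /rdot /= !dotvZl mulrDr. Qed.

Lemma rdotDr z w u : rdot u (z + w) = rdot u z + rdot u w.
Proof. by rewrite rdotC rdotDl !(rdotC _ u). Qed.

Lemma rdotZr a z u : rdot u (a *: z) = a * rdot u z.
Proof. by rewrite rdotC rdotZl (rdotC _ u). Qed.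

Lemma rdotNr z w : rdot z (- w) = - rdot z w.
Proof. by rewrite -scaleN1r rdotZr mulN1r. Qed.

Lemma rdotJl z w : rdot (J z) w = - idot z w.
Proof.
by rewrite /idot /rdot /J /= dotvNl (dotvC z.1 (- _)) dotvNl (dotvC w.2); ring.
Qed.

Lemma JD z w : J (z + w) = J z + J w.
Proof. by rewrite /J /= opprD. Qed.

Lemma JZ a z : J (a *: z) = a *: J z.
Proof. by rewrite /J /= -scalerN. Qed.

Lemma JJ z : J (J z) = - z.
Proof. by case: z. Qed.

Lemma idotDl z w u : idot (z + w) u = idot z u + idot w u.
Proof. exact: rdotDl. Qed.

Lemma idotZl a z u : idot (a *: z) u = a * idot z u.
Proof. exact: rdotZl. Qed.

Lemma idotDr z w u : idot u (z + w) = idot u z + idot u w.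
Proof. by rewrite /idot JD rdotDr. Qed.

Lemma idotZr a z u : idot u (a *: z) = a * idot u z.
Proof. by rewrite /idot JZ rdotZr. Qed.

Lemma idotJl z w : idot (J z) w = rdot z w.
Proof. by rewrite /idot rdotJl /idot JJ rdotNr opprK. Qed.

Lemma idotC z w : idot z w = - idot w z.
Proof. by rewrite -rdotJl rdotC. Qed.

Let is_derive_line (f : Cvec R n -> R) z u (d : R) :
  is_derive (0 : R) 1 (fun h : R => f (h *: u + z)) d -> is_derive z u f d.
Proof.
have E : (fun h : R => h^-1 *: ((f \o shift z) (h *: u) - f z)) =
  (fun h : R => h^-1 *: (((fun h : R => f (h *: u + z)) \o shift (0 : R))
    (h *: (1 : R)) - f ((0 : R) *: u + z))).
  apply/funext => h /=; congr (_ *: (f (_ + _) - f _)).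
    by rewrite addr0 /GRing.scale /= mulr1.
  by rewrite scale0r add0r.
by case=> d1 d2; split; rewrite /derivable /derive /= E.
Qed.

Lemma levi_civita_christoffel : levi_civita (@christoffel R n).
Proof.
move=> z zB; have D0 : 1 - rdot z z != 0 by rewrite subr_eq0 gt_eqF.
split=> [u v|a u v w|u v w].
- by rewrite /christoffel; congr (_ *: _); rewrite addrC.
- rewrite /christoffel scalerA (mulrC a) -scalerA -scalerDr; congr (_ *: _).
  rewrite /cscale JD JZ rdotDl rdotZl idotDl idotZl.
  by apply/pair_equal_spec; split; apply/rowP => i; rewrite !mxE; ring.
have dr t : is_derive z u (rdot t) (rdot t u).
  apply: is_derive_line.
  rewrite (_ : (fun h : R => _) = (rdot t u *: id) + cst (rdot t z)).
    have := is_deriveD (is_deriveZ (rdot t u) (is_derive_id (0:R) 1)) (is_derive_cst (rdot t z) (0:R) 1).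
    by rewrite addr0 /GRing.scale /= mulr1.
  by apply/funext => h; rewrite rdotDr rdotZr mulrC.
have di t : is_derive z u (idot t) (idot t u).
  rewrite (_ : idot t = - rdot (J t)); last first.
    by apply/funext => x; rewrite fctE rdotJl opprK.
  exact: is_deriveN (dr (J t)).
have dN : is_derive z u (fun x => 1 - rdot x x) (- (2 * rdot z u)).
  apply: is_derive_line.
  rewrite (_ : (fun h : R => _) =
    cst (1 - rdot z z) - (2 * rdot z u) *: id - rdot u u *: (id * id)).
    by apply: is_derive_eq; rewrite /GRing.scale /=; ring.
  apply/funext => h; rewrite !fctE /GRing.scale /=.
  by rewrite !rdotDr !rdotDl !rdotZr !rdotZl (rdotC u z); ring.
have dV : is_derive z u (fun x => (1 - rdot x x)^-1)
    ((1 - rdot z z) ^- 2 * (2 * rdot z u)).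
  case: dN => d1 d2; split; first exact: derivableV.
  by rewrite deriveV // d2 /GRing.scale /= mulrNN.
rewrite (_ : (fun x => _) = 4 *: (rdot v w *: (fun x => (1 - rdot x x)^-1)
   + (rdot v * rdot w + idot v * idot w)
      * ((fun x => (1 - rdot x x)^-1) * (fun x => (1 - rdot x x)^-1)))); last first.
  apply/funext => x; rewrite !fctE /metric /GRing.scale /= expr2 invfM.
  by [].
apply: is_derive_eq; rewrite !fctE /GRing.scale /=.
rewrite /metric /christoffel /cscale.
rewrite !(rdotDl, rdotDr, rdotZl, rdotZr, idotDl, idotDr, idotZl, idotZr).
rewrite -!/(idot _ _) !(rdotJl, idotJl).
rewrite (rdotC z u) (rdotC u w) (idotC u w).
by field.
Qed.

End LeviCivita.

(* W^{2n-k}, built from the standard RH^{k+1} of real points of the ball.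
   Gamma_z(u, v) lies in the complex span of u and v, and is real when z, u, v
   are real: so the real slice RH below is totally geodesic, and the totally
   geodesic CH^{n-k} through p tangent to a complex subspace V of T_p CH^n is
   the trace on the ball of the affine subspace p + V. *)
Section RuledMinimalSubmanifold.
Variables (R : realType) (n k : nat).

(* The first k + 1 coordinates are real, the other ones are zero. *)
Definition RH : set (Cvec R n) :=
  [set z | [/\ CH z, z.2 = 0 & forall j : 'I_n, (k < j)%N -> z.1 ord0 j = 0]].

(* e_1, a point of the ideal boundary of RH *)
Definition ideal_point : Cvec R n :=
  (\row_(j < n) (nat_of_ord j == 0%N)%:R, 0).

(* Up to a positive factor, the Busemann function of the geodesic ray from 0
   to e_1 is ln ((1 - <z,e_1>)^2 / (1 - |z|^2)) on RH; the horosphere is its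
   zero level set. *)
Definition horosphere : set (Cvec R n) :=
  [set z | RH z /\ (1 - rdot z ideal_point) ^+ 2 = 1 - rdot z z].

(* velocities at p of curves lying in the set H *)
Definition set_tangent (H : set (Cvec R n)) (p : Cvec R n)
  : set (Cvec R n) :=
  [set v | exists c : R -> Cvec R n,
     [/\ c 0 = p, \forall t \near (0 : R), H (c t)
       & is_derive (0 : R) (1 : R) c v]].

(* metric orthogonal complement of the complex span of T_p H, where H is the
   horosphere *)
Definition horosphere_normal (p : Cvec R n) : set (Cvec R n) :=
  [set v | forall u, set_tangent horosphere p u ->
     metric p v u = 0 /\ metric p v (J u) = 0].

Definition ruled_minimal : set (Cvec R n) :=
  [set q | CH q /\ exists p, horosphere p /\ horosphere_normal p (q - p)].

End RuledMinimalSubmanifold.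

(* C^infinity on the open set O: all iterated directional derivatives are
   differentiable on O. *)
Definition smooth_on (R : realType) (V U : normedModType R) (O : set V)
    (f : V -> U) : Prop :=
  forall (s : seq V) x, O x ->
    differentiable (foldr (fun v (g : V -> U) => 'D_v g) f s) x.

(* An m-dimensional submanifold of CH^n is given by its underlying topological
   space T and its inclusion map f.  Its smooth structure is determined by f. *)
Section Submanifold.
Variables (R : realType) (n m : nat) (T : topologicalType).
Variable f : T -> Cvec R n.

(* phi restricts to a homeomorphism from O onto an open set of T, and f o phi
   is a smooth immersion on O. *)
Record local_param (O : set 'rV[R]_m) (phi : 'rV[R]_m -> T) : Prop := {
  local_param_open : open O;
  local_param_continuous : {within O, continuous phi};
  local_param_inj : {in O &, injective phi};
  local_param_image :
    forall U : set 'rV[R]_m, open U -> U `<=` O -> open (phi @` U);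
  local_param_smooth : smooth_on O (f \o phi);
  local_param_immersion :
    forall x, O x -> forall u, 'D_u (f \o phi) x = 0 -> u = 0 }.

Definition submanifold : Prop :=
  [/\ injective f, forall p, CH (f p) &
      forall p, exists O phi, local_param O phi /\ (phi @` O) p].

Definition tangent (p : T) : set (Cvec R n) :=
  [set X | exists O phi x u,
     [/\ local_param O phi, O x, phi x = p & X = 'D_u (f \o phi) x]].

Definition normal (p : T) : set (Cvec R n) :=
  [set xi | forall X, tangent p X -> metric (f p) xi X = 0].

Definition totally_real_normal_bundle : Prop :=
  forall p xi eta, normal p xi -> normal p eta ->
    metric (f p) (J xi) eta = 0.

Definition max_holomorphic (p : T) : set (Cvec R n) :=
  [set X | tangent p X /\
           forall xi, normal p xi -> metric (f p) X (J xi) = 0].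

Definition smooth_field (Y : T -> Cvec R n) : Prop :=
  forall O phi, local_param O phi -> smooth_on O (Y \o phi).

(* Levi-Civita covariant derivative, in the direction u, of a vector field Y
   of CH^n along f o phi *)
Definition covariant_derivative (phi : 'rV[R]_m -> T) (Y : 'rV[R]_m -> Cvec R n)
    (u x : 'rV[R]_m) : Cvec R n :=
  'D_u Y x + christoffel (f (phi x)) ('D_u (f \o phi) x) (Y x).

(* Gauss formula: for tangent fields X = df(u) and Y, II(X, Y) is the normal
   component of the ambient covariant derivative of Y along X. *)
Definition second_fundamental_form
    (II : T -> Cvec R n -> Cvec R n -> Cvec R n) : Prop :=
  (forall p X Y, tangent p X -> tangent p Y -> normal p (II p X Y)) /\
  (forall O phi Y, local_param O phi -> smooth_on O Y ->
     (forall x, O x -> tangent (phi x) (Y x)) ->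
   forall x u, O x ->
     tangent (phi x) (covariant_derivative phi Y u x
                      - II (phi x) ('D_u (f \o phi) x) (Y x))).

(* the trivial bilinear extension of 2 II(Z, J xi) = xi *)
Definition trivial_bilinear_extension (Z : T -> Cvec R n)
    (II : T -> Cvec R n -> Cvec R n -> Cvec R n) : Prop :=
  forall p,
  [/\ forall X Y, tangent p X -> tangent p Y -> II p X Y = II p Y X,
      forall (a : R) X X' Y, tangent p X -> tangent p X' -> tangent p Y ->
        II p (a *: X + X') Y = a *: II p X Y + II p X' Y,
      forall xi, normal p xi -> 2 *: II p (Z p) (J xi) = xi,
      II p (Z p) (Z p) = 0 /\
      (forall xi eta, normal p xi -> normal p eta ->
         II p (J xi) (J eta) = 0) &
      forall X Y, max_holomorphic p X -> metric (f p) X (Z p) = 0 ->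
        tangent p Y -> II p X Y = 0].

End Submanifold.

(* Main.v *)
(** Let Z be the given unit field, phi(X) = <X, z> / (1 - |z|^2) the form which
   gives the Levi-Civita connection of the ball model, h the Hermitian metric
   and a(X) = Re h(X, Z). As the normal bundle is totally real, the hypothesis
   says that II(X, Y) = - (a(X) J Y + a(Y) J X) / 2 modulo the tangent space.
   So if F is a local parametrisation and psi = Im phi + a / 2, then
   D_u D_w F + J (psi(F_u) F_w + psi(F_w) F_u) is tangent. Differentiating this
   and exchanging derivatives (Codazzi) yields
   nabla_X Z = - (J X + i h(Z, X) Z) / 2, which in turn says that the end e of
   the geodesic in the direction - J Z is a constant point of the sphere.

   In the affine chart z / (1 - <z, e>), which sends e to infinity, the form
   phi + i h(., Z) / 2 becomes <., e> / (1 - <z, e>), with imaginary part psi, so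
   that the second derivatives of the immersion are tangent to its image: the
   image is an open part of a real affine subspace. Its normal vectors are
   orthogonal to the complex line of e and, because the chart is conformal in
   these directions, they span a totally real subspace of dimension k.
   Heisenberg translations (the parabolic isometries fixing e) act on the chart
   by translations, and unitary maps act linearly; together they move the affine
   subspace to the one which is the image of the ruled minimal submanifold,
   namely Im (z_j / (1 - z_0)) = 0 for 1 <= j <= k. *)

(* The hypothesis controls only the imaginary part of the connection form: a real coefficient
   multiplies a tangent vector and is invisible modulo the tangent space. The real part is therefore
   free, and it is chosen so that the form becomes complex linear, equal to minus the logarithmic
   derivative of 1 - <z, e>. Dividing by 1 - <z, e> absorbs exactly such a form.

   Computing modulo the tangent space requires differentiating fields that are only known to be
   tangent. This rests on a limit argument: a limit of tangent vectors at converging base points is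
   tangent. That the flat image lies in an affine subspace is a uniqueness statement for a
   homogeneous linear system, proved by halving a bound. Constancy of e, of the normal space in the
   chart and of the normal components of the chart are three separate connectedness arguments. They
   only give an inclusion in the affine subspace; openness in it comes from solving for the
   tangential component with a left inverse of the differential. *)
Require Import Defs.
From HB Require Import structures.
From mathcomp Require Import all_boot all_order all_algebra.
From mathcomp Require Import all_classical all_reals all_analysis.
From mathcomp Require Import ring lra.
Set Implicit Arguments.
Unset Strict Implicit.
Unset Printing Implicit Defensive.
Import Order.TTheory GRing.Theory Num.Theory.
Import numFieldNormedType.Exports.
Local Open Scope classical_set_scope.
Local Open Scope ring_scope.

(* [cscale] is also the scaling of a charge. *)
Notation cscale := Defs.cscale.

(** * Hermitian algebra *)

Section HermitianAlgebra.
Variables (R : realType) (n : nat).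
Implicit Types z u v w : Cvec R n.

Lemma rdotNl z w : rdot (- z) w = - rdot z w.
Proof. by rewrite rdotC rdotNr rdotC. Qed.

Lemma idotNl z w : idot (- z) w = - idot z w.
Proof. exact: rdotNl. Qed.

Lemma JN z : J (- z) = - J z.
Proof. by rewrite -scaleN1r JZ scaleN1r. Qed.

Lemma idotNr z w : idot z (- w) = - idot z w.
Proof. by rewrite /idot JN rdotNr. Qed.

Lemma idotJr z w : idot z (J w) = - rdot z w.
Proof. by rewrite {1}/idot JJ rdotNr. Qed.

Lemma rdotJr z w : rdot z (J w) = idot z w.
Proof. by []. Qed.

Lemma rdot0l z : rdot 0 z = 0.
Proof. by rewrite -(scale0r z) rdotZl mul0r. Qed.

Lemma rdot0r z : rdot z 0 = 0.
Proof. by rewrite rdotC rdot0l. Qed.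

Lemma J0 : J 0 = 0 :> Cvec R n.
Proof. by rewrite -(scale0r (0 : Cvec R n)) JZ !scale0r. Qed.

Lemma idot0l z : idot 0 z = 0.
Proof. exact: rdot0l. Qed.

Lemma idot0r z : idot z 0 = 0.
Proof. by rewrite /idot J0 rdot0r. Qed.

Lemma idotzz z : idot z z = 0.
Proof. by have H := idotC z z; lra. Qed.

Lemma rdot_ge0 z : 0 <= rdot z z.
Proof. by rewrite addr_ge0 // sumr_ge0 // => i _; rewrite -expr2 sqr_ge0. Qed.

Lemma rdot_eq0 z : rdot z z = 0 -> z = 0.
Proof.
case: z => x y; rewrite /rdot /= => /eqP.
have H (t : 'rV[R]_n) : 0 <= dotv t t.
  by rewrite sumr_ge0 // => i _; rewrite -expr2 sqr_ge0.
have H0 (t : 'rV[R]_n) : dotv t t = 0 -> t = 0.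
  move=> /eqP; rewrite psumr_eq0; last by move=> i _; rewrite -expr2 sqr_ge0.
  move=> /allP t0; apply/rowP => i; rewrite mxE; apply/eqP.
  by have := t0 i (mem_index_enum i); rewrite mulf_eq0 orbb.
by rewrite paddr_eq0 // => /andP[/eqP/H0 -> /eqP/H0 ->].
Qed.

Lemma rdot_ext z w : (forall t, rdot z t = rdot w t) -> z = w.
Proof.
move=> H; apply/eqP; rewrite -subr_eq0; apply/eqP/rdot_eq0.
by rewrite rdotDl rdotNl H subrr.
Qed.

Lemma cscaleE a b z : cscale a b z = a *: z + b *: J z. Proof. by []. Qed.

Definition dotE := (rdotDl, rdotDr, rdotZl, rdotZr, rdotNl, rdotNr, rdotJl,
  rdotJr, idotDl, idotDr, idotZl, idotZr, idotNl, idotNr, idotJl, idotJr,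
  rdot0l, rdot0r, idot0l, idot0r).

Definition JE := (JD, JZ, JN, JJ, J0).

Lemma CH_gt0 z : CH z -> 0 < 1 - rdot z z.
Proof. by rewrite /CH /= subr_gt0. Qed.

Lemma metricC z u v : metric z u v = metric z v u.
Proof. by rewrite /metric (rdotC u v); ring. Qed.

Lemma metricDl z u v w : metric z (u + v) w = metric z u w + metric z v w.
Proof. by rewrite /metric !dotE; ring. Qed.

Lemma metricZl z a u w : metric z (a *: u) w = a * metric z u w.
Proof. by rewrite /metric !dotE; ring. Qed.

Lemma metricNl z u w : metric z (- u) w = - metric z u w.
Proof. by rewrite -scaleN1r metricZl mulN1r. Qed.

Lemma metricDr z u v w : metric z w (u + v) = metric z w u + metric z w v.
Proof. by rewrite metricC metricDl !(metricC z w). Qed.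

Lemma metricZr z a u w : metric z w (a *: u) = a * metric z w u.
Proof. by rewrite metricC metricZl (metricC z w). Qed.

Lemma metricNr z u w : metric z w (- u) = - metric z w u.
Proof. by rewrite metricC metricNl (metricC z w). Qed.

Lemma metric0l z u : metric z 0 u = 0.
Proof. by rewrite -(scale0r u) metricZl mul0r. Qed.

Lemma metric0r z u : metric z u 0 = 0.
Proof. by rewrite metricC metric0l. Qed.

Lemma metricJJ z u v : metric z (J u) (J v) = metric z u v.
Proof. by rewrite /metric !dotE; ring. Qed.

Lemma metricJl z u v : metric z (J u) v = - metric z u (J v).
Proof. by rewrite -metricJJ JJ metricNl. Qed.

Lemma metric_ge z u : CH z -> 4 * rdot u u / (1 - rdot z z) <= metric z u u.
Proof.
move=> /CH_gt0 z1; rewrite /metric -mulrA ler_pM2l ?ltr0n // lerDl.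
by rewrite divr_ge0 ?sqr_ge0 // addr_ge0 // -expr2 sqr_ge0.
Qed.

Lemma metric_eq0 z u : CH z -> metric z u u = 0 -> u = 0.
Proof.
move=> z1 u0; apply: rdot_eq0; apply/eqP; rewrite eq_le rdot_ge0 andbT.
have := metric_ge u z1; rewrite u0 ler_pdivrMr ?CH_gt0 // mul0r.
by rewrite pmulr_rle0.
Qed.

End HermitianAlgebra.

Lemma cvec_eq (R : realType) (n : nat) (z w : Cvec R n) :
  z.1 = w.1 -> z.2 = w.2 -> z = w.
Proof. by case: z w => x y [x' y'] /= -> ->. Qed.

Ltac cvec_coord := apply: cvec_eq; apply/rowP => ?; rewrite ?mxE.

(** * Orthogonal projection onto finitely generated subspaces *)

Section OrthogonalDecomposition.
Variables (R : realType) (V : lmodType R) (g : V -> V -> R).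
Hypothesis gC : forall u v, g u v = g v u.
Hypothesis gD : forall u v w, g (u + v) w = g u w + g v w.
Hypothesis gZ : forall a u w, g (a *: u) w = a * g u w.
Hypothesis g_eq0 : forall u, g u u = 0 -> u = 0.
Variable P : V -> Prop.
Hypothesis P0 : P 0.
Hypothesis PD : forall a u v, P u -> P v -> P (a *: u + v).

(** Gram-Schmidt: [y] is the projection of [v] onto the span of [s]. The span itself is not
    mentioned; it is replaced by the subspace [P] and by orthogonality to everything that is
    orthogonal to [s], which is what the induction consumes. *)
Lemma orth_seq (s : seq V) (v : V) : (forall x, x \in s -> P x) ->
  exists y, [/\ P y, forall w, (forall x, x \in s -> g w x = 0) -> g w y = 0
    & forall x, x \in s -> g (v - y) x = 0].
Proof.
have gN u w : g (- u) w = - g u w by rewrite -scaleN1r gZ mulN1r.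
have gDr u w t : g t (u + w) = g t u + g t w by rewrite gC gD !(gC t).
have gZr a u t : g t (a *: u) = a * g t u by rewrite gC gZ (gC t).
have gNr u t : g t (- u) = - g t u by rewrite gC gN (gC t).
have g0 t : g t 0 = 0 by rewrite -(scale0r 0) gZr mul0r.
elim: s v => [|x s IH] v Ps.
  by exists 0; split.
have Ps' y : y \in s -> P y by move=> ys; apply: Ps; rewrite inE ys orbT.
have [p [Pp ps hp]] := IH x Ps'; have [q [Pq qs hq]] := IH v Ps'.
pose c := g (v - q) (x - p) / g (x - p) (x - p).
(* If [x] is already in the span of the tail, the denominator of [c] is 0; then definiteness gives
   [x = p] and both sides vanish. *)
have cE : c * g (x - p) (x - p) = g (v - q) (x - p).
  have [r0|r0] := eqVneq (g (x - p) (x - p)) 0.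
    by rewrite r0 mulr0 (g_eq0 r0) g0.
  by rewrite /c divfK.
exists (c *: (x - p) + q); split.
- apply: PD => //; rewrite -[x - p]/(x + - p) addrC -scaleN1r; apply: PD => //.
  by apply: Ps; rewrite inE eqxx.
- move=> w ws; rewrite gDr gZr gDr gNr ws ?inE ?eqxx // ps ?qs //.
  + by rewrite subr0 mulr0 addr0.
  + by move=> y ys; apply: ws; rewrite inE ys orbT.
  + by move=> y ys; apply: ws; rewrite inE ys orbT.
- have xs y : y \in s -> g (v - (c *: (x - p) + q)) y = 0.
    move=> ys; rewrite opprD addrCA addrC gD hq // gN gZ hp //.
    by rewrite mulr0 subr0.
  move=> y; rewrite inE => /orP[/eqP->|]; last exact: xs.
  have -> : forall w, g w x = g w (x - p) + g w p by move=> w; rewrite -gDr subrK.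
  by rewrite (ps _ xs) addr0 opprD addrCA addrC gD gN gZ cE subrr.
Qed.

End OrthogonalDecomposition.

(** The form is abstract because the lemma serves both the Euclidean product of the chart and the
    hyperbolic metric at a point. *)
Lemma orth_proj (R : realType) (V : lmodType R) (g : V -> V -> R) m
    (A : {linear 'rV[R]_m -> V}) (v : V) :
  (forall u v, g u v = g v u) ->
  (forall u v w, g (u + v) w = g u w + g v w) ->
  (forall a u w, g (a *: u) w = a * g u w) ->
  (forall u, g u u = 0 -> u = 0) ->
  exists d, forall d', g (v - A d) (A d') = 0.
Proof.
move=> gC gD gZ g0.
pose P u := exists d, u = A d.
have P0 : P 0 by exists 0; rewrite linear0.
have PD a u w : P u -> P w -> P (a *: u + w).
  by move=> [d ->] [d' ->]; exists (a *: d + d'); rewrite linearP.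
have [|y [[d ->] _ H]] := @orth_seq R V g gC gD gZ g0 P P0 PD
   [seq A (delta_mx 0 i) | i : 'I_m] v.
  by move=> x /mapP[i _ ->]; exists (delta_mx 0 i).
exists d => d'; rewrite (row_sum_delta d') linear_sum /=.
have gDr u w t : g t (u + w) = g t u + g t w by rewrite gC gD !(gC t).
have gZr a u t : g t (a *: u) = a * g t u by rewrite gC gZ (gC t).
apply: (big_ind (fun x => g (v - A d) x = 0)).
- by rewrite -(scale0r 0) gZr mul0r.
- by move=> a b ha hb; rewrite gDr ha hb addr0.
- move=> i _; rewrite linearZ /= gZr H ?mulr0 //.
  by apply: map_f; rewrite mem_enum.
Qed.

Section Rank.
Variables (R : realType) (n : nat).

Lemma injective_dim a b (A : {linear 'rV[R]_a -> 'rV[R]_b}) :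
  (forall x, A x = 0 -> x = 0) -> (a <= b)%N /\ exists L : {linear 'rV[R]_b -> 'rV[R]_a}, cancel A L.
Proof.
move=> Ai.
have fr : row_free (lin1_mx A).
  rewrite -kermx_eq0; apply/eqP/row_matrixP => i; rewrite row0.
  by apply: Ai; rewrite -mul_rV_lin1 -row_mul mulmx_ker row0.
split; first by rewrite -(eqP fr) rank_leq_col.
have [B AB] := row_freeP fr.
exists (mulmxr B) => x /=.
by rewrite -mul_rV_lin1 -mulmxA AB mulmx1.
Qed.

(** Flattening to a single row of length 2n makes matrix rank available for dimension counts. *)
Definition rv_of_cvec (z : Cvec R n) : 'rV[R]_(n + n) := row_mx z.1 z.2.
Definition cvec_of_rv (x : 'rV[R]_(n + n)) : Cvec R n := (lsubmx x, rsubmx x).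

Lemma rv_of_cvecK : cancel rv_of_cvec cvec_of_rv.
Proof. by case=> x y; rewrite /cvec_of_rv row_mxKl row_mxKr. Qed.

Lemma cvec_of_rvK : cancel cvec_of_rv rv_of_cvec.
Proof. by move=> x; rewrite /rv_of_cvec hsubmxK. Qed.

Fact rv_of_cvec_linear : linear rv_of_cvec.
Proof. by move=> a [x y] [x' y']; rewrite /rv_of_cvec /= scale_row_mx add_row_mx. Qed.
HB.instance Definition _ := GRing.isLinear.Build R (Cvec R n) 'rV[R]_(n + n) _
  rv_of_cvec rv_of_cvec_linear.

Fact cvec_of_rv_linear : linear cvec_of_rv.
Proof. by move=> a x y; rewrite /cvec_of_rv !linearP. Qed.
HB.instance Definition _ := GRing.isLinear.Build R 'rV[R]_(n + n) (Cvec R n) _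
  cvec_of_rv cvec_of_rv_linear.

End Rank.

(** * Directional derivatives *)

Section DirectionalDerivatives.
Variables (R : realType) (V W : normedModType R).
Implicit Types (f : V -> W) (x v : V).

Lemma is_deriveP f x v (d : W) : is_derive x v f d <->
  (fun h : R => h^-1 *: (f (h *: v + x) - f x)) @ 0^' --> d.
Proof.
split=> [[c <-]|c]; first exact: c.
split; first by apply/cvg_ex; exists d; exact: c.
by apply: cvg_lim; first exact: norm_hausdorff.
Qed.

Lemma is_derive_unique f x v (d d' : W) :
  is_derive x v f d -> is_derive x v f d' -> d = d'.
Proof. by move=> [_ <-] [_ <-]. Qed.

Lemma is_derive_cvg f x v (d : W) : is_derive x v f d ->
  (fun h : R => f (h *: v + x)) @ 0^' --> f x.
Proof.
move=> [/derivable1P/derivable1_diffP/differentiable_continuous c _].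
by have := (continuous_withinNx _ _).1 c; rewrite scale0r add0r.
Qed.

End DirectionalDerivatives.

Section DerivativeRules.
Variables (R : realType) (V W U : normedModType R).
Implicit Types (f : V -> W) (x v : V).

Lemma is_derive_linear (L : {linear W -> U}) f x v (d : W) : continuous L ->
  is_derive x v f d -> is_derive x v (fun y => L (f y)) (L d).
Proof.
move=> Lc /is_deriveP fd; apply/is_deriveP.
rewrite (_ : (fun h => _) = L \o (fun h : R => h^-1 *: (f (h *: v + x) - f x))).
  exact: (continuous_cvg _ (Lc d) fd).
by apply/funext => h /=; rewrite [RHS]linearZ /=; congr (_ *: _); rewrite linearB.
Qed.

Lemma is_derive_scale (k : V -> R) f x v dk d :
  is_derive x v k dk -> is_derive x v f d ->
  is_derive x v (fun y => k y *: f y) (dk *: f x + k x *: d).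
Proof.
move=> kd fd; have fc := is_derive_cvg fd.
move/is_deriveP: kd => kd; move/is_deriveP: fd => fd; apply/is_deriveP.
rewrite (_ : (fun h => _) = (fun h : R =>
  (h^-1 *: (k (h *: v + x) - k x)) *: f (h *: v + x)
  + k x *: (h^-1 *: (f (h *: v + x) - f x)))).
  apply: cvgD.
    by apply: (cvg_comp2 kd fc (@scale_continuous _ _ (_, _))).
  by apply: (cvg_comp2 (cvg_cst _) fd (@scale_continuous _ _ (_, _))).
apply/funext => h; rewrite -[_ *: (k _ - k x)]/(_ * _) -scalerA.
rewrite [k x *: (_^-1 *: _)]scalerA [k x * _]mulrC -scalerA -scalerDr scalerBl.
by rewrite [k x *: (_ - _)]scalerBr addrA subrK.
Qed.

Lemma differentiable_is_derive f x v :
  differentiable f x -> is_derive x v f ('D_v f x).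
Proof. by move=> fd; split=> //; exact: diff_derivable. Qed.

Lemma is_derive_shiftl f x v (b : V) d : is_derive (b + x) v f d ->
  is_derive x v (fun y => f (b + y)) d.
Proof.
move=> /is_deriveP H; apply/is_deriveP; move: H; apply: cvg_trans.
by under eq_fun do rewrite addrCA; exact: cvg_id.
Qed.

Lemma differentiable_line f x v (t : R) :
  differentiable f (t *: v + x) ->
  is_derive t 1 (fun s : R => f (s *: v + x)) ('D_v f (t *: v + x)).
Proof.
move=> /(@differentiable_is_derive _ _ v)/is_deriveP H; apply/is_deriveP.
rewrite (_ : (fun h => _) = (fun h : R =>
  h^-1 *: (f (h *: v + (t *: v + x)) - f (t *: v + x)))) //.
by apply/funext => h; rewrite scalerDl addrA [h *: 1]mulr1.
Qed.

End DerivativeRules.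

(** * Mean value theorem and symmetry of mixed derivatives *)

Section MeanValue.
Variables (R : realType) (V : normedModType R).

Lemma mean_value (g : V -> R) (x v : V) :
  (forall t : R, 0 <= t <= 1 -> differentiable g (t *: v + x)) ->
  exists2 t : R, 0 <= t <= 1 & g (v + x) - g x = 'D_v g (t *: v + x).
Proof.
move=> gd.
have [|||t] := @MVT_segment R (fun s => g (s *: v + x))
  (fun s => 'D_v g (s *: v + x)) 0 1.
- exact: ler01.
- move=> t; rewrite in_itv /= => /andP[t0 t1].
  by apply: differentiable_line; apply: gd; rewrite !ltW.
- apply: derivable_within_continuous => t; rewrite in_itv /= => t01.
  have [] := differentiable_line (gd t t01); exact.
rewrite in_itv /= => t01; rewrite scale1r scale0r add0r subr0 mulr1 => H.
by exists t.
Qed.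

Lemma continuous_near_dist (W : normedModType R) (g : V -> W) (x : V) (e : R) :
  {for x, continuous g} -> 0 < e -> \forall y \near x, `|g y - g x| < e.
Proof.
by move=> /cvgrPdist_lt gc e0; apply: filterS (gc e e0) => y; rewrite distrC.
Qed.

(* The second difference [D] over the parallelogram spanned by [h u] and
   [h w] is [h^2] times a value of either mixed derivative. *)
Lemma mixed_derivative_sym (g gu gw guw gwu : V -> R) (O : set V) (x u w : V) :
  open O -> O x ->
  (forall y, O y -> differentiable g y) ->
  (forall y, O y -> differentiable gu y) ->
  (forall y, O y -> differentiable gw y) ->
  (forall y, O y -> 'D_u g y = gu y) -> (forall y, O y -> 'D_w g y = gw y) ->
  (forall y, O y -> 'D_w gu y = guw y) -> (forall y, O y -> 'D_u gw y = gwu y) ->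
  {for x, continuous guw} -> {for x, continuous gwu} -> guw x = gwu x.
Proof.
move=> oO Ox gd gud gwd guE gwE guwE gwuE cwu cuw.
(* The pair is ordered: the mean value theorem is applied first along [a], then along [b]. Using it
   for both orders gives the same second difference two expressions. *)
have key (a b : V) (ga gab : V -> R) (e : R) :
    (forall y, O y -> differentiable ga y) ->
    (forall y, O y -> 'D_a g y = ga y) -> (forall y, O y -> 'D_b ga y = gab y) ->
    {for x, continuous gab} -> 0 < e ->
    \forall h \near (0 : R)^'+, exists2 d, `|d - gab x| < e &
      g (h *: a + h *: b + x) - g (h *: a + x) - g (h *: b + x) + g x = h ^+ 2 * d.
  move=> gad gaE gabE cba e0.
  have : \forall y \near x, O y /\ `|gab y - gab x| < e.
    near=> y; split; near: y; first exact: open_nbhs_nbhs.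
    exact: continuous_near_dist.
  move=> /nbhs_ballP[r /= r0 rB].
  (* With [h] below this bound the whole parallelogram stays in the ball; the added 1 covers the
     case where [a] and [b] both vanish. *)
  have rP : 0 < r / (`|a| + `|b| + 1) by rewrite divr_gt0 // ltr_wpDl // addr_ge0.
  near=> h.
  have h0 : 0 < h by near: h; exact: nbhs_right_gt.
  have hr : h < r / (`|a| + `|b| + 1) by near: h; exact: nbhs_right_lt.
  have hr' : h * (`|a| + `|b|) < r.
    move: hr; rewrite ltr_pdivlMr; last by rewrite ltr_wpDl // addr_ge0.
    by apply: le_lt_trans; rewrite ler_wpM2l ?(ltW h0) // lerDl.
  have inB (s t : R) : 0 <= s <= 1 -> 0 <= t <= 1 ->
      ball x r (s *: (h *: a) + (t *: (h *: b) + x)).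
    move=> /andP[s0 s1] /andP[t0 t1]; rewrite -ball_normE /= addrA opprD addrCA.
    rewrite subrr addr0 normrN; apply: le_lt_trans hr'.
    rewrite (le_trans (ler_normD _ _)) // !normrZ !ger0_norm ?(ltW h0) // mulrDr.
    by rewrite lerD // ler_piMl // mulr_ge0 // ltW.
  pose f1 (y : V) := g (h *: b + y) - g y.
  have f1d (y : V) : O y -> O (h *: b + y) ->
      differentiable f1 y /\
      'D_(h *: a) f1 y = h * (ga (h *: b + y) - ga y).
    move=> Oy Oby.
    have d1 : differentiable (fun z => g (h *: b + z)) y.
      apply: (@differentiable_comp _ _ _ _ (fun z => h *: b + z) g).
        exact: differentiableD.
      exact: gd.
    have d2 : differentiable f1 y by apply: differentiableB => //; exact: gd.
    split=> //; rewrite deriveE // linearZ /= -deriveE //; congr (_ * _).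
    rewrite -(gaE _ Oby) -(gaE _ Oy).
    have [_ <-] := @is_deriveB _ _ _ (fun z => g (h *: b + z)) g y a
      ('D_a g (h *: b + y)) ('D_a g y)
      (is_derive_shiftl (differentiable_is_derive a (gd _ Oby)))
      (differentiable_is_derive a (gd _ Oy)).
    by [].
  have Or y : ball x r y -> O y by move=> /rB[].
  have [t t01 Et] : exists2 t : R, 0 <= t <= 1 &
      f1 (h *: a + x) - f1 x = 'D_(h *: a) f1 (t *: (h *: a) + x).
    apply: mean_value => t t01; apply: (f1d _ _ _).1; apply: Or.
      by have := inB t 0 t01; rewrite scale0r add0r; apply; rewrite lexx ler01.
    by have := inB t 1 t01; rewrite scale1r addrCA; apply; rewrite lexx ler01.
  have Ot : O (t *: (h *: a) + x).
    by have := inB t 0 t01; rewrite scale0r add0r => /(_ _)/Or; apply; rewrite lexx ler01.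
  have Otb : O (h *: b + (t *: (h *: a) + x)).
    by have := inB t 1 t01; rewrite scale1r addrCA => /(_ _)/Or; apply; rewrite lexx ler01.
  have [s s01 Es] : exists2 s : R, 0 <= s <= 1 &
      ga (h *: b + (t *: (h *: a) + x)) - ga (t *: (h *: a) + x) =
      'D_(h *: b) ga (s *: (h *: b) + (t *: (h *: a) + x)).
    apply: (@mean_value ga) => s s01; apply: gad; rewrite addrCA.
    by apply: Or; apply: inB.
  have Oz : O (s *: (h *: b) + (t *: (h *: a) + x)).
    by rewrite addrCA; apply: Or; apply: inB.
  exists (gab (s *: (h *: b) + (t *: (h *: a) + x))).
    by rewrite addrCA; apply: (rB _ _).2; exact: inB.
  have := Et; rewrite (f1d _ Ot Otb).2 Es (deriveE _ (gad _ Oz)) linearZ /=.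
  rewrite -(deriveE _ (gad _ Oz)) (gabE _ Oz).
  rewrite /f1 -[h *: gab _]/(h * _) mulrA -expr2 => <-.
  by rewrite (addrA (h *: b)) (addrC (h *: b)); ring.
apply/eqP; rewrite -subr_eq0 -normr_le0; apply/ler_addgt0Pl => e e0.
rewrite addr0; have e2 : 0 < e / 2 by rewrite divr_gt0.
near (0 : R)^'+ => h.
have h0 : 0 < h by near: h; exact: nbhs_right_gt.
have [d1 d1e E1] : exists2 d, `|d - guw x| < e / 2 &
      g (h *: u + h *: w + x) - g (h *: u + x) - g (h *: w + x) + g x = h ^+ 2 * d.
  by near: h; exact: (key u w gu).
have [d2 d2e E2] : exists2 d, `|d - gwu x| < e / 2 &
      g (h *: w + h *: u + x) - g (h *: w + x) - g (h *: u + x) + g x = h ^+ 2 * d.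
  by near: h; exact: (key w u gw).
have dd : d1 = d2.
  apply: (@mulfI _ (h ^+ 2)); first by rewrite expf_neq0 // gt_eqF.
  by rewrite -E1 -E2 (addrC (h *: w) (h *: u)); ring.
rewrite -dd in d2e; rewrite distrC in d1e.
have -> : guw x - gwu x = (guw x - d1) + (d1 - gwu x) by rewrite addrA subrK.
by rewrite (le_trans (ler_normD _ _)) // (splitr e) lerD // ltW.
Unshelve. all: by end_near. Qed.

End MeanValue.

Section FiniteDimension.
Variables (R : realType) (m : nat) (W : normedModType R).

Lemma row_norm_coord (d : 'rV[R]_m) i : `|d 0 i| <= `|d|.
Proof.
rewrite [leRHS]mx_normrE.
exact: (le_bigmax _ (fun ij : 'I_1 * 'I_m => `|d ij.1 ij.2|) (0, i)).
Qed.

Lemma linear_row_bound (A : {linear 'rV[R]_m -> W}) d :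
  `|A d| <= `|d| * \sum_i `|A (delta_mx 0 i)|.
Proof.
rewrite {1}(row_sum_delta d) linear_sum mulr_sumr /=.
rewrite (le_trans (ler_norm_sum _ _ _)) //; apply: ler_sum => i _.
by rewrite linearZ /= normrZ ler_wpM2r // row_norm_coord.
Qed.

Lemma linear_row_continuous (A : {linear 'rV[R]_m -> W}) : continuous A.
Proof.
apply: bounded_linear_continuous; apply/linear_boundedP.
near=> M => d; rewrite (le_trans (linear_row_bound A d)) // mulrC ler_wpM2r //.
Unshelve. all: by end_near. Qed.

End FiniteDimension.

Section CvecContinuity.
Variables (R : realType) (n : nat) (W : normedModType R).

Lemma linear_cvec_continuous (A : {linear Cvec R n -> W}) : continuous A.
Proof.
pose A1 (x : 'rV[R]_n) := A (x, 0); pose A2 (x : 'rV[R]_n) := A (0, x).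
have l1 : linear A1.
  move=> a x y; rewrite /A1 -linearP; congr (A _).
  by apply/pair_equal_spec; split=> //=; rewrite scaler0 addr0.
have l2 : linear A2.
  move=> a x y; rewrite /A2 -linearP; congr (A _).
  by apply/pair_equal_spec; split=> //=; rewrite scaler0 addr0.
pose L1 : {linear _ -> _} := HB.pack A1 (GRing.isLinear.Build _ _ _ _ _ l1).
pose L2 : {linear _ -> _} := HB.pack A2 (GRing.isLinear.Build _ _ _ _ _ l2).
have -> : (A : _ -> _) = (fun z => L1 z.1) + (fun z => L2 z.2).
  apply/funext => -[x y]; rewrite fctE /L1 /L2 /= /A1 /A2 -linearD.
  by congr (A _); apply/pair_equal_spec; rewrite addr0 add0r.
move=> z; apply: cvgD.
  by apply: (cvg_comp _ _ cvg_fst); exact: linear_row_continuous.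
by apply: (cvg_comp _ _ cvg_snd); exact: linear_row_continuous.
Qed.

Lemma J_linear : linear (@J R n).
Proof. by move=> a x y; rewrite JD JZ. Qed.
HB.instance Definition _ := GRing.isLinear.Build R (Cvec R n) (Cvec R n) _
  (@J R n) J_linear.

Lemma rdot_linear (t : Cvec R n) : linear (rdot t : _ -> R^o).
Proof. by move=> a x y; rewrite rdotDr rdotZr. Qed.
HB.instance Definition _ t := GRing.isLinear.Build R (Cvec R n) R^o _
  (@rdot R n t) (rdot_linear t).

End CvecContinuity.

Section CvecDerivatives.
Variables (R : realType) (n : nat) (V : normedModType R).
Implicit Types (f g : V -> Cvec R n) (x v : V).

Lemma J_continuous : continuous (@J R n).
Proof. exact: linear_cvec_continuous. Qed.

Lemma rdot_continuous (t : Cvec R n) : continuous (rdot t : _ -> R).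
Proof. exact: (@linear_cvec_continuous _ _ R^o (rdot t)). Qed.

Lemma is_derive_J f x v d : is_derive x v f d -> is_derive x v (fun y => J (f y)) (J d).
Proof. by apply: is_derive_linear; exact: J_continuous. Qed.

Lemma is_derive_rdot_cst t f x v d : is_derive x v f d ->
  is_derive x v (fun y => rdot t (f y)) (rdot t d).
Proof. by apply: (@is_derive_linear _ _ _ R^o (rdot t)); exact: rdot_continuous. Qed.

Lemma rdot_coord (z w : Cvec R n) : rdot z w =
  \sum_i (rdot (delta_mx 0 i, 0) z * rdot (delta_mx 0 i, 0) w
        + rdot (0, delta_mx 0 i) z * rdot (0, delta_mx 0 i) w).
Proof.
have D (x y : 'rV[R]_n) i :
  rdot (delta_mx 0 i, 0) (x, y) = x 0 i /\ rdot (0, delta_mx 0 i) (x, y) = y 0 i.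
  rewrite /rdot /dotv /=; split; rewrite (bigD1 i) //= big1.
  - rewrite big1 => [|j _]; first by rewrite !mxE !eqxx mul1r !addr0.
    by rewrite mxE mul0r.
  - by move=> j ji; rewrite !mxE (negPf ji) andbF mul0r.
  - rewrite mxE mul0r !add0r (bigD1 i) //= big1.
      by rewrite !mxE !eqxx mul1r !addr0.
    by move=> j ji; rewrite !mxE (negPf ji) andbF mul0r.
  - by move=> j ji; rewrite mxE mul0r.
case: z w => x y [x' y']; rewrite [LHS]/rdot {1 2}/dotv /= -big_split /=.
by apply: eq_bigr => i _; rewrite !(D _ _ i).1 !(D _ _ i).2.
Qed.

Lemma is_derive_rdot f g x v df dg : is_derive x v f df -> is_derive x v g dg ->
  is_derive x v (fun y => rdot (f y) (g y)) (rdot df (g x) + rdot (f x) dg).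
Proof.
move=> fd gd.
pose e1 i : Cvec R n := (delta_mx 0 i, 0); pose e2 i : Cvec R n := (0, delta_mx 0 i).
pose h i y : R := rdot (e1 i) (f y) * rdot (e1 i) (g y)
                + rdot (e2 i) (f y) * rdot (e2 i) (g y).
rewrite (_ : (fun y => _) = \sum_i h i); last first.
  by apply/funext => y; rewrite fct_sumE rdot_coord.
apply: is_derive_eq.
  apply: is_derive_sum => i; apply: is_deriveD; apply: is_deriveM;
    exact: is_derive_rdot_cst.
rewrite (rdot_coord df) (rdot_coord (f x)) -big_split /=; apply: eq_bigr => i _.
rewrite /GRing.scale /= /e1 /e2; ring.
Qed.

Lemma is_derive_idot f g x v df dg : is_derive x v f df -> is_derive x v g dg ->
  is_derive x v (fun y => idot (f y) (g y)) (idot df (g x) + idot (f x) dg).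
Proof. by move=> fd gd; apply: is_derive_rdot => //; exact: is_derive_J. Qed.

Lemma is_derive_cscale (a b : V -> R) f x v da db d :
  is_derive x v a da -> is_derive x v b db -> is_derive x v f d ->
  is_derive x v (fun y => cscale (a y) (b y) (f y))
    (cscale da db (f x) + cscale (a x) (b x) d).
Proof.
move=> ad bd fd; apply: is_derive_eq.
  apply: (@is_deriveD _ _ _ (fun y => a y *: f y) (fun y => b y *: J (f y))).
    exact: is_derive_scale.
  by apply: is_derive_scale => //; exact: is_derive_J.
by rewrite !cscaleE addrACA.
Qed.

End CvecDerivatives.

Lemma linear_left_inverse (R : realType) (n m : nat) (A : {linear 'rV[R]_m -> Cvec R n}) :
  (forall d, A d = 0 -> d = 0) ->
  exists2 L : {linear Cvec R n -> 'rV[R]_m}, continuous L & cancel A L.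
Proof.
move=> A0.
have [|_ [L LK]] := @injective_dim R m (n + n) (@rv_of_cvec R n \o A).
  by move=> d /= /(congr1 (@cvec_of_rv R n)); rewrite rv_of_cvecK linear0 => /A0.
exists (L \o @rv_of_cvec R n); first exact: linear_cvec_continuous.
by move=> d /=; exact: LK.
Qed.

Lemma linear_row_dist_bound (R : realType) (m : nat) (W : normedModType R)
    (A B : {linear 'rV[R]_m -> W}) (c : R) d :
  (forall i, `|A (delta_mx 0 i) - B (delta_mx 0 i)| <= c) ->
  `|A d - B d| <= c * `|d| *+ m.
Proof.
move=> AB; have E (C : {linear 'rV[R]_m -> W}) :
    C d = \sum_i d 0 i *: C (delta_mx 0 i).
  rewrite {1}(row_sum_delta d) linear_sum /=.
  by apply: eq_bigr => i _; rewrite linearZ.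
rewrite !E -sumrB.
rewrite (le_trans (ler_norm_sum _ _ _)) //.
rewrite -[X in _ *+ X]card_ord -sumr_const; apply: ler_sum => i _.
by rewrite -scalerBr normrZ mulrC ler_pM // row_norm_coord.
Qed.

(** * Immersions *)

Section Immersion.
Variables (R : realType) (n m : nat) (F : 'rV[R]_m -> Cvec R n).
Implicit Types (x d : 'rV[R]_m).

Definition image_space x : set (Cvec R n) := [set X | exists d, X = 'D_d F x].

Variable x0 : 'rV[R]_m.
Hypothesis Fd : \forall x \near x0, differentiable F x.
Hypothesis Fc : forall d, {for x0, continuous ('D_d F)}.
Hypothesis Fi : forall d, 'D_d F x0 = 0 -> d = 0.

Let Fd0 : differentiable F x0. Proof. exact: nbhs_singleton Fd. Qed.

Lemma derive_near (e : R) : 0 < e ->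
  \forall x \near x0, forall d, `|'D_d F x - 'D_d F x0| <= e * `|d|.
Proof.
(* The errors on the [m] basis vectors add up; [m.+1] instead of [m] keeps the quotient positive
   when [m] is 0. *)
move=> e0; have e'0 : 0 < e / m.+1%:R by rewrite divr_gt0.
have H (i : 'I_m) : \forall x \near x0,
    `|'D_(delta_mx 0 i) F x - 'D_(delta_mx 0 i) F x0| < e / m.+1%:R.
  exact: continuous_near_dist.
have {}H : \forall x \near x0, forall i : 'I_m,
    `|'D_(delta_mx 0 i) F x - 'D_(delta_mx 0 i) F x0| < e / m.+1%:R.
  exact: (filter_forall _ H).
apply: filterS2 H Fd => x xH xd d.
have xH' i : `|'d F x (delta_mx 0 i) - 'd F x0 (delta_mx 0 i)| <= e / m.+1%:R.
  by have := xH i; rewrite !deriveE // => /ltW.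
rewrite !deriveE // (le_trans (linear_row_dist_bound _ xH')) //.
rewrite -mulrnAl -mulr_natl ler_wpM2r // mulrCA ler_piMr ?ltW //.
by rewrite ltr_pdivrMr // mul1r ltr_nat.
Qed.

(** A left inverse with Lipschitz constant [k] bounds the argument at [x0]. At nearby points the
    differential has moved by at most 1 / (2k), which costs half of [|d|], whence the factor 2. *)
Lemma image_lower_bound : exists2 k : R, 0 < k &
  \forall x \near x0, forall d, `|d| <= k * `|'D_d F x|.
Proof.
have [|L Lc LK] := @linear_left_inverse R n m ('d F x0).
  by move=> d; rewrite -deriveE //; exact: Fi.
have [k k0 Lk] := linear_lipschitz Lc.
exists (2 * k); first by rewrite mulr_gt0.
have e0 : 0 < (2 * k)^-1 by rewrite invr_gt0 mulr_gt0.
apply: filterS (derive_near e0) => x xH d.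
have H : `|d| <= k * (`|'D_d F x| + (2 * k)^-1 * `|d|).
  rewrite -{1}(LK d) (le_trans (Lk _)) // ler_pM2l // -deriveE //.
  have -> : 'D_d F x0 = 'D_d F x - ('D_d F x - 'D_d F x0) by rewrite subKr.
  by rewrite (le_trans (ler_normB _ _)) // lerD2l.
move: H; rewrite mulrDr mulrA invfM mulrCA divff ?gt_eqF // mulr1.
lra.
Qed.

Lemma image_space_orth X :
  (forall t, (forall d, rdot ('D_d F x0) t = 0) -> rdot X t = 0) ->
  image_space x0 X.
Proof.
move=> H; have [d hd] := @orth_proj R (Cvec R n) (@rdot R n) m ('d F x0) X
  (@rdotC R n) (@rdotDl R n) (@rdotZl R n) (@rdot_eq0 R n).
exists d; apply/eqP; rewrite -subr_eq0; apply/eqP/rdot_eq0.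
rewrite rdotDl rdotNl deriveE //.
have K t : rdot ('d F x0 t) (X - 'd F x0 d) = 0 by rewrite rdotC hd.
rewrite K subr0 H // => t; rewrite deriveE //.
Qed.

(* It suffices that each linear form vanishing on the image is negligible
   along [g]. *)
Lemma image_space_limit (g : R -> Cvec R n) X :
  g @ 0^' --> X ->
  (forall t, (forall d, rdot ('D_d F x0) t = 0) -> forall e, 0 < e ->
    \forall h \near 0^', `|rdot (g h) t| <= e * `|g h|) ->
  image_space x0 X.
Proof.
move=> gX H; apply: image_space_orth => t t0.
apply/eqP; rewrite -normr_le0; apply/ler_addgt0Pl => e e0; rewrite addr0.
have X1 : 0 < `|X| + 1 by rewrite ltr_wpDl.
have e'0 : 0 < e / (`|X| + 1) by rewrite divr_gt0.
have gt : (fun h => rdot (g h) t) @ 0^' --> rdot X t.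
  rewrite rdotC; under eq_fun do rewrite rdotC.
  exact: (cvg_comp _ _ gX (@rdot_continuous R n t X)).
have e2 : 0 < e / 2 by rewrite divr_gt0.
have e3 : 0 < e / 2 / (`|X| + 1) by rewrite divr_gt0.
have h1 : \forall h \near 0^', `|rdot (g h) t - rdot X t| <= e / 2.
  exact: cvgr_distC_le _ _ gt _ e2.
have h3 : \forall h \near 0^', `|g h| <= `|X| + 1.
  apply: filterS (cvgr_distC_le _ _ gX _ ltr01) => h gh.
  by rewrite -[g h](subrK X) addrC (le_trans (ler_normD _ _)) // lerD2l.
have [h [{}h1 h2 {}h3]] : exists h, [/\ `|rdot (g h) t - rdot X t| <= e / 2,
    `|rdot (g h) t| <= e / 2 / (`|X| + 1) * `|g h| & `|g h| <= `|X| + 1].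
  by apply: (@filter_ex _ (0 : R)^'); apply: filterS3 h1 (H t t0 _ e3) h3.
rewrite distrC in h1.
rewrite -[rdot X t](subrK (rdot (g h) t)) (le_trans (ler_normD _ _)) //.
rewrite (splitr e) lerD // (le_trans h2) //.
by rewrite -[leRHS](divfK (lt0r_neq0 X1)) ler_pM2l.
Qed.

(** The coefficient [d] of [g h] is bounded by a multiple of [|g h|], so replacing the differential
    at [y h] by the one at [x0] changes [g h] by a negligible amount. *)
Lemma image_space_closed (g : R -> Cvec R n) (y : R -> 'rV[R]_m) X :
  g @ 0^' --> X -> y @ 0^' --> x0 ->
  (\forall h \near 0^', image_space (y h) (g h)) -> image_space x0 X.
Proof.
move=> gX yx yg; apply: (image_space_limit gX) => t t0 e e0.
have [k k0 Hk] := image_lower_bound.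
have [K K0 HK] := linear_lipschitz (@rdot_continuous R n t).
have d0 : 0 < e / (K * k) by rewrite divr_gt0 // mulr_gt0.
have H1 : \forall h \near 0^', forall d, `|d| <= k * `|'D_d F (y h)| := yx _ Hk.
have H2 : \forall h \near 0^', forall d,
    `|'D_d F (y h) - 'D_d F x0| <= e / (K * k) * `|d| := yx _ (derive_near d0).
apply: filterS3 H1 H2 yg => h {}H1 {}H2 [d gE].
have -> : rdot (g h) t = rdot t (g h - 'D_d F x0).
  by rewrite rdotDr rdotNr (rdotC t ('D_d F x0)) t0 subr0 rdotC.
rewrite (le_trans (HK _)) // gE.
have {H1} := H1 d; have {H2} := H2 d.
move: ('D_d F (y h)) ('D_d F x0) => A B AB dA.
rewrite (@le_trans _ _ (K * (e / (K * k) * (k * `|A|)))) //.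
  by rewrite ler_pM2l // (le_trans AB) // ler_pM2l.
move: (`|A|) => a; rewrite le_eqVlt; apply/orP; left; apply/eqP.
by field; rewrite !gt_eqF.
Qed.

(** The difference quotients of [s - 'D_c F] lie in the image spaces at nearby points, so their
    limit lies in the image space at [x0]. Thus a section has the same derivative as a coordinate
    field modulo the image space, and nothing has to be known about the smoothness of its
    coefficients. *)
Lemma derive_section (s : 'rV[R]_m -> Cvec R n) (c v : 'rV[R]_m) ds dF :
  is_derive x0 v s ds -> is_derive x0 v ('D_c F) dF ->
  s x0 = 'D_c F x0 ->
  (\forall x \near x0, image_space x (s x)) -> image_space x0 (ds - dF).
Proof.
move=> sd Fcd s0 sI.
have gd : is_derive x0 v (fun x => s x - 'D_c F x) (ds - dF) := is_deriveB sd Fcd.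
have s00 : s x0 - 'D_c F x0 = 0 by rewrite s0 subrr.
have /is_deriveP gX := gd.
have yx : (fun h : R => h *: v + x0) @ 0^' --> x0.
  have /is_derive_cvg := is_derive_id x0 v; exact.
apply: (image_space_closed gX yx).
have H1 : \forall h \near (0 : R)^', image_space (h *: v + x0) (s (h *: v + x0))
  := yx _ sI.
have H2 : \forall h \near (0 : R)^', differentiable F (h *: v + x0) := yx _ Fd.
apply: filterS2 H1 H2 => h [d sE] xd.
exists (h^-1 *: (d - c)); rewrite s00 subr0 sE (deriveE d xd) (deriveE c xd).
by rewrite (deriveE _ xd) [RHS]linearZ /= [in RHS]linearB.
Qed.

(** This compares two parametrisations of a submanifold: a curve of one runs in the image of every
    small neighbourhood for the other, and its velocity is tangent without any differentiability of
    the transition map. *)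
Lemma image_space_curve (c : R -> Cvec R n) X :
  is_derive (0 : R) 1 c X -> c 0 = F x0 ->
  (forall U : set 'rV[R]_m, nbhs x0 U ->
     \forall h \near 0^', exists2 x, U x & c h = F x) ->
  image_space x0 X.
Proof.
move=> /is_deriveP cX c0 cU; apply: (image_space_limit cX) => t t0 e e0.
have [|L Lc LK] := @linear_left_inverse R n m ('d F x0).
  by move=> d; rewrite -deriveE //; exact: Fi.
have [k k0 Hk] := linear_lipschitz Lc.
have [K K0 HK] := linear_lipschitz (@rdot_continuous R n t).
(* The first bound gives [|y| <= 2 k |B|] below; with it, the second turns the first-order error
   into at most [e |B|] after applying [rdot t]. *)
pose d : R := Num.min ((2 * k)^-1) (e / (2 * k * K)).
have d0 : 0 < d.
  by rewrite lt_min invr_gt0 divr_gt0 // ?mulr_gt0 //.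
have : \forall x \near x0, `|F x - F x0 - 'd F x0 (x - x0)| <= d * `|x - x0|.
  have /eqaddoP/(_ d d0) H := diff_locally Fd0.
  rewrite (near_shift 0) subr0; apply: filterS H => y /=.
  rewrite -[(_ - (_ + _)) _]/((F \o shift x0) y - (F x0 + 'd F x0 y)).
  by rewrite /= addrK opprD addrA.
move=> /cU; apply: filterS => h [x hx cE].
have {}t0 : rdot t ('d F x0 (x - x0)) = 0 by rewrite rdotC -deriveE.
have {}LK := LK (x - x0).
rewrite addr0 -[h *: 1]/(h * 1) mulr1 c0 cE.
rewrite rdotZl normrM normrZ mulrCA ler_wpM2l // rdotC.
move: hx t0 LK; set A := 'd F x0 (x - x0); clearbody A.
move: (x - x0) (F x - F x0) => y B hx t0 LK.
have yB : `|y| <= 2 * k * `|B|.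
  have : `|y| <= k * (`|B| + (2 * k)^-1 * `|y|).
    rewrite -{1}LK (le_trans (Hk _)) // ler_pM2l //.
    have -> : A = B - (B - A) by rewrite subKr.
    rewrite (le_trans (ler_normB _ _)) // lerD2l (le_trans hx) // ler_wpM2r //.
    by rewrite ge_min lexx.
  rewrite mulrDr mulrA invfM mulrCA divff ?gt_eqF // mulr1; lra.
have -> : rdot t B = rdot t (B - A) by rewrite rdotDr rdotNr t0 subr0.
rewrite (le_trans (HK _)) // -ler_pdivlMl // (le_trans hx) //.
rewrite (@le_trans _ _ (e / (2 * k * K) * (2 * k * `|B|))) //.
  by apply: ler_pM => //; [exact: ltW | rewrite ge_min lexx orbT].
move: (`|B|) => b; rewrite le_eqVlt; apply/orP; left; apply/eqP.
by field; rewrite !gt_eqF.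
Qed.

End Immersion.

(** * Local surjectivity onto the tangential component *)

Lemma row_norm_le (R : realType) m (d : 'rV[R]_m) (c : R) :
  0 <= c -> (forall i, `|d 0 i| <= c) -> `|d| <= c.
Proof.
move=> c0 dc; rewrite [leLHS]mx_normrE; apply/bigmax_leP; split=> // -[i j] _ /=.
by rewrite (ord1 i).
Qed.

Section LocalImage.
Variables (R : realType) (n m : nat) (G : 'rV[R]_m -> Cvec R n).
Implicit Types (x d : 'rV[R]_m).
Variable x0 : 'rV[R]_m.
Hypothesis Gd : \forall x \near x0, differentiable G x.
Hypothesis Gc : forall d, {for x0, continuous ('D_d G)}.
Hypothesis Gi : forall d, 'D_d G x0 = 0 -> d = 0.

Let Gd0 : differentiable G x0. Proof. exact: nbhs_singleton Gd. Qed.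

(* Minimising [|L (y - G x)|] over a closed ball stands in for Newton's
   iteration [x |-> x + L (y - G x)], which halves that quantity. *)
Lemma local_surjectivity (U : set 'rV[R]_m) : nbhs x0 U ->
  exists2 L : {linear Cvec R n -> 'rV[R]_m}, (forall d, L ('D_d G x0) = d) &
    \forall y \near G x0, exists2 x, U x & L (G x) = L y.
Proof.
move=> U0; have [|L Lc LK] := @linear_left_inverse R n m ('d G x0).
  by move=> d; rewrite -deriveE //; exact: Gi.
have LD d : L ('D_d G x0) = d by rewrite deriveE.
exists L => //.
have [k k0 Lk] := linear_lipschitz Lc.
have e0 : 0 < (2 * k)^-1 by rewrite invr_gt0 mulr_gt0.
have : \forall x \near x0, [/\ differentiable G x, U x &
    forall d, `|'D_d G x - 'D_d G x0| <= (2 * k)^-1 * `|d|].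
  by apply: filterS3 Gd U0 (derive_near Gd Gc e0).
move=> /nbhs_ballP[r' /= r'0 rB].
pose r := r' / 2; have r0 : 0 < r by rewrite divr_gt0.
have rr' : r < r' by rewrite /r; move: r'0 => /=; lra.
pose B := [set x : 'rV[R]_m | `|x - x0| <= r].
have BB x : B x -> ball x0 r' x.
  by rewrite /B /= -ball_normE /= distrC => /le_lt_trans; apply.
(* The map [x - L (G x)] contracts by 1/2 on [B]. The estimate is made coordinate by coordinate,
   since [mean_value] concerns real functions. *)
have contr x x' : B x -> B x' -> `|(x - x') - L (G x - G x')| <= `|x - x'| / 2.
  move=> Bx Bx'; apply: row_norm_le => [|i]; first by rewrite divr_ge0.
  pose g (z : 'rV[R]_m) : R := z 0 i - L (G z) 0 i.
  pose pr (z : 'rV[R]_m) : R^o := z 0 i.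
  have prl : linear pr by move=> a z w; rewrite /pr !mxE.
  pose P : {linear _ -> _} := HB.pack pr (GRing.isLinear.Build _ _ _ _ _ prl).
  have Pc : continuous P by exact: linear_row_continuous.
  have gder z v : ball x0 r' z -> is_derive z v g (v 0 i - L ('D_v G z) 0 i).
    move=> /rB[zd _ _].
    have := is_derive_linear Pc (is_derive_linear Lc (differentiable_is_derive v zd)).
    move=> /(is_deriveB (is_derive_linear Pc (is_derive_id z v))); exact.
  have gdiff z : ball x0 r' z -> differentiable g z.
    move=> /rB[zd _ _]; apply: (@differentiableB _ _ _ P (P \o (L \o G))).
      exact: linear_differentiable.
    apply: differentiable_comp; last exact: linear_differentiable.
    apply: differentiable_comp => //; exact: linear_differentiable.
  have seg (t : R) : 0 <= t <= 1 -> B (t *: (x - x') + x').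
    move=> /andP[t0 t1]; rewrite /B /=.
    have -> : t *: (x - x') + x' - x0 = t *: (x - x0) + (1 - t) *: (x' - x0).
      by apply/rowP => j; rewrite !mxE; ring.
    rewrite (le_trans (ler_normD _ _)) // !normrZ !ger0_norm ?subr_ge0 //.
    have -> : r = t * r + (1 - t) * r by ring.
    by rewrite lerD // ler_wpM2l // subr_ge0.
  have [t t01] := @mean_value R _ g x' (x - x') (fun t t01 => gdiff _ (BB _ (seg t t01))).
  have [_ ->] := gder _ (x - x') (BB _ (seg t t01)).
  rewrite subrK /g => H.
  have -> : (x - x' - L (G x - G x')) 0 i =
      L ('D_(x - x') G x0 - 'D_(x - x') G (t *: (x - x') + x')) 0 i.
    have E (u w : 'rV[R]_m) : (u - w) 0 i = u 0 i - w 0 i by rewrite !mxE.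
    have := LD (x - x'); move: H.
    move: ('D_(x - x') G x0) ('D_(x - x') G (t *: (x - x') + x')) (G x) (G x').
    move=> a b p q + La; rewrite (linearB _ p) (linearB _ a) La !E => H.
    by rewrite -[in RHS]H; ring.
  rewrite (le_trans (row_norm_coord _ i)) // (le_trans (Lk _)) // distrC.
  have [_ _ /(_ (x - x'))] := rB _ (BB _ (seg t t01)).
  move=> /(ler_wpM2l (ltW k0))/le_trans; apply.
  rewrite mulrA [_ / 2]mulrC ler_wpM2r // invfM mulrCA divff ?gt_eqF // mulr1.
  by rewrite lexx.
have d0 : 0 < r / (2 * k) by rewrite divr_gt0 // mulr_gt0.
have : \forall y \near G x0, `|y - G x0| <= r / (2 * k).
  by apply: filterS (nbhsx_ballx _ _ d0) => y; rewrite -ball_normE /= distrC => /ltW.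
apply: filterS => y yG.
have Bx0 : B x0 by rewrite /B /= subrr normr0 ltW.
have Bcl : closed B.
  rewrite (_ : B = closed_ball_ (fun z => `|z|) x0 r); first exact: closed_closed_ball_.
  by apply/funext => x; rewrite /B /= distrC.
have Bc : compact B.
  apply: bounded_closed_compact => //; exists (r + `|x0|).
  split=> [|M rM x Bx]; first exact: num_real.
  apply: le_trans (ltW rM).
  by rewrite -{1}(subrK x0 x) (le_trans (ler_normD _ _)) // lerD2r.
have Lyc : {within B, continuous (fun x => `|L (y - G x)|)}.
  apply: continuous_in_subspaceT => x; rewrite inE => /BB/rB[xd _ _].
  have d1 : differentiable (fun z => y - G z) x.
    by apply: (@differentiableB _ _ _ (cst y) G).
  have d2 : differentiable (L \o (fun z => y - G z)) x.
    by apply: differentiable_comp d1 _; exact: linear_differentiable.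
  exact: cvg_norm (differentiable_continuous d2).
have [|c /[!inE] Bc' cmin] := @EVT_min_rV R m _ B _ Bc Lyc; first by exists x0.
exists c; first by have [] := rB _ (BB _ Bc').
pose c' := c + L (y - G c).
have c'c : c' - c = L (y - G c) by rewrite /c' addrC addKr.
(* Half of the radius pays for the contraction towards [x0], the other half for the distance from
   [y] to [G x0]. *)
have Bc'' : B c'.
  rewrite /B /=.
  have -> : c' - x0 = ((c - x0) - L (G c - G x0)) + L (y - G x0).
    have -> : L (y - G x0) = L (G c - G x0) + L (y - G c).
      by rewrite -linearD [in RHS]addrC addrA subrK.
    by rewrite /c' addrA subrK addrAC.
  rewrite (le_trans (ler_normD _ _)) // [r]splitr lerD //.
    by rewrite (le_trans (contr _ _ Bc' Bx0)) // ler_wpM2r.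
  rewrite (le_trans (Lk _)) // (le_trans (ler_wpM2l (ltW k0) yG)) //.
  have -> : k * (r / (2 * k)) = r / 2 by field; rewrite gt_eqF.
  exact: lexx.
have := cmin c'; rewrite inE => /(_ Bc'').
have -> : L (y - G c') = (c' - c) - L (G c' - G c).
  by rewrite c'c -linearB; congr (L _); rewrite opprB addrA subrK.
move=> /le_trans/(_ (contr _ _ Bc'' Bc')); rewrite c'c => H.
have /eqP : `|L (y - G c)| = 0 by apply/eqP; rewrite eq_le normr_ge0 andbT; move: H; lra.
by rewrite normr_eq0 linearB subr_eq0 => /eqP ->.
Qed.

End LocalImage.

(** * Immersions whose second derivatives are tangent *)

Lemma sumr_ge_term (R : numDomainType) (I : finType) (F : I -> R) i :
  (forall j, 0 <= F j) -> F i <= \sum_j F j.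
Proof. by move=> F0; rewrite (bigD1 i) //= lerDl sumr_ge0. Qed.

Lemma ball_segment (R : realType) (m : nat) (x0 x y : 'rV[R]_m) (r s : R) :
  ball x0 r x -> ball x0 r y -> 0 <= s <= 1 -> ball x0 r (s *: (y - x) + x).
Proof.
rewrite -!ball_normE /= => Bx By /andP[s0 s1].
have -> : x0 - (s *: (y - x) + x) = s *: (x0 - y) + (1 - s) *: (x0 - x).
  by apply/rowP => l; rewrite !mxE; ring.
rewrite (le_lt_trans (ler_normD _ _)) // !normrZ !ger0_norm ?subr_ge0 //.
have [->|sn0] := eqVneq s 0; first by rewrite mul0r add0r subr0 mul1r.
have -> : r = s * r + (1 - s) * r by ring.
by rewrite ltr_leD // ?ltr_pM2l ?lt0r ?sn0 // ler_wpM2l ?subr_ge0 // ltW.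
Qed.

Section FlatImage.
Variables (R : realType) (n m : nat) (G : 'rV[R]_m -> Cvec R n).
Implicit Types (x d : 'rV[R]_m).
Variable x0 : 'rV[R]_m.
Hypothesis Gd : \forall x \near x0, differentiable G x.
Hypothesis Gdd : forall d, \forall x \near x0, differentiable ('D_d G) x.
Hypothesis Gcc : forall d d', {for x0, continuous ('D_d ('D_d' G))}.
Hypothesis Gi : forall d, 'D_d G x0 = 0 -> d = 0.
Hypothesis Gflat : \forall x \near x0, forall d d',
  image_space G x ('D_d ('D_d' G) x).

Let e (i : 'I_m) : 'rV[R]_m := delta_mx 0 i.

Lemma derive_basis x d : differentiable G x ->
  'D_d G x = \sum_i d 0 i *: 'D_(e i) G x.
Proof.
move=> xd; rewrite deriveE // {1}(row_sum_delta d) linear_sum /=.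
by apply: eq_bigr => i _; rewrite linearZ /= deriveE.
Qed.

(** By flatness the components along [t] of the first derivatives satisfy a homogeneous linear
    system with bounded coefficients, so they vanish on the ball once they vanish at one point. The
    radius depends neither on that point nor on [t]. *)
Lemma image_space_locally_constant : exists2 r : R, 0 < r &
  forall x1 x t, ball x0 r x1 -> ball x0 r x ->
    (forall d, rdot ('D_d G x1) t = 0) -> forall d, rdot ('D_d G x) t = 0.
Proof.
have Gc d : {for x0, continuous ('D_d G)}.
  exact: differentiable_continuous (nbhs_singleton (Gdd d)).
have [k k0 Hk] := image_lower_bound Gd Gc Gi.
pose C1 : R := \sum_i `|'D_(e i) G x0| + 1.
pose C2 : R := \sum_i \sum_j `|'D_(e i) ('D_(e j) G) x0| + 1.
have C1_gt0 : 0 < C1 by rewrite ltr_wpDl // sumr_ge0.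
have C2_gt0 : 0 < C2 by rewrite ltr_wpDl // sumr_ge0 // => i _; rewrite sumr_ge0.
have near1 (H : 'rV[R]_m -> Cvec R n) : {for x0, continuous H} ->
    \forall x \near x0, `|H x| <= `|H x0| + 1.
  move=> /continuous_near_dist/(_ ltr01); apply: filterS => x Hx.
  rewrite -{1}(subrK (H x0) (H x)) addrC (le_trans (ler_normD _ _)) // lerD2l.
  exact: ltW.
have H1 : \forall x \near x0, forall i, `|'D_(e i) G x| <= C1.
  have H i : \forall x \near x0, `|'D_(e i) G x| <= C1.
    apply: filterS (near1 _ (Gc (e i))) => x xH.
    apply: (le_trans xH); rewrite /C1 lerD2r.
    by apply: (@sumr_ge_term _ _ (fun l => `|'D_(e l) G x0|)) => j.
  exact: (filter_forall _ H).
have H2 : \forall x \near x0, forall i j, `|'D_(e i) ('D_(e j) G) x| <= C2.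
  have H i j : \forall x \near x0, `|'D_(e i) ('D_(e j) G) x| <= C2.
    have := near1 ('D_(e i) ('D_(e j) G)) (@Gcc (e i) (e j)).
    apply: filterS => x xH.
    apply: (le_trans xH); rewrite /C2 lerD2r.
    apply: (le_trans (@sumr_ge_term _ _ (fun l => `|'D_(e i) ('D_(e l) G) x0|) j _)) => //.
    apply: (@sumr_ge_term _ _ (fun q => \sum_l `|'D_(e q) ('D_(e l) G) x0|)) => q.
    by rewrite sumr_ge0.
  have H' i : \forall x \near x0, forall j, `|'D_(e i) ('D_(e j) G) x| <= C2.
    exact: (filter_forall _ (H i)).
  exact: (filter_forall _ H').
have H3 : \forall x \near x0, forall i, differentiable ('D_(e i) G) x.
  exact: (filter_forall _ (fun i => Gdd (e i))).
have {H1 H2 H3} : \forall x \near x0, [/\ differentiable G x,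
    (forall i, differentiable ('D_(e i) G) x),
    (forall i, `|'D_(e i) G x| <= C1),
    (forall i j, `|'D_(e i) ('D_(e j) G) x| <= C2) &
    (forall d, `|d| <= k * `|'D_d G x|) /\
    (forall d d', image_space G x ('D_d ('D_d' G) x))].
  have H4 : \forall x \near x0, (forall d, `|d| <= k * `|'D_d G x|) /\
    (forall d d', image_space G x ('D_d ('D_d' G) x)) by apply: filterS2 Hk Gflat.
  have H5 : \forall x \near x0, (forall i, `|'D_(e i) G x| <= C1) /\
    (forall i j, `|'D_(e i) ('D_(e j) G) x| <= C2) by apply: filterS2 H1 H2.
  have H6 : \forall x \near x0, differentiable G x /\
    (forall i, differentiable ('D_(e i) G) x) by apply: filterS2 Gd H3.
  by apply: filterS3 H4 H5 H6 => x ? [? ?] [? ?]; split.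
move=> /nbhs_ballP[r' /= r'0 rB].
pose M : R := m.+1%:R.
have M0 : 0 < M by rewrite ltr0n.
have mM : m%:R <= M by rewrite ler_nat.
(* Two points of the ball are at distance at most 2r, so the coefficients [c] of the second
   derivative are at most 2 r k M C2; summing [M] terms of size [|c| N] gives (4 M M k C2) r N / 2,
   which must not exceed N / 2. *)
pose r : R := Num.min r' (4 * M * M * k * C2)^-1.
have r0 : 0 < r by rewrite lt_min r'0 invr_gt0 !mulr_gt0.
exists r; first exact: r0.
move=> x1 x t Bx1 Bx t0.
have rr' y : ball x0 r y -> ball x0 r' y by apply: le_ball; rewrite ge_min lexx.
have [K K0 HK] := linear_lipschitz (@rdot_continuous R n t).
(* Mean value along the segment from [x1], where all the components vanish,
   halves any common bound of the components on the ball. *)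
have step (N : R) : 0 <= N ->
    (forall y, ball x0 r y -> forall i, `|rdot t ('D_(e i) G y)| <= N) ->
    (forall y, ball x0 r y -> forall i, `|rdot t ('D_(e i) G y)| <= N / 2).
  move=> N0 HN y By j.
  have seg (s : R) : 0 <= s <= 1 -> ball x0 r (s *: (y - x1) + x1) := ball_segment Bx1 By.
  pose g z : R := rdot t ('D_(e j) G z).
  have gd z : ball x0 r z -> differentiable g z.
    move=> /rr'/rB[_ zd _ _ _].
    apply: (@differentiable_comp _ _ _ _ ('D_(e j) G) (rdot t : _ -> R)) => //.
    by apply: (@linear_differentiable _ _ R (rdot t)); exact: rdot_continuous.
  have [s s01 Es] := @mean_value R _ g x1 (y - x1) (fun s s01 => gd _ (seg s s01)).
  have Bz := seg s s01; move: Es Bz; move: (s *: (y - x1) + x1) => z Es Bz.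
  have [zd zdd _ zC2 [zk zflat]] := rB _ (rr' _ Bz).
  have [c Ec] := zflat (y - x1) (e j).
  have gz : 'D_(y - x1) g z = rdot t ('D_c G z).
    have [_ ->] := is_derive_rdot_cst t (differentiable_is_derive (y - x1) (zdd j)).
    by rewrite Ec.
  have gx1 : g x1 = 0 by rewrite /g rdotC t0.
  rewrite -[X in `|X|]/(g y) -(subr0 (g y)) -gx1.
  rewrite -{1}(subrK x1 y) Es gz (derive_basis _ zd).
  have yx1 : `|y - x1| <= 2 * r.
    move: By Bx1; rewrite -!ball_normE /= => By' Bx1'.
    have -> : y - x1 = (x0 - x1) - (x0 - y) by rewrite opprB [in RHS]addrC addrA subrK.
    rewrite (le_trans (ler_normB _ _)) // mulr_natl mulr2n lerD // ltW //.
  have cb : `|c| <= k * (2 * r * M * C2).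
    rewrite (le_trans (zk c)) // ler_pM2l // -Ec deriveE //.
    rewrite (le_trans (linear_row_bound _ _)) // -mulrA ler_pM //.
      by rewrite sumr_ge0.
    rewrite (@le_trans _ _ (\sum_(i < m) C2)) //.
      by apply: ler_sum => i _; have := zC2 i j; rewrite deriveE.
    by rewrite sumr_const card_ord -mulr_natl ler_wpM2r // ltW.
  have HN' : `|rdot t (\sum_i c 0 i *: 'D_(e i) G z)| <= M * (`|c| * N).
    have -> : rdot t (\sum_i c 0 i *: 'D_(e i) G z) =
        \sum_i c 0 i * rdot t ('D_(e i) G z).
      rewrite (linear_sum (rdot t)) /=; apply: eq_bigr => i _.
      by rewrite rdotZr.
    rewrite (le_trans (ler_norm_sum _ _ _)) //.
    rewrite (@le_trans _ _ (\sum_(i < m) `|c| * N)) //.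
      apply: ler_sum => i _; rewrite normrM ler_pM // ?row_norm_coord //.
      exact: HN.
    by rewrite sumr_const card_ord -mulr_natl ler_wpM2r // mulr_ge0.
  rewrite (le_trans HN') //.
  rewrite (@le_trans _ _ (M * (k * (2 * r * M * C2) * N))) //.
    by rewrite ler_pM2l // ler_wpM2r.
  have -> : M * (k * (2 * r * M * C2) * N) = (r * (4 * M * M * k * C2)) * (N / 2) by field.
  rewrite ler_piMl ?divr_ge0 // -ler_pdivlMr ?mulr_gt0 // mul1r.
  by rewrite ge_min lexx orbT.
have bnd q : forall y, ball x0 r y -> forall i,
    `|rdot t ('D_(e i) G y)| <= K * C1 / 2 ^+ q.
  elim: q => [|q IH] y By i.
    rewrite expr0 divr1 (le_trans (HK _)) // ler_pM2l //.
    by have [] := rB _ (rr' _ By).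
  rewrite exprSr invfM mulrA; apply: step => //.
  by rewrite divr_ge0 ?exprn_ge0 // mulr_ge0 ?ltW.
have z0 y i : ball x0 r y -> rdot t ('D_(e i) G y) = 0.
  move=> By; apply/eqP; rewrite -normr_le0.
  have := fun q => bnd q y By i; move: (`|_|) (K * C1) => v A vA.
  rewrite leNgt; apply/negP => v0.
  have qA : A / v < (Num.truncn (A / v)).+1%:R := truncnS_gt _.
  have := vA (Num.truncn (A / v)).+1.
  rewrite leNgt => /negP; apply; rewrite ltr_pdivrMr ?exprn_gt0 // -ltr_pdivrMl //.
  rewrite mulrC (lt_trans qA) // -natrX ltr_nat ltn_expl //.
move=> d; have [xd _ _ _ _] := rB _ (rr' _ Bx).
rewrite (derive_basis _ xd) rdotC (linear_sum (rdot t)) /= big1 // => i _.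
by rewrite rdotZr z0 ?mulr0.
Qed.
End FlatImage.

(** * Isometries of the ball *)

Lemma diff_compE (R : realType) (U V W : normedModType R) (f : U -> V)
    (g : V -> W) (x : U) (Lf : U -> V) (Lg : V -> W) :
  differentiable f x -> differentiable g (f x) ->
  (forall v, 'd f x v = Lf v) -> (forall v, 'd g (f x) v = Lg v) ->
  forall v, 'd (g \o f) x v = Lg (Lf v).
Proof. by move=> fd gd fL gL v; rewrite diff_comp //= fL gL. Qed.

Section IsometryPairs.
Variables (R : realType) (n : nat).
Implicit Types (F G : Cvec R n -> Cvec R n) (z u v w : Cvec R n).

Definition isometric_at F z : Prop := exists L : Cvec R n -> Cvec R n,
  [/\ differentiable F z, forall v, 'd F z v = L v, forall v, L (J v) = J (L v) &
      forall u v, metric (F z) (L u) (L v) = metric z u v].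

(** The inverse is carried along: it yields bijectivity, and its differentiability lets [open_part]
    pull neighbourhoods back. *)
Record isometry_pair F G : Prop := IsometryPair {
  isometry_pair_CH : forall z, CH z -> CH (F z);
  isometry_pair_CHV : forall z, CH z -> CH (G z);
  isometry_pairK : forall z, CH z -> G (F z) = z;
  isometry_pairVK : forall z, CH z -> F (G z) = z;
  isometry_pair_at : forall z, CH z -> isometric_at F z;
  isometry_pair_atV : forall z, CH z -> isometric_at G z }.

Lemma isometry_pair_holomorphic F G : isometry_pair F G -> holomorphic_isometry F.
Proof.
case=> FC GC FK GK Fi _; split; last first.
  move=> z /Fi[L [Fd FL LJ Lm]]; split=> // [v|u v].
    by rewrite (FL v) (FL (J v)) LJ.
  by rewrite (FL u) (FL v) Lm.
split.
- by move=> z; exact: FC.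
- move=> z w; rewrite !inE => zC wC Fzw.
  by rewrite -(FK _ zC) -(FK _ wC) Fzw.
- by move=> z zC; exists (G z); [exact: GC|exact: GK].
Qed.

Lemma isometric_at_comp F G z :
  isometric_at F z -> isometric_at G (F z) -> isometric_at (G \o F) z.
Proof.
move=> [L [Fd FL LJ Lm]] [K [Gd GK KJ Km]]; exists (K \o L).
split=> [|v|v|u v] /=; first exact: differentiable_comp.
- exact: (diff_compE Fd Gd FL GK).
- by rewrite LJ KJ.
- by rewrite Km Lm.
Qed.

Lemma isometry_pair_comp F G F' G' : isometry_pair F G -> isometry_pair F' G' ->
  isometry_pair (F' \o F) (G \o G').
Proof.
case=> FC GC FK GK Fi Gi [FC' GC' FK' GK' Fi' Gi']; split=> z zC /=.
- exact/FC'/FC.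
- exact/GC/GC'.
- by rewrite FK' ?FK //; exact: FC.
- by rewrite GK ?GK' //; exact: GC'.
- by apply: isometric_at_comp; [exact: Fi|exact/Fi'/FC].
- by apply: isometric_at_comp; [exact: Gi'|exact/Gi/GC'].
Qed.

Lemma isometry_pair_id : isometry_pair id id.
Proof.
have i z : isometric_at id z.
  by exists id; split=> // v; rewrite diff_val.
by split.
Qed.

Definition unitary (A : Cvec R n -> Cvec R n) : Prop :=
  [/\ linear A, forall z, A (J z) = J (A z) &
      forall z w, rdot (A z) (A w) = rdot z w].

Lemma unitary_idot A z w : unitary A -> idot (A z) (A w) = idot z w.
Proof. by case=> _ AJ Ar; rewrite /idot -AJ Ar. Qed.

Lemma unitary_isometric A z : unitary A -> isometric_at A z.
Proof.
move=> Au; have [Al AJ Ar] := Au.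
pose L : {linear Cvec R n -> Cvec R n} := HB.pack A (GRing.isLinear.Build _ _ _ _ _ Al).
have Lc : continuous L by exact: linear_cvec_continuous.
have Ld : differentiable L z by exact: linear_differentiable.
have dE v : 'd A z v = A v by rewrite (_ : A = L) // diff_lin.
exists A; split=> // u v.
by rewrite /metric !Ar !(unitary_idot _ _ Au).
Qed.

Lemma unitary_isometry_pair A B : unitary A -> unitary B ->
  cancel A B -> cancel B A -> isometry_pair A B.
Proof.
move=> Au Bu AK BK; split=> z zC; [| | by rewrite AK | by rewrite BK
  | exact: unitary_isometric | exact: unitary_isometric];
  have [_ _ Ar] := Au; have [_ _ Br] := Bu; by rewrite /CH /= ?Ar ?Br.
Qed.

(* The complex reflection along [u - v]; it maps [u] to [v] if these have the
   same length. *)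
Definition reflection u v z : Cvec R n :=
  let w := u - v in
  let N := rdot u w ^+ 2 + idot u w ^+ 2 in
  z - cscale ((rdot z w * rdot u w + idot z w * idot u w) / N)
             ((idot z w * rdot u w - rdot z w * idot u w) / N) w.

Variables (u v : Cvec R n).
Hypotheses (uv : u != v) (uuvv : rdot u u = rdot v v).

Let ww : rdot (u - v) (u - v) = 2 * rdot u (u - v).
Proof. by rewrite !dotE -uuvv (rdotC v u); ring. Qed.

Let uw0 : rdot u (u - v) != 0.
Proof.
apply/eqP => uw; have : rdot (u - v) (u - v) = 0 by rewrite ww uw mulr0.
by move=> /rdot_eq0/eqP; rewrite subr_eq0 (negPf uv).
Qed.

Let N0 : rdot u (u - v) ^+ 2 + idot u (u - v) ^+ 2 != 0.
Proof. by rewrite paddr_eq0 ?sqr_ge0 // sqrf_eq0 (negPf uw0). Qed.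

(** With w = u - v the map is z - (<z, w> / <u, w>) w. It preserves the Hermitian product because
    |w|^2 = 2 Re <u, w>, which is the equality of the lengths of [u] and [v]. *)
Lemma reflection_unitary : unitary (reflection u v).
Proof.
rewrite /reflection /=; move: N0 ww; move: (u - v) => w M0 wW.
split.
- move=> a z t; rewrite /cscale !dotE.
  move: (J w) (rdot u w) (idot u w) (rdot z w) (idot z w) (rdot t w) (idot t w) M0.
  by move=> w' c d e f g h N1; cvec_coord; field.
- move=> z; rewrite /cscale !dotE JD JN JD !JZ JJ.
  move: (J w) (J z) (rdot u w) (idot u w) (rdot z w) (idot z w) M0.
  by move=> w' z' c d e f N1; cvec_coord; field.
- move=> z t; rewrite /cscale !dotE !(idotzz w) wW.
  rewrite !(rdotC w) !(idotC w); move: M0.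
  move: (rdot u w) (idot u w) (rdot z w) (idot z w) (rdot t w) (idot t w) (rdot z t).
  by move=> a b c d e f g ab; field.
Qed.

Lemma reflection_map : reflection u v u = v.
Proof.
rewrite /reflection /=.
have -> : idot u (u - v) * rdot u (u - v) - rdot u (u - v) * idot u (u - v) = 0.
  by rewrite mulrC subrr.
rewrite mul0r -!expr2 divff //.
by rewrite /cscale scale1r scale0r addr0 subKr.
Qed.

Lemma reflection_fix z : rdot z u = rdot z v -> idot z u = idot z v ->
  reflection u v z = z.
Proof.
move=> zr zi; rewrite /reflection /=.
have -> : rdot z (u - v) = 0 by rewrite !dotE zr subrr.
have -> : idot z (u - v) = 0 by rewrite !dotE zi subrr.
by rewrite !mul0r addr0 subr0 mul0r /cscale !scale0r addr0 subr0.
Qed.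

(** Exchanging [u] and [v] keeps the complex line of w and conjugates <u, w>, hence replaces the
    factor of the reflection by its inverse. *)
Lemma reflectionK : cancel (reflection u v) (reflection v u).
Proof.
move=> z; rewrite {1}/reflection /=.
have E1 : v - u = - (u - v) by rewrite opprB.
have E2 : rdot v (v - u) = rdot u (u - v).
  by rewrite !dotE (rdotC v u) uuvv; ring.
have E3 : idot v (v - u) = - idot u (u - v).
  by rewrite !dotE !idotzz (idotC v u); ring.
rewrite E2 E3 E1 /reflection /=; move: N0 ww; move: (u - v) => w M0 wW.
rewrite /cscale !dotE idotzz wW sqrrN JN.
move: (J w) (rdot u w) (idot u w) (rdot z w) (idot z w) M0.
by move=> w' a b c d N1; cvec_coord; field.
Qed.

End IsometryPairs.

Section UnitaryTransport.
Variables (R : realType) (n : nat).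
Implicit Types (s t : nat -> Cvec R n).

Definition hermitian_orthonormal (j : nat) s : Prop :=
  forall a b, (a < j)%N -> (b < j)%N ->
    rdot (s a) (s b) = (a == b)%:R /\ idot (s a) (s b) = 0.

(** Each new vector is moved by one reflection. Those already placed are orthogonal to both its
    source and its target, so the reflection fixes them. *)
Lemma unitary_transport j s t :
  hermitian_orthonormal j s -> hermitian_orthonormal j t ->
  exists A B : Cvec R n -> Cvec R n, [/\ unitary A, unitary B, cancel A B,
    cancel B A & forall a, (a < j)%N -> A (s a) = t a].
Proof.
elim: j => [|j IH] sj tj.
  by exists id, id; split.
have [||A [B [Au Bu AK BK As]]] := IH.
- by move=> a b aj bj; apply: sj; exact: ltnW.
- by move=> a b aj bj; apply: tj; exact: ltnW.
have [Ast|Ast] := eqVneq (A (s j)) (t j).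
  exists A, B; split=> // a; rewrite ltnS leq_eqVlt => /orP[/eqP->//|].
  exact: As.
have [_ _ Ar] := Au.
have E : rdot (A (s j)) (A (s j)) = rdot (t j) (t j).
  by rewrite Ar (sj _ _ _ _).1 // (tj _ _ _ _).1.
have AstV : t j != A (s j) by rewrite eq_sym.
exists (reflection (A (s j)) (t j) \o A), (B \o reflection (t j) (A (s j))); split.
- have [Rl RJ Rr] := reflection_unitary Ast E; have [Al AJ _] := Au.
  split=> [a z w|z|z w] /=; first by rewrite Al Rl.
    by rewrite AJ RJ.
  by rewrite Rr Ar.
- have [Rl RJ Rr] := reflection_unitary AstV (esym E); have [Bl BJ Br] := Bu.
  split=> [a z w|z|z w] /=; first by rewrite Rl Bl.
    by rewrite RJ BJ.
  by rewrite Br Rr.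
- by move=> z /=; rewrite reflectionK // AK.
- by move=> z /=; rewrite BK reflectionK.
move=> a; rewrite ltnS leq_eqVlt => /orP[/eqP->|aj] /=.
  by rewrite reflection_map.
have aj' : (a < j.+1)%N by exact: ltnW.
rewrite (As a aj) reflection_fix //.
  by rewrite -{1}(As a aj) Ar (sj _ _ _ _).1 // (tj _ _ _ _).1.
by rewrite -{1}(As a aj) (unitary_idot _ _ Au) (sj _ _ _ _).2 // (tj _ _ _ _).2.
Qed.

End UnitaryTransport.

(* (dr + i di)^-1 v *)
Definition cdiv (R : realType) (n : nat) (dr di : R) (v : Cvec R n) : Cvec R n :=
  cscale (dr / (dr ^+ 2 + di ^+ 2)) (- di / (dr ^+ 2 + di ^+ 2)) v.

Section CDiv.
Variables (R : realType) (n : nat).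
Implicit Types (u v w z : Cvec R n) (dr di : R).

Lemma cdivK dr di v : dr ^+ 2 + di ^+ 2 != 0 -> cscale dr di (cdiv dr di v) = v.
Proof.
move=> d0; rewrite /cdiv /cscale !JE.
by move: (J v) => Jv; cvec_coord; field.
Qed.

Lemma cscale_inj dr di u v : dr ^+ 2 + di ^+ 2 != 0 ->
  cscale dr di u = cscale dr di v -> u = v.
Proof.
move=> d0 E; have : cdiv dr di (cscale dr di u) = cdiv dr di (cscale dr di v) by rewrite E.
have K z : cdiv dr di (cscale dr di z) = z.
  by rewrite /cdiv /cscale !JE; move: (J z) => Jz; cvec_coord; field.
by rewrite !K.
Qed.

Lemma rdot_cscalel a b u v : rdot (cscale a b u) v = a * rdot u v - b * idot u v.
Proof. by rewrite /cscale rdotDl !rdotZl rdotJl mulrN. Qed.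

Lemma idot_cscalel a b u v : idot (cscale a b u) v = a * idot u v + b * rdot u v.
Proof. by rewrite /cscale idotDl !idotZl idotJl. Qed.

Lemma rdot_cscaler a b u v : rdot u (cscale a b v) = a * rdot u v + b * idot u v.
Proof. by rewrite /cscale rdotDr !rdotZr rdotJr. Qed.

Lemma idot_cscaler a b u v : idot u (cscale a b v) = a * idot u v - b * rdot u v.
Proof. by rewrite /cscale idotDr !idotZr idotJr mulrN. Qed.

Definition cscale_dotE :=
  (rdot_cscalel, idot_cscalel, rdot_cscaler, idot_cscaler).

Lemma rdot_cdiv dr di u v : dr ^+ 2 + di ^+ 2 != 0 ->
  rdot (cdiv dr di u) (cdiv dr di v) = rdot u v / (dr ^+ 2 + di ^+ 2).
Proof.
move=> d0; rewrite /cdiv !cscale_dotE; move: (rdot u v) (idot u v) => a b.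
by field.
Qed.

Lemma idot_cdiv dr di u v : dr ^+ 2 + di ^+ 2 != 0 ->
  idot (cdiv dr di u) (cdiv dr di v) = idot u v / (dr ^+ 2 + di ^+ 2).
Proof.
move=> d0; rewrite /cdiv !cscale_dotE; move: (rdot u v) (idot u v) => a b.
by field.
Qed.

(* With [Q = (z, 1)], [U = (u, 0)] and [V = (v, 0)] mapped to [(N, D)],
   [(Nu, Lu)] and [(Nv, Lv)] by a linear map preserving the Hermitian form of
   signature (n, 1), the projectivised map preserves the metric. *)
Lemma metric_projective z u v (N Nu Nv : Cvec R n) dr di ur ui vr vi :
  CH z ->
  dr ^+ 2 + di ^+ 2 - rdot N N = 1 - rdot z z ->
  rdot Nu N - (ur * dr + ui * di) = rdot u z ->
  idot Nu N - (ui * dr - ur * di) = idot u z ->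
  rdot Nv N - (vr * dr + vi * di) = rdot v z ->
  idot Nv N - (vi * dr - vr * di) = idot v z ->
  rdot Nu Nv - (ur * vr + ui * vi) = rdot u v ->
  let g := cdiv dr di N in
  metric g (cdiv dr di (Nu - cscale ur ui g)) (cdiv dr di (Nv - cscale vr vi g))
  = metric z u v.
Proof.
move=> /CH_gt0 z1 e1 e2 e3 e4 e5 e6 /=.
have d0 : 0 < dr ^+ 2 + di ^+ 2.
  by move: z1; rewrite -e1 subr_gt0; apply: le_lt_trans; exact: rdot_ge0.
have {}d0 := lt0r_neq0 d0.
have z0 : 1 - rdot z z != 0 by exact: lt0r_neq0.
rewrite /metric !rdot_cdiv // !idot_cdiv //.
have rg v' : rdot (cdiv dr di N) v' =
    (dr * rdot N v' + di * idot N v') / (dr ^+ 2 + di ^+ 2).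
  by rewrite rdot_cscalel; ring.
have ig v' : idot (cdiv dr di N) v' =
    (dr * idot N v' - di * rdot N v') / (dr ^+ 2 + di ^+ 2).
  by rewrite idot_cscalel; ring.
have gr v' : rdot v' (cdiv dr di N) =
    (dr * rdot N v' + di * idot N v') / (dr ^+ 2 + di ^+ 2) by rewrite rdotC rg.
have gi v' : idot v' (cdiv dr di N) =
    - ((dr * idot N v' - di * rdot N v') / (dr ^+ 2 + di ^+ 2)) by rewrite idotC ig.
have E1 a b : rdot (cscale a b (cdiv dr di N)) N = _ := rdot_cscalel _ _ _ _.
have E2 a b : idot (cscale a b (cdiv dr di N)) N = _ := idot_cscalel _ _ _ _.
have E3 a b : rdot Nu (cscale a b (cdiv dr di N)) = _ := rdot_cscaler _ _ _ _.
have E4 a b : rdot (cscale a b (cdiv dr di N)) Nv = _ := rdot_cscalel _ _ _ _.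
have E5 : rdot (cscale ur ui (cdiv dr di N)) (cscale vr vi (cdiv dr di N)) =
    (ur * vr + ui * vi) * rdot N N / (dr ^+ 2 + di ^+ 2).
  rewrite rdot_cscalel rdot_cscaler idot_cscaler !rdot_cdiv // !idot_cdiv // idotzz.
  by ring.
move: (E1 ur ui) (E1 vr vi) (E2 ur ui) (E2 vr vi) (E3 vr vi) (E4 ur ui) E5.
rewrite !rg !ig !gr !gi idotzz.
move: (cscale ur ui _) (cscale vr vi _) => A B F1 F2 F3 F4 F5 F6 F7.
rewrite !(rdotDl, rdotDr, rdotNl, rdotNr, idotDl, idotNl).
rewrite F1 F2 F3 F4 F5 F6 F7 -e2 -e3 -e4 -e5 -e6.
rewrite (rdotC N Nu) (rdotC N Nv) (idotC N Nu) (idotC N Nv).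
have -> : rdot N N = dr ^+ 2 + di ^+ 2 - (1 - rdot z z) by rewrite -e1; ring.
move: (1 - rdot z z) z0 => M z0.
move: (rdot Nu N) (rdot Nv N) (idot Nu N) (idot Nv N) (rdot Nu Nv) (idot Nu Nv).
move=> a b c d e f; clear -d0 z0.
by field; rewrite z0 d0.
Qed.
End CDiv.

Section DifferentiableCvec.
Variables (R : realType) (n : nat) (V : normedModType R).
Implicit Types (f : V -> Cvec R n) (x : V).

Lemma cvec_basis (z : Cvec R n) :
  z = \sum_i rdot (delta_mx 0 i, 0) z *: (delta_mx 0 i, 0) +
      \sum_i rdot (0, delta_mx 0 i) z *: (0, delta_mx 0 i).
Proof.
apply: rdot_ext => t; rewrite (rdot_coord z t) rdotDl big_split /=.
by congr (_ + _); rewrite -(rdotC t) (linear_sum (rdot t)); apply: eq_bigr => i _;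
  rewrite /= rdotZr rdotC (rdotC t).
Qed.

Lemma differentiable_cvec f x :
  (forall t, differentiable (fun y => rdot t (f y)) x) -> differentiable f x.
Proof.
move=> fd.
rewrite (_ : f = (fun y => \sum_i rdot (delta_mx 0 i, 0) (f y) *: ((delta_mx 0 i, 0) : Cvec R n)) +
   (fun y => \sum_i rdot (0, delta_mx 0 i) (f y) *: ((0, delta_mx 0 i) : Cvec R n))); last first.
  by apply/funext => y; rewrite fctE -cvec_basis.
apply: differentiableD.
  rewrite (_ : (fun y => _) = \sum_i (fun y => rdot (delta_mx 0 i, 0) (f y) *: ((delta_mx 0 i, 0) : Cvec R n))).
    by apply: differentiable_sum => i; apply: differentiableZl.
  by apply/funext => y; rewrite fct_sumE.
rewrite (_ : (fun y => _) = \sum_i (fun y => rdot (0, delta_mx 0 i) (f y) *: ((0, delta_mx 0 i) : Cvec R n))).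
  by apply: differentiable_sum => i; apply: differentiableZl.
by apply/funext => y; rewrite fct_sumE.
Qed.

Lemma differentiable_rdot_cst t f x : differentiable f x ->
  differentiable (fun y => rdot t (f y)) x.
Proof.
move=> fd; apply: (@differentiable_comp _ _ _ _ f (rdot t : _ -> R)) => //.
by apply: (@linear_differentiable _ _ R (rdot t)); exact: rdot_continuous.
Qed.

Lemma differentiable_rdot f g x : differentiable f x -> differentiable g x ->
  differentiable (fun y => rdot (f y) (g y)) x.
Proof.
move=> fd gd.
pose h (i : 'I_n) y : R := rdot (delta_mx 0 i, 0) (f y) * rdot (delta_mx 0 i, 0) (g y)
                + rdot (0, delta_mx 0 i) (f y) * rdot (0, delta_mx 0 i) (g y).
rewrite (_ : (fun y => _) = \sum_i h i).
  apply: differentiable_sum => i; apply: differentiableD; apply: differentiableM;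
    exact: differentiable_rdot_cst.
by apply/funext => y; rewrite fct_sumE rdot_coord.
Qed.

Lemma differentiable_J f x : differentiable f x -> differentiable (fun y => J (f y)) x.
Proof.
move=> fd; apply: (@differentiable_comp _ _ _ _ f (@J R n)) => //.
by apply: linear_differentiable; exact: J_continuous.
Qed.

Lemma differentiable_idot f g x : differentiable f x -> differentiable g x ->
  differentiable (fun y => idot (f y) (g y)) x.
Proof. by move=> fd gd; apply: differentiable_rdot => //; exact: differentiable_J. Qed.

Lemma differentiable_cscale (a b : V -> R) f x : differentiable a x ->
  differentiable b x -> differentiable f x ->
  differentiable (fun y => cscale (a y) (b y) (f y)) x.
Proof.
move=> ad bd fd; apply: differentiable_cvec => t.
rewrite (_ : (fun y => _) = a * (fun y => rdot t (f y)) + b * (fun y => rdot t (J (f y)))).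
  apply: differentiableD; apply: differentiableM => //.
    exact: differentiable_rdot_cst.
  exact/differentiable_rdot_cst/differentiable_J.
by apply/funext => y; rewrite rdot_cscaler.
Qed.

Lemma differentiable_cdiv (a b : V -> R) f x : differentiable a x ->
  differentiable b x -> differentiable f x -> a x ^+ 2 + b x ^+ 2 != 0 ->
  differentiable (fun y => cdiv (a y) (b y) (f y)) x.
Proof.
move=> ad bd fd ab0; rewrite /cdiv.
have d1 : differentiable (fun y => (a y ^+ 2 + b y ^+ 2)^-1) x.
  apply: (@differentiableV _ _ (fun y => a y ^+ 2 + b y ^+ 2)) => //.
  by apply: (@differentiableD _ _ _ (a ^+ 2) (b ^+ 2)); apply: differentiableX.
apply: differentiable_cscale => //.
  exact: (@differentiableM _ _ a).
by apply: (@differentiableM _ _ (- b)) => //; exact: differentiableN.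
Qed.

(* Differentiating [D G = f] avoids the derivative of [1 / D]. *)
Lemma is_derive_cdiv (a b : V -> R) f x v da db d : differentiable a x ->
  differentiable b x -> differentiable f x -> a x ^+ 2 + b x ^+ 2 != 0 ->
  is_derive x v a da -> is_derive x v b db -> is_derive x v f d ->
  is_derive x v (fun y => cdiv (a y) (b y) (f y))
    (cdiv (a x) (b x) (d - cscale da db (cdiv (a x) (b x) (f x)))).
Proof.
move=> ad bd fd ab0 a' b' f'.
have gd := differentiable_cdiv ad bd fd ab0.
have g' := differentiable_is_derive v gd.
apply: is_derive_eq g' _.
apply: (cscale_inj ab0); rewrite cdivK //.
have H := is_derive_cscale a' b' (differentiable_is_derive v gd).
have ab : \forall y \near x, a y ^+ 2 + b y ^+ 2 != 0.
  have c : {for x, continuous (fun y => a y ^+ 2 + b y ^+ 2)}.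
    apply: differentiable_continuous.
    by apply: (@differentiableD _ _ _ (a ^+ 2) (b ^+ 2)); apply: differentiableX.
  by apply: (c [set y | y != 0]); exact: open_nbhs_nbhs.
have H' : is_derive x v (fun y => cscale (a y) (b y) (cdiv (a y) (b y) (f y))) d.
  apply: (near_eq_is_derive _ f').
  by apply: filterS ab => y y0; rewrite cdivK.
by rewrite (is_derive_unique H' H) addrAC subrr add0r.
Qed.

End DifferentiableCvec.

(* The parabolic isometry fixing the ideal point [e] which, in the affine
   coordinates [z / (1 - <z, e>)], adds [tau] and a multiple of [e]. *)
Section HeisenbergTranslation.
Variables (R : realType) (n : nat) (e : Cvec R n).
Hypothesis ee : rdot e e = 1.
Implicit Types (z u v tau : Cvec R n).

(** For [tau] orthogonal to the complex line of [e], these formulas describe a unipotent element of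
    U(n,1) fixing (e, 1). The image of (u, 0) is [heis_lin] with last entry [heis_lr] + i [heis_li];
    the constant terms of [heis_num] and [heis_dr] are the image of (0, 1). *)
Definition heis_lr tau u : R := rdot u tau - rdot u e * (rdot tau tau / 2).
Definition heis_li tau u : R := idot u tau - idot u e * (rdot tau tau / 2).
Definition heis_dr tau z : R := 1 + rdot tau tau / 2 + heis_lr tau z.
Definition heis_di tau z : R := heis_li tau z.
Definition heis_lin tau u : Cvec R n :=
  u - cscale (rdot u e) (idot u e) tau + cscale (heis_lr tau u) (heis_li tau u) e.
Definition heis_num tau z : Cvec R n :=
  heis_lin tau z + tau + (rdot tau tau / 2) *: e.
Definition heis tau z : Cvec R n :=
  cdiv (heis_dr tau z) (heis_di tau z) (heis_num tau z).

Section Fixed.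
Variable tau : Cvec R n.
Hypotheses (te : rdot tau e = 0) (ite : idot tau e = 0).

Let et : rdot e tau = 0. Proof. by rewrite rdotC. Qed.
Let iet : idot e tau = 0. Proof. by rewrite idotC ite oppr0. Qed.

Lemma heis_lin_dot u v :
  rdot (heis_lin tau u) (heis_lin tau v)
    - (heis_lr tau u * heis_lr tau v + heis_li tau u * heis_li tau v) = rdot u v.
Proof.
rewrite /heis_lin.
have E1 (a b c d a' b' c' d' : R) :
  rdot (u - cscale a b tau + cscale c d e) (v - cscale a' b' tau + cscale c' d' e) =
  rdot u v - (a' * rdot u tau + b' * idot u tau) + (c' * rdot u e + d' * idot u e)
  - (a * rdot v tau + b * idot v tau) + (a * a' + b * b') * rdot tau tau
  + (c * rdot v e + d * idot v e) + (c * c' + d * d').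
  rewrite /cscale !dotE !idotzz te et ite iet ee.
  rewrite (rdotC tau v) (rdotC e v) (idotC tau v) (idotC e v).
  by ring.
rewrite E1 /heis_lr /heis_li.
move: (rdot u v) (rdot u tau) (idot u tau) (rdot u e) (idot u e) (rdot v tau)
  (idot v tau) (rdot v e) (idot v e) (rdot tau tau).
by move=> *; field.
Qed.

Lemma heis_lrJ u : heis_lr tau (J u) = - heis_li tau u.
Proof. by rewrite /heis_lr /heis_li !dotE; ring. Qed.

Lemma heis_liJ u : heis_li tau (J u) = heis_lr tau u.
Proof. by rewrite /heis_lr /heis_li !dotE; ring. Qed.

Lemma heis_linJ u : heis_lin tau (J u) = J (heis_lin tau u).
Proof.
rewrite /heis_lin heis_lrJ heis_liJ /cscale !JE !dotE.
by move: (heis_lr _ _) (heis_li _ _) (rdot u e) (idot u e) (J tau) (J e) (J u) => *;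
  cvec_coord; ring.
Qed.

Lemma heis_lin_idot u v :
  idot (heis_lin tau u) (heis_lin tau v)
    - (heis_li tau u * heis_lr tau v - heis_lr tau u * heis_li tau v) = idot u v.
Proof.
have := heis_lin_dot u (J v); rewrite heis_linJ heis_lrJ heis_liJ !rdotJr => <-.
by ring.
Qed.

Let c : Cvec R n := tau + (rdot tau tau / 2) *: e.

Let lin_c u : rdot (heis_lin tau u) c = heis_lr tau u * (1 + rdot tau tau / 2).
Proof.
have E1 (a b p q h : R) :
  rdot (u - cscale a b tau + cscale p q e) (tau + h *: e) =
  rdot u tau + h * rdot u e - a * rdot tau tau + h * p.
  by rewrite /cscale !dotE !idotzz te et ite iet ee; ring.
rewrite /heis_lin /c E1 /heis_lr.
by move: (rdot u tau) (rdot u e) (rdot tau tau) => *; field.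
Qed.

Let lin_ic u : idot (heis_lin tau u) c = heis_li tau u * (1 + rdot tau tau / 2).
Proof.
by rewrite -[LHS]opprK -rdotJl -heis_linJ lin_c heis_lrJ; ring.
Qed.

Let cc : rdot c c = (1 + rdot tau tau / 2) ^+ 2 - 1.
Proof.
rewrite /c; have -> (h : R) : rdot (tau + h *: e) (tau + h *: e) = rdot tau tau + h ^+ 2.
  by rewrite !dotE te et ee; ring.
by field.
Qed.

Let numE z : heis_num tau z = heis_lin tau z + c.
Proof. by rewrite /heis_num addrA. Qed.

Lemma heis_form z : heis_dr tau z ^+ 2 + heis_di tau z ^+ 2
  - rdot (heis_num tau z) (heis_num tau z) = 1 - rdot z z.
Proof.
rewrite numE rdotDl !(rdotDr (heis_lin tau z) c) (rdotC c (heis_lin _ _)) lin_c cc -(heis_lin_dot z z).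
by rewrite /heis_dr /heis_di; ring.
Qed.

Lemma heis_form_dr u z : rdot (heis_lin tau u) (heis_num tau z)
  - (heis_lr tau u * heis_dr tau z + heis_li tau u * heis_di tau z) = rdot u z.
Proof.
rewrite numE (rdotDr (heis_lin tau z) c) lin_c -(heis_lin_dot u z) /heis_dr /heis_di; ring.
Qed.

Lemma heis_form_di u z : idot (heis_lin tau u) (heis_num tau z)
  - (heis_li tau u * heis_dr tau z - heis_lr tau u * heis_di tau z) = idot u z.
Proof.
rewrite numE (idotDr (heis_lin tau z) c) lin_ic -(heis_lin_idot u z) /heis_dr /heis_di; ring.
Qed.

Lemma heis_den z : CH z -> 0 < heis_dr tau z ^+ 2 + heis_di tau z ^+ 2.
Proof.
move=> /CH_gt0; rewrite -heis_form subr_gt0; apply: le_lt_trans.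
exact: rdot_ge0.
Qed.

Lemma heis_CH z : CH z -> CH (heis tau z).
Proof.
move=> zC; have d0 := heis_den zC.
rewrite /CH /= /heis rdot_cdiv ?lt0r_neq0 // ltr_pdivrMr // mul1r.
by rewrite -subr_gt0 heis_form CH_gt0.
Qed.

Lemma heis_lr_linear : linear (heis_lr tau : _ -> R^o).
Proof. by move=> a u v; rewrite /heis_lr !dotE /GRing.scale /=; ring. Qed.

Lemma heis_li_linear : linear (heis_li tau : _ -> R^o).
Proof. by move=> a u v; rewrite /heis_li !dotE /GRing.scale /=; ring. Qed.

Lemma heis_lin_linear : linear (heis_lin tau).
Proof.
move=> a u v; rewrite /heis_lin (heis_lr_linear a u v) (heis_li_linear a u v).
rewrite /cscale !dotE /GRing.scale /=.
move: (heis_lr _ _) (heis_lr _ _) (heis_li _ _) (heis_li _ _) (J tau) (J e)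
  (rdot u e) (rdot v e) (idot u e) (idot v e) => *.
by cvec_coord; ring.
Qed.

(** The quotient rule gives the differential in the shape required by [metric_projective], whose
    hypotheses are the invariance of the form proved above. *)
Lemma heis_isometric z : CH z -> isometric_at (heis tau) z.
Proof.
move=> zC; have d0 := lt0r_neq0 (heis_den zC).
pose Lr : {linear Cvec R n -> R^o} := HB.pack (heis_lr tau : _ -> R^o)
  (GRing.isLinear.Build _ _ _ _ _ heis_lr_linear).
pose Li : {linear Cvec R n -> R^o} := HB.pack (heis_li tau : _ -> R^o)
  (GRing.isLinear.Build _ _ _ _ _ heis_li_linear).
pose Ln : {linear Cvec R n -> Cvec R n} := HB.pack (heis_lin tau)
  (GRing.isLinear.Build _ _ _ _ _ heis_lin_linear).
have Lrc : continuous Lr by exact: linear_cvec_continuous.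
have Lic : continuous Li by exact: linear_cvec_continuous.
have Lnc : continuous Ln by exact: linear_cvec_continuous.
have drd : differentiable (heis_dr tau) z.
  apply: (@differentiableD _ _ _ (cst (1 + rdot tau tau / 2)) Lr) => //.
  exact: linear_differentiable.
have did : differentiable (heis_di tau) z by exact: (@linear_differentiable _ _ _ Li).
have nud : differentiable (heis_num tau) z.
  have -> : heis_num tau = (fun y => Ln y + cst c y) by apply/funext => y; rewrite numE.
  exact: (differentiableD (linear_differentiable z Lnc) (differentiable_cst c z)).
have dr' u : is_derive z u (heis_dr tau) (heis_lr tau u).
  have H := is_derive_linear Lrc (is_derive_id z u).
  have := is_deriveD (is_derive_cst (1 + rdot tau tau / 2 : R^o) z u) H.
  by rewrite add0r; apply.
have di' u : is_derive z u (heis_di tau) (heis_li tau u).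
  exact: is_derive_linear Lic (is_derive_id z u).
have nu' u : is_derive z u (heis_num tau) (heis_lin tau u).
  have -> : heis_num tau = (fun y => Ln y + cst c y) by apply/funext => y; rewrite numE.
  have H := is_derive_linear Lnc (is_derive_id z u).
  by have := is_deriveD H (is_derive_cst c z u); rewrite addr0; apply.
have hd : differentiable (heis tau) z by exact: differentiable_cdiv.
exists (fun u => cdiv (heis_dr tau z) (heis_di tau z)
  (heis_lin tau u - cscale (heis_lr tau u) (heis_li tau u) (heis tau z))).
split=> // [u|u|u v].
- rewrite -deriveE //.
  by have [_ ->] := is_derive_cdiv drd did nud d0 (dr' u) (di' u) (nu' u).
- have E (x g : Cvec R n) (a b p q : R) :
    cdiv a b (J x - cscale (- q) p g) = J (cdiv a b (x - cscale p q g)).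
    rewrite /cdiv /cscale !JE; move: (J x) (J g) => x' g'.
    by cvec_coord; ring.
  by rewrite heis_linJ heis_lrJ heis_liJ E.
- apply: metric_projective => //.
  + exact: heis_form.
  + exact: heis_form_dr.
  + exact: heis_form_di.
  + exact: heis_form_dr.
  + exact: heis_form_di.
  + exact: heis_lin_dot.
Qed.

End Fixed.
End HeisenbergTranslation.

(** * The affine chart at an ideal point *)

Section AffineChart.
Variables (R : realType) (n : nat) (e : Cvec R n).
Hypothesis ee : rdot e e = 1.
Implicit Types (z u v tau eta : Cvec R n).

(* The affine chart of the projective space whose hyperplane at infinity is
   tangent to the sphere at [e]. *)
Definition chart z : Cvec R n := cdiv (1 - rdot z e) (- idot z e) z.

Lemma chart_den_gt0 z : CH z -> 0 < 1 - rdot z e.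
Proof.
rewrite /CH /= => zz; have := rdot_ge0 (z - e).
by rewrite !dotE (rdotC e z) ee; lra.
Qed.

Lemma chart_den z : CH z -> (1 - rdot z e) ^+ 2 + (- idot z e) ^+ 2 != 0.
Proof.
move=> /chart_den_gt0/lt0r_neq0 d0.
by rewrite paddr_eq0 ?sqr_ge0 // negb_and sqrf_eq0 d0.
Qed.

(** The inverse of the chart is w / (1 + <w, e>), because 1 + <chart z, e> = 1 / (1 - <z, e>). *)
Lemma chart_inj z w : CH z -> CH w -> chart z = chart w -> z = w.
Proof.
move=> zC wC E.
have H y : CH y -> cscale (1 + rdot (chart y) e) (idot (chart y) e) y = chart y.
  move=> yC; have d0 := chart_den yC.
  apply: (cscale_inj d0); rewrite [RHS]cdivK //.
  have -> : 1 + rdot (chart y) e =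
      (1 - rdot y e) / ((1 - rdot y e) ^+ 2 + (- idot y e) ^+ 2).
    by rewrite /chart rdot_cscalel; field.
  have -> : idot (chart y) e =
      idot y e / ((1 - rdot y e) ^+ 2 + (- idot y e) ^+ 2).
    by rewrite /chart idot_cscalel; field.
  rewrite /cscale !JE; move: (J y) (rdot y e) (idot y e) d0 => y' a b d0.
  by cvec_coord; field.
have c0 : (1 + rdot (chart z) e) ^+ 2 + idot (chart z) e ^+ 2 != 0.
  have d0 := chart_den zC.
  have -> : 1 + rdot (chart z) e =
      (1 - rdot z e) / ((1 - rdot z e) ^+ 2 + (- idot z e) ^+ 2).
    by rewrite /chart rdot_cscalel; field.
  have -> : idot (chart z) e =
      idot z e / ((1 - rdot z e) ^+ 2 + (- idot z e) ^+ 2).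
    by rewrite /chart idot_cscalel; field.
  move: (rdot z e) (idot z e) d0 => a b d0.
  have -> : ((1 - a) / ((1 - a) ^+ 2 + (- b) ^+ 2)) ^+ 2 +
    (b / ((1 - a) ^+ 2 + (- b) ^+ 2)) ^+ 2 = ((1 - a) ^+ 2 + (- b) ^+ 2)^-1 by field.
  by rewrite invr_eq0.
by apply: (cscale_inj c0); rewrite H // E H.
Qed.

Section Fixed.
Variable tau : Cvec R n.
Hypotheses (te : rdot tau e = 0) (ite : idot tau e = 0).

(** Denominator minus <numerator, e> is still 1 - <z, e>: the hyperplane at infinity of the chart is
    preserved. Hence the denominator of [heis] cancels in the chart. *)
Lemma heis_num_e z :
  rdot (heis_num e tau z) e = rdot z e + heis_dr e tau z - 1 /\
  idot (heis_num e tau z) e = idot z e + heis_di e tau z.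
Proof.
rewrite /heis_dr /heis_di /heis_num /heis_lin.
move: (heis_lr _ _ _) (heis_li _ _ _) (rdot tau tau / 2) => a b h.
by rewrite /cscale !dotE !idotzz te ite ee; split; ring.
Qed.

Lemma heis_e z : CH z ->
  1 - rdot (heis e tau z) e = ((1 - rdot z e) * heis_dr e tau z - idot z e * heis_di e tau z)
     / (heis_dr e tau z ^+ 2 + heis_di e tau z ^+ 2) /\
  idot (heis e tau z) e = ((1 - rdot z e) * heis_di e tau z + idot z e * heis_dr e tau z)
     / (heis_dr e tau z ^+ 2 + heis_di e tau z ^+ 2).
Proof.
move=> zC; have d0 := lt0r_neq0 (heis_den ee te ite zC).
rewrite /heis rdot_cscalel idot_cscalel (heis_num_e z).1 (heis_num_e z).2.
move: (heis_dr _ _ _) (heis_di _ _ _) (rdot z e) (idot z e) d0 => a b c d d0.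
by split; field.
Qed.

Lemma cdiv_quotient (a b c d : R) (v : Cvec R n) :
  a ^+ 2 + b ^+ 2 != 0 -> c ^+ 2 + d ^+ 2 != 0 ->
  cdiv ((c * a + d * b) / (a ^+ 2 + b ^+ 2)) ((d * a - c * b) / (a ^+ 2 + b ^+ 2))
    (cdiv a b v) = cdiv c d v.
Proof.
move=> ab cd.
have E : ((c * a + d * b) / (a ^+ 2 + b ^+ 2)) ^+ 2 +
  ((d * a - c * b) / (a ^+ 2 + b ^+ 2)) ^+ 2 = (c ^+ 2 + d ^+ 2) / (a ^+ 2 + b ^+ 2).
  by field.
rewrite /cdiv E /cscale !JE; move: (J v) => v'.
by cvec_coord; field; rewrite cd ab.
Qed.

Lemma chart_heisE z : CH z -> chart (heis e tau z) =
  cdiv (1 - rdot z e) (- idot z e) (heis_num e tau z).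
Proof.
move=> zC; have d0 := lt0r_neq0 (heis_den ee te ite zC).
have d1 := chart_den zC; rewrite -(cdiv_quotient _ d0 d1) /chart.
rewrite (heis_e zC).1 (heis_e zC).2; congr cdiv.
  by congr (_ / _); ring.
by rewrite -mulNr; congr (_ / _); ring.
Qed.

Lemma chart_heis z eta : CH z -> rdot e eta = 0 -> idot e eta = 0 ->
  rdot (chart (heis e tau z)) eta = rdot (chart z) eta + rdot tau eta.
Proof.
move=> zC er ei; have d1 := chart_den zC.
rewrite (chart_heisE zC) /chart /cdiv !rdot_cscalel.
have -> : rdot (heis_num e tau z) eta =
   rdot z eta + (1 - rdot z e) * rdot tau eta + idot z e * idot tau eta.
  by rewrite /heis_num /heis_lin /cscale !dotE er ei; ring.
have -> : idot (heis_num e tau z) eta =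
   idot z eta + (1 - rdot z e) * idot tau eta - idot z e * rdot tau eta.
  by rewrite /heis_num /heis_lin /cscale !dotE er ei; ring.
move: (rdot z e) (idot z e) (rdot z eta)
  (idot z eta) (rdot tau eta) (idot tau eta) d1 => a b c d f g d1.
by field.
Qed.

End Fixed.

Lemma heisK tau z : rdot tau e = 0 -> idot tau e = 0 -> CH z ->
  heis e (- tau) (heis e tau z) = z.
Proof.
move=> te ite zC; have d0 := lt0r_neq0 (heis_den ee te ite zC).
have te' : rdot (- tau) e = 0 by rewrite rdotNl te oppr0.
have ite' : idot (- tau) e = 0 by rewrite idotNl ite oppr0.
have gC := heis_CH ee te ite zC.
apply: (chart_inj (heis_CH ee te' ite' gC) zC).
have [e1 e2] := heis_e te ite zC.
have d1 := chart_den zC.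
rewrite (chart_heisE te' ite' gC) e2.
have -> : (1 - rdot (heis e tau z) e) = ((1 - rdot z e) * heis_dr e tau z + - idot z e * heis_di e tau z)
     / (heis_dr e tau z ^+ 2 + heis_di e tau z ^+ 2).
  by rewrite e1; congr (_ / _); ring.
rewrite -mulNr.
have -> : - ((1 - rdot z e) * heis_di e tau z + idot z e * heis_dr e tau z) =
   - idot z e * heis_dr e tau z - (1 - rdot z e) * heis_di e tau z by ring.
rewrite /chart -(cdiv_quotient z d0 d1); congr cdiv.
apply: (cscale_inj d0); rewrite cdivK //.
have g : cscale (heis_dr e tau z) (heis_di e tau z) (heis e tau z) = heis_num e tau z.
  by rewrite cdivK.
have cD a b u v : cscale a b (u + v) = cscale a b u + cscale a b v.
  by rewrite /cscale !JE !scalerDr addrACA.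
have tt : rdot (- tau) (- tau) = rdot tau tau by rewrite !dotE opprK.
have r1 : rdot (heis_num e tau z) tau = rdot z tau + (1 - rdot z e) * rdot tau tau.
  rewrite /heis_num /heis_lin /cscale !dotE !idotzz (rdotC e tau) (idotC e tau) te ite.
  by ring.
have r2 : idot (heis_num e tau z) tau = idot z tau - idot z e * rdot tau tau.
  rewrite /heis_num /heis_lin /cscale !dotE !idotzz (rdotC e tau) (idotC e tau) te ite.
  by ring.
have r3 : rdot (heis e tau z) tau = (heis_dr e tau z * rdot (heis_num e tau z) tau
   + heis_di e tau z * idot (heis_num e tau z) tau)
   / (heis_dr e tau z ^+ 2 + heis_di e tau z ^+ 2).
  by rewrite /heis rdot_cscalel; ring.
have r4 : idot (heis e tau z) tau = (heis_dr e tau z * idot (heis_num e tau z) tau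
   - heis_di e tau z * rdot (heis_num e tau z) tau)
   / (heis_dr e tau z ^+ 2 + heis_di e tau z ^+ 2).
  by rewrite /heis idot_cscalel; ring.
have {e1} e1 : rdot (heis e tau z) e = 1 -
    ((1 - rdot z e) * heis_dr e tau z - idot z e * heis_di e tau z) /
    (heis_dr e tau z ^+ 2 + heis_di e tau z ^+ 2) by rewrite -e1; ring.
rewrite /heis_num /heis_lin tt /heis_lr /heis_li tt !rdotNr !idotNr r3 r4 e1 e2 r1 r2.
move: g; move: (heis e tau z) => G g.
have assoc (A B C D : Cvec R n) : G - A + B - C + D = G + (- A + B - C + D).
  by rewrite !addrA.
rewrite assoc cD g /heis_num /heis_lin.
have a1 : rdot z tau = heis_dr e tau z - 1 - rdot tau tau / 2
    + rdot z e * (rdot tau tau / 2) by rewrite /heis_dr /heis_lr; ring.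
have a2 : idot z tau = heis_di e tau z + idot z e * (rdot tau tau / 2).
  by rewrite /heis_di /heis_li; ring.
rewrite /heis_lr /heis_li a1 a2.
move: (heis_dr _ _ _) (heis_di _ _ _) (rdot z e) (idot z e) (rdot tau tau) d0
  => a b c d t d0.
rewrite /cscale !JE; move: (J tau) (J e) => tau' e'.
by cvec_coord; field.
Qed.

Lemma heis_isometry_pair tau : rdot tau e = 0 -> idot tau e = 0 ->
  isometry_pair (heis e tau) (heis e (- tau)).
Proof.
move=> te ite.
have te' : rdot (- tau) e = 0 by rewrite rdotNl te oppr0.
have ite' : idot (- tau) e = 0 by rewrite idotNl ite oppr0.
split=> z zC.
- exact: heis_CH.
- exact: heis_CH.
- exact: heisK.
- by have := heisK te' ite' zC; rewrite opprK.
- exact: heis_isometric.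
- exact: heis_isometric.
Qed.

End AffineChart.

Lemma chart_unitary (R : realType) (n : nat) (A : Cvec R n -> Cvec R n) e z :
  unitary A -> chart (A e) (A z) = A (chart e z).
Proof.
move=> Au; have [Al AJ Ar] := Au.
have AZ a u : A (a *: u) = a *: A u.
  have A0 : A 0 = 0 by apply: rdot_eq0; rewrite Ar rdot0l.
  by have := Al a u 0; rewrite !addr0 A0 addr0.
rewrite /chart /cdiv /cscale Ar (unitary_idot _ _ Au).
by rewrite Al AZ AJ.
Qed.

(** * The ruled minimal submanifold *)

Section RuledMinimal.
Variables (R : realType) (n k : nat).
Hypothesis kn : (k < n)%N.
Implicit Types (p q u z mu tau : Cvec R n).

Let n0 : (0 < n)%N. Proof. exact: leq_ltn_trans kn. Qed.
Let i0 : 'I_n := Ordinal n0.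
Let e : Cvec R n := ideal_point R n.

Definition re_vec (j : 'I_n) : Cvec R n := (delta_mx 0 j, 0).
Definition im_vec (j : 'I_n) : Cvec R n := (0, delta_mx 0 j).

Lemma J_re_vec j : J (re_vec j) = im_vec j.
Proof. by rewrite /J /re_vec /im_vec /= oppr0. Qed.

Lemma rdot_re_vec z j : rdot z (re_vec j) = z.1 0 j.
Proof.
rewrite /rdot /dotv /= (bigD1 j) //= big1 ?addr0.
  by rewrite big1 ?addr0 => [|i _]; rewrite mxE ?eqxx ?mulr1 ?mulr0.
by move=> i ij; rewrite mxE (negPf ij) andbF mulr0.
Qed.

Lemma rdot_im_vec z j : rdot z (im_vec j) = z.2 0 j.
Proof.
rewrite /rdot /dotv /= big1 ?add0r => [|i _]; last by rewrite mxE mulr0.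
rewrite (bigD1 j) //= big1 ?addr0; first by rewrite mxE !eqxx mulr1.
by move=> i ij; rewrite mxE (negPf ij) andbF mulr0.
Qed.

Lemma idot_re_vec z j : idot z (re_vec j) = z.2 0 j.
Proof. by rewrite /idot J_re_vec rdot_im_vec. Qed.

Lemma ideal_pointE : e = re_vec i0.
Proof.
apply: cvec_eq => //=; apply/rowP => j; rewrite !mxE eqxx /=.
by congr (nat_of_bool _)%:R; apply/eqP/eqP => [j0|->] //; exact: val_inj.
Qed.

Lemma ideal_point_norm : rdot e e = 1.
Proof. by rewrite ideal_pointE rdot_re_vec /= mxE !eqxx. Qed.

(** The real directions e_2, ..., e_(k+1), numbered 1 to k in the code, which parametrise the
    horosphere. *)
Definition real_span mu : Prop :=
  mu.2 = 0 /\ forall j : 'I_n, ~~ (0 < j <= k)%N -> mu.1 0 j = 0.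

Lemma real_span_e mu : real_span mu -> rdot mu e = 0 /\ idot mu e = 0.
Proof.
by move=> [m2 m1]; rewrite ideal_pointE rdot_re_vec idot_re_vec m2 m1 // mxE.
Qed.

Lemma real_span_idot mu nu : real_span mu -> real_span nu -> idot mu nu = 0.
Proof.
move=> [m2 _] [n2 _]; rewrite /idot /rdot /dotv /J /= m2 n2 !big1 ?addr0 // => i _.
  by rewrite !mxE mul0r.
by rewrite !mxE oppr0 mulr0.
Qed.

(** This is [heis e tau 0]: the horosphere through 0 is the orbit of 0 under the real Heisenberg
    translations. *)
Definition horo_point tau : Cvec R n :=
  (1 + rdot tau tau / 2)^-1 *: (tau + (rdot tau tau / 2) *: e).

Lemma horo_den tau : 0 < 1 + rdot tau tau / 2.
Proof. by rewrite ltr_wpDr // divr_ge0 // rdot_ge0. Qed.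

Lemma horo_point_horosphere tau : real_span tau -> @horosphere R n k (horo_point tau).
Proof.
move=> tT; have [te ite] := real_span_e tT; have s0 := horo_den tau.
have E1 : rdot (horo_point tau) e = (rdot tau tau / 2) / (1 + rdot tau tau / 2).
  by rewrite /horo_point rdotZl rdotDl rdotZl te ideal_point_norm; ring.
have E2 : rdot (horo_point tau) (horo_point tau) =
    (rdot tau tau + (rdot tau tau / 2) ^+ 2) / (1 + rdot tau tau / 2) ^+ 2.
  rewrite /horo_point rdotZl rdotZr rdotDl !rdotDr !rdotZl !rdotZr te (rdotC e) te.
  by rewrite ideal_point_norm expr2 invfM; ring.
have E3 : (1 - rdot (horo_point tau) e) ^+ 2 = 1 - rdot (horo_point tau) (horo_point tau).
  rewrite E1 E2; move: (rdot tau tau) (lt0r_neq0 s0) => t t0.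
  by field; move: t0; apply: contraNneq => H; apply/eqP; lra.
split; last exact: E3.
split.
- rewrite /CH /= -subr_gt0 -E3 exprn_even_gt0 //= E1.
  have -> : 1 - (rdot tau tau / 2) / (1 + rdot tau tau / 2) = (1 + rdot tau tau / 2)^-1.
    by rewrite -{1}(divff (lt0r_neq0 s0)) -mulrBl addrK mul1r.
  by rewrite invr_eq0 lt0r_neq0.
- by case: tT => t2 _; rewrite /horo_point /= t2 /e /ideal_point /= scaler0 addr0 scaler0.
- move=> j kj; case: tT => _ t1; rewrite /horo_point /= !mxE t1.
    by rewrite add0r; case: (nat_of_ord j) kj => //= m _; rewrite !mulr0.
  by rewrite negb_and -leqNgt -ltnNge kj orbT.
Qed.

Lemma horosphere_horo_point p : @horosphere R n k p ->
  exists2 tau, real_span tau & p = horo_point tau.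
Proof.
move=> [[pC p2 pk] pE].
(* The part of the chart image of [p] that is orthogonal to [e]. *)
pose tau : Cvec R n := (1 - rdot p e)^-1 *: (p - rdot p e *: e).
have d0 := lt0r_neq0 (chart_den_gt0 ideal_point_norm pC).
have tT : real_span tau.
  split; first by rewrite /tau /= p2 /e /ideal_point /= !scaler0 subr0 scaler0.
  move=> j; rewrite negb_and -leqNgt -ltnNge leqn0 => /orP[/eqP j0|kj].
    have -> : j = i0 by apply: val_inj.
    by rewrite /tau ideal_pointE rdot_re_vec /= !mxE !eqxx mulr1 subrr mulr0.
  rewrite /tau /= !mxE pk //; case: (nat_of_ord j) kj => //= m _.
  by rewrite mulr0 subr0 mulr0.
exists tau => //.
have tt : rdot tau tau = 2 * rdot p e / (1 - rdot p e).
  rewrite /tau !rdotZl !rdotZr rdotDl !rdotDr !rdotNl !rdotNr !rdotZl !rdotZr.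
  rewrite (rdotC e p) ideal_point_norm.
  have -> : rdot p p = 1 - (1 - rdot p e) ^+ 2 by move: pE; rewrite -/e => ->; ring.
  by field.
rewrite /horo_point tt /tau.
move: (rdot p e) d0 => a a0.
by cvec_coord; field; rewrite a0 /=; apply/eqP; lra.
Qed.

(** The first hypothesis is the equation of the horosphere and the third its linearisation. They
    turn orthogonality of [q - p] to [u] and [J u] into equations that are affine in [q]. *)
Lemma horo_metric p q u : (1 - rdot p e) ^+ 2 = 1 - rdot p p -> 1 - rdot p e != 0 ->
  rdot p u = (1 - rdot p e) * rdot u e -> idot p u = 0 ->
  metric p (q - p) u = 4 / (1 - rdot p e) ^+ 3 *
    ((1 - rdot p e) * rdot q u + rdot u e * (rdot q p - 1)) /\
  metric p (q - p) (J u) = 4 / (1 - rdot p e) ^+ 3 *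
    ((1 - rdot p e) * idot q u + rdot u e * idot q p).
Proof.
move=> pp p0 pu ipu; rewrite /metric -pp !dotE !idotzz.
rewrite (rdotC u p) (idotC u p) ipu pu.
have -> : rdot p p = 1 - (1 - rdot p e) ^+ 2 by rewrite pp; ring.
move: (rdot p e) (rdot u e) (rdot q u) (rdot q p) (idot q u) (idot q p) p0.
by move=> a b c d f g a0; split; field.
Qed.

Lemma horo_point_dot tau : real_span tau ->
  [/\ 1 - rdot (horo_point tau) e = (1 + rdot tau tau / 2)^-1,
      (1 - rdot (horo_point tau) e) ^+ 2 = 1 - rdot (horo_point tau) (horo_point tau) &
      forall mu, real_span mu -> idot (horo_point tau) mu = 0 /\ idot (horo_point tau) e = 0].
Proof.
move=> tT; have [te ite] := real_span_e tT; have s0 := lt0r_neq0 (horo_den tau).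
split.
- rewrite /horo_point rdotZl rdotDl rdotZl te ideal_point_norm add0r mulr1.
  by rewrite mulrC -{1}(divff s0) -mulrBl addrK mul1r.
- by have [] := horo_point_horosphere tT.
- move=> mu mT; have [me ime] := real_span_e mT.
  rewrite /horo_point !idotZl !idotDl !idotZl (real_span_idot tT mT) ite.
  by rewrite (idotC e) ime idotzz oppr0 !mulr0 addr0 mulr0.
Qed.

Lemma horo_point_tangent tau mu : real_span tau -> real_span mu ->
  set_tangent (@horosphere R n k) (horo_point tau)
    ((1 + rdot tau tau / 2)^-1 *: (mu + rdot tau mu *: e) -
     (rdot tau mu / (1 + rdot tau tau / 2) ^+ 2) *: (tau + (rdot tau tau / 2) *: e)).
Proof.
move=> tT mT; exists (fun x : R => horo_point (x *: mu + tau)); split.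
- by rewrite scale0r add0r.
- apply: filterE => x; apply: horo_point_horosphere.
  case: tT mT => t2 t1 [m2 m1]; split; first by rewrite /= t2 m2 scaler0 addr0.
  by move=> j kj; rewrite /= !mxE t1 // m1 // mulr0 addr0.
have c' : is_derive (0 : R) (1 : R) (fun x : R => x *: mu + tau) mu.
  have H := is_derive_scale (is_derive_id (0 : R) 1) (is_derive_cst mu (0 : R) 1).
  have := is_deriveD H (is_derive_cst tau (0 : R) (1 : R)).
  by rewrite scale1r scaler0 !addr0; apply.
pose s x : R := 1 + rdot (x *: mu + tau) (x *: mu + tau) / 2.
have s0 x : s x != 0 by exact: lt0r_neq0 (horo_den _).
have r' := is_derive_rdot c' c'; rewrite scale0r add0r in r'.
have h' : is_derive (0 : R) (1 : R) (fun x : R => rdot (x *: mu + tau) (x *: mu + tau) / 2)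
    (rdot tau mu).
  rewrite (_ : (fun x => _) = 2^-1 *: (fun x : R => rdot (x *: mu + tau) (x *: mu + tau))).
    apply: is_derive_eq; rewrite (rdotC mu tau) /GRing.scale /=.
    by field.
  by apply/funext => x; rewrite fctE /GRing.scale /= mulrC.
have s' : is_derive (0 : R) (1 : R) s (rdot tau mu).
  have := is_deriveD (is_derive_cst (1 : R) (0 : R) (1 : R)) h'.
  by rewrite add0r; apply.
have sV : is_derive (0 : R) (1 : R) (fun x => (s x)^-1) (- (rdot tau mu / s 0 ^+ 2)).
  case: s' => d1 d2; split; first exact: derivableV.
  by rewrite deriveV // d2 /GRing.scale /= mulNr mulrC.
have v' : is_derive (0 : R) (1 : R) (fun x : R => (x *: mu + tau) +
    (rdot (x *: mu + tau) (x *: mu + tau) / 2) *: e) (mu + rdot tau mu *: e).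
  have H := is_derive_scale h' (is_derive_cst e (0 : R) (1 : R)).
  by have := is_deriveD c' H; rewrite scaler0 addr0; apply.
have := is_derive_scale sV v'.
rewrite /s scale0r add0r /horo_point => H.
by apply: is_derive_eq H _; rewrite addrC scaleNr.
Qed.

(** The equations of the horosphere hold along the curve near 0, so their derivatives vanish.
    Necessary conditions suffice to show that a vector is normal; the opposite inclusion uses the
    explicit velocities of [horo_point_tangent]. *)
Lemma set_tangent_horosphere p u : @horosphere R n k p ->
  set_tangent (@horosphere R n k) p u ->
  [/\ real_span (u - rdot u e *: e) & rdot p u = (1 - rdot p e) * rdot u e].
Proof.
move=> pH [c [c0 cH c']].
have zero (g : R -> R) d : is_derive (0 : R) (1 : R) g d ->
    (\forall t \near (0 : R), g t = 0) -> d = 0.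
  move=> g' g0; apply: (is_derive_unique g').
  apply: (near_eq_is_derive _ (is_derive_cst (0 : R) (0 : R) (1 : R))).
  by apply: filterS g0 => t ->.
have lin t : (\forall x \near (0 : R), rdot t (c x) = 0) -> rdot t u = 0.
  exact: zero (is_derive_rdot_cst t c').
have u2 : u.2 = 0.
  apply/rowP => j; rewrite mxE -rdot_im_vec rdotC; apply: lin.
  by apply: filterS cH => x [[_ x2 _] _]; rewrite rdotC rdot_im_vec x2 mxE.
split.
  split; first by rewrite /= u2 /e /ideal_point /= scaler0 subr0.
  move=> j; rewrite negb_and -leqNgt -ltnNge leqn0 => /orP[/eqP j0|kj].
    have -> : j = i0 by apply: val_inj.
    by rewrite ideal_pointE rdot_re_vec /= !mxE !eqxx mulr1 subrr.
  rewrite /= !mxE -rdot_re_vec rdotC lin.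
    by case: (nat_of_ord j) kj => //= m _; rewrite mulr0 subr0.
  by apply: filterS cH => x [[_ _ xk] _]; rewrite rdotC rdot_re_vec xk.
have H1 := is_derive_rdot c' c'.
have H2 := is_derive_rdot_cst e c'.
have H3 := is_deriveB (is_derive_cst (1 : R) (0 : R) (1 : R)) H2.
have H4 := is_deriveM H3 H3.
have H5 := is_deriveB H4 (is_deriveB (is_derive_cst (1 : R) (0 : R) (1 : R)) H1).
have H7 : \forall x \near (0 : R), (1 - rdot e (c x)) * (1 - rdot e (c x))
    - (1 - rdot (c x) (c x)) = 0.
  by apply: filterS cH => x [_ xE]; rewrite (rdotC e) -expr2 xE subrr.
have := zero _ _ H5 H7; rewrite /GRing.scale /= !fctE c0 => H6.
move: H6; rewrite (rdotC u p) (rdotC e p) (rdotC e u); move: (rdot p u) (rdot p e) (rdot u e).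
by move=> a b d; lra.
Qed.

(** The rulings are the level sets of the chart coordinates 1 to k, and the points of the horosphere
    realise exactly the real values of these coordinates. *)
Lemma ruled_minimalP q : @ruled_minimal R n k q <->
  CH q /\ forall j : 'I_n, (0 < j <= k)%N -> rdot (chart e q) (im_vec j) = 0.
Proof.
split.
- move=> [qC [p [pH pN]]]; split=> // j jk.
  have [tau tT pE] := horosphere_horo_point pH.
  have jT : real_span (re_vec j).
    split=> // i ik; rewrite /= mxE eqxx /=.
    by case: eqP ik => // ->; rewrite jk.
  have ut := horo_point_tangent tT jT.
  rewrite pE in pN.
  have [e1 e2 e3] := horo_point_dot tT.
  have [te ite] := real_span_e tT; have [je ije] := real_span_e jT.
  have ee := ideal_point_norm.
  have s0 := lt0r_neq0 (horo_den tau).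
  move tE : (rdot tau (re_vec j)) ut => t ut.
  have [] := pN _ ut; set u := (_ *: _ - _ *: _).
  have ue : rdot u e = t / (1 + rdot tau tau / 2) ^+ 2.
    rewrite /u rdotDl rdotNl !rdotZl !rdotDl !rdotZl te je ee.
    by move: (rdot tau tau) s0 => a a0; field; apply/eqP => H; move/eqP: a0; apply; lra.
  have pu : rdot (horo_point tau) u = (1 - rdot (horo_point tau) e) * rdot u e.
    rewrite e1 ue /horo_point /u rdotDr rdotNr !rdotZr !rdotZl !rdotDl !rdotDr !rdotZl !rdotZr.
    rewrite te ee !(rdotC e) te je tE.
    by move: (rdot tau tau) s0 => a a0; field; apply/eqP => H; move/eqP: a0; apply; lra.
  have ipu : idot (horo_point tau) u = 0.
    rewrite /u idotDr idotNr !idotZr !idotDr !idotZr.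
    by rewrite (e3 _ jT).1 (e3 _ tT).1 (e3 _ tT).2 !mulr0 !addr0 !mulr0 subr0.
  have p0 : 1 - rdot (horo_point tau) e != 0 by rewrite e1 invr_eq0.
  have [-> ->] := horo_metric q e2 p0 pu ipu.
  rewrite e1 ue.
  have qu : rdot q u = (1 + rdot tau tau / 2)^-1 * (rdot q (re_vec j) + t * rdot q e) -
     t / (1 + rdot tau tau / 2) ^+ 2 * (rdot q tau + rdot tau tau / 2 * rdot q e).
    by rewrite /u rdotDr rdotNr !rdotZr !rdotDr !rdotZr.
  have iqu : idot q u = (1 + rdot tau tau / 2)^-1 * (idot q (re_vec j) + t * idot q e) -
     t / (1 + rdot tau tau / 2) ^+ 2 * (idot q tau + rdot tau tau / 2 * idot q e).
    by rewrite /u idotDr idotNr !idotZr !idotDr !idotZr.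
  have qp : rdot q (horo_point tau) = (1 + rdot tau tau / 2)^-1 *
      (rdot q tau + rdot tau tau / 2 * rdot q e).
    by rewrite /horo_point rdotZr rdotDr rdotZr.
  have iqp : idot q (horo_point tau) = (1 + rdot tau tau / 2)^-1 *
      (idot q tau + rdot tau tau / 2 * idot q e).
    by rewrite /horo_point idotZr idotDr idotZr.
  rewrite qu iqu qp iqp => /eqP X0 /eqP Y0.
  (* [X1] and [Y1] are the real and imaginary parts of <q, e_j> = t (1 - <q, e>), so the coordinate
     [j] of the chart is the real number [t]. *)
  have X1 : rdot q (re_vec j) = t * (1 - rdot q e).
    move: X0; rewrite mulf_eq0 => /orP[|].
      by rewrite mulf_eq0 invr_eq0 expf_eq0 invr_eq0 (negPf s0) pnatr_eq0.
    move: (rdot q (re_vec j)) (rdot q tau) (rdot q e) (rdot tau tau / 2) s0.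
    move=> a b c h s0 /eqP X0.
    have : (a - t * (1 - c)) / (1 + h) ^+ 2 = 0 by rewrite -[RHS]X0; field.
    by move/eqP; rewrite mulf_eq0 invr_eq0 expf_eq0 (negPf s0) orbF subr_eq0 => /eqP.
  have Y1 : idot q (re_vec j) = - (t * idot q e).
    move: Y0; rewrite mulf_eq0 => /orP[|].
      by rewrite mulf_eq0 invr_eq0 expf_eq0 invr_eq0 (negPf s0) pnatr_eq0.
    move: (idot q (re_vec j)) (idot q tau) (idot q e) (rdot tau tau / 2) s0.
    move=> a b c h s0 /eqP Y1.
    have : (a + t * c) / (1 + h) ^+ 2 = 0 by rewrite -[RHS]Y1; field.
    by move/eqP; rewrite mulf_eq0 invr_eq0 expf_eq0 (negPf s0) orbF addr_eq0 => /eqP.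
  rewrite -J_re_vec rdotJr /chart idot_cscalel Y1 X1.
  by move: (rdot q e) (idot q e) => a b; ring.
- move=> [qC qj]; split=> //.
  (* The chart coordinates 1 to k of [q], real by hypothesis, name the base point of the ruling
     through [q]. *)
  pose tau : Cvec R n :=
    (\row_j (if (0 < j <= k)%N then (chart e q).1 0 j else 0), 0).
  have tT : real_span tau.
    by split=> // j jk; rewrite /= mxE (negPf jk).
  have [te ite] := real_span_e tT.
  have s0 := lt0r_neq0 (horo_den tau).
  exists (horo_point tau); have pH := horo_point_horosphere tT; split=> // u uT.
  have [mT pu] := set_tangent_horosphere pH uT.
  set mu := u - _ in mT.
  have uE : u = rdot u e *: e + mu by rewrite addrC subrK.
  clearbody mu; have [me ime] := real_span_e mT.
  have d0 := chart_den ideal_point_norm qC.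
  have H nu : real_span nu -> rdot q nu = (1 - rdot q e) * rdot tau nu /\
      idot q nu = - idot q e * rdot tau nu.
    move=> [n2 n1].
    have c1 : rdot (chart e q) nu = rdot tau nu.
      rewrite /rdot n2; congr (_ + _); last first.
        apply: eq_bigr => i _; have -> : (0 : 'rV[R]_n) 0 i = 0 by rewrite mxE.
        by rewrite !mulr0.
      apply: eq_bigr => i _; rewrite /tau /= mxE; case: ifP => // /negbT ik.
      by rewrite n1 // !mulr0.
    have c2 : idot (chart e q) nu = 0.
      rewrite /idot /rdot /J /= n2 /dotv big1 ?add0r => [|i _]; last by rewrite !mxE oppr0 mulr0.
      rewrite big1 // => i _; have [ik|ik] := boolP (0 < i <= k)%N.
        by have := qj i ik; rewrite rdot_im_vec => ->; rewrite mul0r.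
      by rewrite n1 // mulr0.
    have qE : q = cscale (1 - rdot q e) (- idot q e) (chart e q) by rewrite cdivK.
    split.
      by rewrite {1}qE rdot_cscalel c1 c2 mulr0 subr0.
    by rewrite {1}qE idot_cscalel c1 c2 mulr0 add0r.
  have [e1 e2 e3] := horo_point_dot tT.
  have ee := ideal_point_norm.
  have p0 : 1 - rdot (horo_point tau) e != 0 by rewrite e1 invr_eq0.
  have ipu : idot (horo_point tau) u = 0.
    by rewrite uE idotDr idotZr (e3 _ mT).1 (e3 _ mT).2 mulr0 addr0.
  have [-> ->] := horo_metric q e2 p0 pu ipu.
  have tm : rdot tau mu = rdot u e * (1 - rdot tau tau / 2).
    move: pu; rewrite e1 {1}uE /horo_point rdotZl rdotDl rdotZl !rdotDr !rdotZr te ee.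
    rewrite (rdotC e mu) me mulr0 add0r mulr1 addr0.
    move=> /(mulfI _); rewrite invr_eq0 => /(_ s0) E.
    by rewrite mulrBr mulr1 -{1}E; ring.
  have qu : rdot q u = rdot u e * rdot q e + (1 - rdot q e) * rdot tau mu.
    by rewrite {1}uE rdotDr rdotZr (H _ mT).1.
  have iqu : idot q u = rdot u e * idot q e - idot q e * rdot tau mu.
    by rewrite {1}uE idotDr idotZr (H _ mT).2 mulNr.
  have qp : rdot q (horo_point tau) = (1 + rdot tau tau / 2)^-1 *
      ((1 - rdot q e) * rdot tau tau + rdot tau tau / 2 * rdot q e).
    by rewrite /horo_point rdotZr rdotDr rdotZr (H _ tT).1.
  have iqp : idot q (horo_point tau) = (1 + rdot tau tau / 2)^-1 *
      (- idot q e * rdot tau tau + rdot tau tau / 2 * idot q e).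
    by rewrite /horo_point idotZr idotDr idotZr (H _ tT).2.
  rewrite e1 qu iqu qp iqp tm.
  move: (rdot tau tau) (rdot u e) (rdot q e) (idot q e) s0 => t a b c s0.
  by split; field; apply/eqP => H1; move/eqP: s0; apply; lra.
Qed.

End RuledMinimal.

(** * The Codazzi equation *)

Section ConnectionFormula.
Variables (R : realType) (n : nat).
Implicit Types (z u v w : Cvec R n).

(* The two real components of the complex number <u, z> / (1 - |z|^2), the
   C-linear form which governs the Levi-Civita connection. *)
Definition phi_re z u : R := rdot u z / (1 - rdot z z).
Definition phi_im z u : R := idot u z / (1 - rdot z z).

Lemma christoffelE z u v : christoffel z u v =
  (phi_re z u *: v + phi_im z u *: J v) + (phi_re z v *: u + phi_im z v *: J u).
Proof.
rewrite /christoffel /cscale /phi_re /phi_im.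
move: (J u) (J v) (rdot u z) (idot u z) (rdot v z) (idot v z) ((1 - rdot z z)^-1) => *.
by cvec_coord; ring.
Qed.

End ConnectionFormula.

(** * Tangent and normal spaces of a submanifold *)

Section LocalTheory.
Variables (R : realType) (n m : nat) (T : topologicalType) (f : T -> Cvec R n).
Hypothesis fM : submanifold m f.

Lemma submanifold_CH p : CH (f p). Proof. by case: fM. Qed.

Section Param.
Variables (O : set 'rV[R]_m) (phi : 'rV[R]_m -> T).
Hypothesis Op : local_param f O phi.

Let oO : open O := local_param_open Op.

Lemma param_near x : O x -> \forall y \near x, O y.
Proof. by move=> Ox; exact: open_nbhs_nbhs. Qed.

Lemma param_d0 x : O x -> differentiable (f \o phi) x.
Proof. by move=> Ox; exact: (local_param_smooth Op [::] Ox). Qed.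

Lemma param_d1 w x : O x -> differentiable ('D_w (f \o phi)) x.
Proof. by move=> Ox; exact: (local_param_smooth Op [:: w] Ox). Qed.

Lemma param_d2 v w x : O x -> differentiable ('D_v ('D_w (f \o phi))) x.
Proof. by move=> Ox; exact: (local_param_smooth Op [:: v; w] Ox). Qed.

Lemma param_near_d0 x : O x -> \forall y \near x, differentiable (f \o phi) y.
Proof. by move=> /param_near; apply: filterS => y; exact: param_d0. Qed.

Lemma param_c1 w x : O x -> {for x, continuous ('D_w (f \o phi))}.
Proof. by move=> Ox; apply: differentiable_continuous; exact: param_d1. Qed.

Lemma param_inj x : O x -> forall d, 'D_d (f \o phi) x = 0 -> d = 0.
Proof. by move=> Ox d; exact: (local_param_immersion Op Ox). Qed.

Lemma param_continuous x : O x -> {for x, continuous phi}.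
Proof.
move=> Ox; have := local_param_continuous Op.
by rewrite continuous_open_subspace // => /(_ x); rewrite inE; apply.
Qed.

Lemma param_nbhs x (U : set 'rV[R]_m) : O x -> nbhs x U -> nbhs (phi x) (phi @` (U `&` O)).
Proof.
move=> Ox xU; have : nbhs x (U `&` O) by apply: filterI => //; exact: param_near.
move=> xUO; pose V := (U `&` O)^°.
have VU : V `<=` U `&` O by exact: interior_subset.
apply: (@filterS _ _ _ (phi @` V)); first exact: image_subset.
apply: open_nbhs_nbhs; split; last by exists x.
apply: (local_param_image Op); first exact: open_interior.
by move=> y /VU[].
Qed.

End Param.

(** [tangent] admits every parametrisation. That one is enough follows from [image_space_curve], as
    [phi] is open and the other parametrisation is continuous. *)
Lemma tangentP (O : set 'rV[R]_m) (phi : 'rV[R]_m -> T) x X : local_param f O phi -> O x ->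
  tangent m f (phi x) X <-> image_space (f \o phi) x X.
Proof.
move=> Op Ox; split; last first.
  by move=> [d ->]; exists O, phi, x, d.
move=> [A [psi [y [v [Op' Oy1 psy ->]]]]].
apply: (@image_space_curve _ _ _ _ _ (param_near_d0 Op Ox)
  (param_inj Op Ox) (fun h : R => f (psi (h *: v + y)))).
- have H : differentiable (f \o psi) ((0 : R) *: v + y).
    by rewrite scale0r add0r; exact: (param_d0 Op' Oy1).
  by have := differentiable_line H; rewrite scale0r add0r; apply.
- by rewrite scale0r add0r psy.
move=> U xU.
have H : (fun h : R => psi (h *: v + y)) @ 0^' --> phi x.
  have c : (fun h : R => h *: v + y) @ 0^' --> y := is_derive_cvg (is_derive_id y v).
  by rewrite -psy; exact: (cvg_comp _ _ c (param_continuous Op' Oy1)).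
have H' : \forall h \near (0 : R)^', (phi @` (U `&` O)) (psi (h *: v + y)).
  exact: H _ (param_nbhs Op Ox xU).
by apply: filterS H' => h [z [Uz Oz] zE]; exists z => //=; rewrite zE.
Qed.

Lemma paramP p : exists (O : set 'rV[R]_m) (phi : 'rV[R]_m -> T) x,
  [/\ local_param f O phi, O x & phi x = p].
Proof. by case: fM => _ _ /(_ p)[A [phi [Op [x Ox xp]]]]; exists A, phi, x. Qed.

Lemma tangentD p (a : R) X Y : tangent m f p X -> tangent m f p Y ->
  tangent m f p (a *: X + Y).
Proof.
have [A [phi [x [Op Ox <-]]]] := paramP p.
move=> /(tangentP _ Op Ox)[d ->] /(tangentP _ Op Ox)[d' ->].
apply/(tangentP _ Op Ox); exists (a *: d + d').
have D w := deriveE w (param_d0 Op Ox).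
by rewrite (D d) (D d') (D (a *: d + d')) [RHS]linearP.
Qed.

Lemma tangentZ p (a : R) X : tangent m f p X -> tangent m f p (a *: X).
Proof.
move=> Xt; have := tangentD (a - 1) Xt Xt.
by rewrite -{2}(scale1r X) -scalerDl subrK.
Qed.

Lemma tangentN p X : tangent m f p X -> tangent m f p (- X).
Proof. by move=> /(tangentZ (-1)); rewrite scaleN1r. Qed.

Lemma tangentDD p X Y : tangent m f p X -> tangent m f p Y -> tangent m f p (X + Y).
Proof. by move=> Xt /(tangentD 1 Xt); rewrite scale1r. Qed.

Lemma tangentB p X Y : tangent m f p X -> tangent m f p Y -> tangent m f p (X - Y).
Proof. by move=> Xt /tangentN; exact: tangentDD. Qed.

Lemma tangent_split p v : exists2 t, tangent m f p t & normal m f p (v - t).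
Proof.
have [A [phi [x [Op Ox <-]]]] := paramP p.
have [d dP] := @orth_proj R (Cvec R n) (metric (f (phi x))) m ('d (f \o phi) x) v
  (@metricC R n _) (@metricDl R n _) (fun a u w => @metricZl R n _ a u w)
  (fun u => @metric_eq0 R n _ u (submanifold_CH (phi x))).
exists ('D_d (f \o phi) x); first by apply/(tangentP _ Op Ox); exists d.
move=> X /(tangentP _ Op Ox)[d' ->].
have D w := deriveE w (param_d0 Op Ox).
by rewrite (D d) (D d') dP.
Qed.

Lemma tangent_orth p v :
  (forall xi, normal m f p xi -> metric (f p) v xi = 0) -> tangent m f p v.
Proof.
move=> vN; have [t tT tN] := tangent_split p v.
have : metric (f p) (v - t) (v - t) = 0.
  rewrite {1}metricDl metricNl vN // sub0r metricC tN ?oppr0 //.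
move=> /(metric_eq0 (submanifold_CH p))/eqP; rewrite subr_eq0 => /eqP -> //.
Qed.

Lemma normal_nonzero p : (m < n + n)%N -> exists2 xi, normal m f p xi & xi != 0.
Proof.
move=> mn; apply: contrapT => H.
have [A [phi [x [Op Ox xp]]]] := paramP p.
have full v : exists d, v = 'd (f \o phi) x d.
  have [t tT tN] := tangent_split p v.
  have vt : v = t.
    apply/eqP; rewrite -subr_eq0; apply/eqP; apply: contrapT => /eqP vt.
    by apply: H; exists (v - t).
  move: tT; rewrite -vt -xp => /(tangentP _ Op Ox)[d ->]; exists d.
  exact: deriveE (param_d0 Op Ox).
have D w := deriveE w (param_d0 Op Ox).
have [|L _ LK] := @linear_left_inverse R n m ('d (f \o phi) x).
  by move=> d; rewrite -(D d); exact: param_inj Ox d.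
have [] := @injective_dim R (n + n) m (L \o @cvec_of_rv R n).
  move=> v /= Lv; have [d dE] := full (cvec_of_rv v).
  have d0 : d = 0 by rewrite -(LK d) -dE.
  by rewrite -(cvec_of_rvK v) dE d0 !linear0.
by rewrite leqNgt mn.
Qed.

End LocalTheory.

Lemma mixed_derivative_cvec (R : realType) (n m : nat) (G : 'rV[R]_m -> Cvec R n)
    (O : set 'rV[R]_m) u w x : open O -> O x ->
  (forall y, O y -> differentiable G y) ->
  (forall v y, O y -> differentiable ('D_v G) y) ->
  (forall v v', {for x, continuous ('D_v ('D_v' G))}) ->
  'D_u ('D_w G) x = 'D_w ('D_u G) x.
Proof.
move=> oO Ox d0 d1 c2; apply: rdot_ext => t.
apply: (etrans (rdotC _ t)); apply: (etrans _ (rdotC t _)).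
have c3 v v' : {for x, continuous (fun y => rdot t ('D_v ('D_v' G) y))}.
  exact: (cvg_comp _ _ (c2 v v') (@rdot_continuous R n t _)).
have DE (g : 'rV[R]_m -> Cvec R n) v y : differentiable g y ->
    'D_v (fun y => rdot t (g y)) y = rdot t ('D_v g y).
  by move=> gd; have [_ ->] := is_derive_rdot_cst t (differentiable_is_derive v gd).
apply: (@mixed_derivative_sym _ _ (fun y => rdot t (G y)) (fun y => rdot t ('D_w G y))
  (fun y => rdot t ('D_u G y)) (fun y => rdot t ('D_u ('D_w G) y))
  (fun y => rdot t ('D_w ('D_u G) y)) O x w u oO Ox) => //.
- by move=> y Oy; apply: differentiable_rdot_cst; exact: d0.
- by move=> y Oy; apply: differentiable_rdot_cst; exact: d1.
- by move=> y Oy; apply: differentiable_rdot_cst; exact: d1.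
- by move=> y Oy; apply: DE; exact: d0.
- by move=> y Oy; apply: DE; exact: d0.
- by move=> y Oy; apply: DE; exact: d1.
- by move=> y Oy; apply: DE; exact: d1.
Qed.

(** The common third derivative [A] and the terms in [B] cancel. Two applications of J produce real
    multiples of [Fu] and [Fv], which are tangent and subtracted here. What remains is J applied to
    first derivatives, with the covariant derivatives of psi as coefficients. *)
Lemma codazzi_algebra (R : realType) (n : nat) (A Fvw Fuw B Fu Fv Fw : Cvec R n)
    (pu pv pw dvu duv dvw duw Puv Puw Pvw : R) :
  ((A + J ((dvu *: Fw + pu *: Fvw) + (dvw *: Fu + pw *: B)))
     + J (pv *: (Fuw + J (pu *: Fw + pw *: Fu)) + Puw *: Fv))
  - ((A + J ((duv *: Fw + pv *: Fuw) + (duw *: Fv + pw *: B)))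
     + J (pu *: (Fvw + J (pv *: Fw + pw *: Fv)) + Pvw *: Fu))
  - ((pw * pu) *: Fv - (pw * pv) *: Fu)
  = ((dvu - Puv) - (duv - Puv)) *: J Fw
    + ((dvw - Pvw) *: J Fu - (duw - Puw) *: J Fv).
Proof.
rewrite !JE; move: (J Fw) (J Fu) (J Fv) (J Fvw) (J Fuw) (J B) => *.
by cvec_coord; ring.
Qed.

(** * Covariant derivative of the connection form *)

Section PsiDerivative.
Variables (R : realType) (n : nat).
Implicit Types z X W D zeta dz : Cvec R n.

Definition psi_form z zeta X : R := phi_im z X + metric z X zeta / 2.

Definition psi_derivative z X W D zeta dz : R :=
  let k := (1 - rdot z z)^-1 in
  (idot D z + idot W X) * k + idot W z * (2 * rdot z X * k ^+ 2)
  + 2 * ((rdot D zeta + rdot W dz) * k + rdot W zeta * (2 * rdot z X * k ^+ 2)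
   + ((rdot D z + rdot W X) * rdot zeta z + rdot W z * (rdot dz z + rdot zeta X)
      + (idot D z + idot W X) * idot zeta z + idot W z * (idot dz z + idot zeta X)) * k ^+ 2
   + (rdot W z * rdot zeta z + idot W z * idot zeta z) * (4 * rdot z X * k ^+ 3)).

(* The Codazzi equation forces this to vanish when [dz] is the derivative of
   the field [zeta] = Z in the direction [X]. *)
Definition defect z X zeta dz : Cvec R n :=
  dz + christoffel z X zeta
  + 2^-1 *: (J X + metric z X zeta *: J zeta - metric z (J X) zeta *: zeta).

(** The left side is the covariant derivative of psi for the connection D + J (psi(X) W + psi(W) X).
    It no longer depends on [D], and as a form in [W] it is the metric dual of half the defect. *)
Lemma psi_derivative_defect z X W D zeta dz : CH z ->
  psi_derivative z X W D zeta dz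
    - psi_form z zeta (D + J (psi_form z zeta X *: W + psi_form z zeta W *: X))
  = metric z W (defect z X zeta dz) / 2.
Proof.
move=> zC; have k0 := lt0r_neq0 (CH_gt0 zC).
rewrite /psi_derivative /defect.
have -> : psi_form z zeta (D + J (psi_form z zeta X *: W + psi_form z zeta W *: X)) =
   psi_form z zeta D + psi_form z zeta X * psi_form z zeta (J W)
   + psi_form z zeta W * psi_form z zeta (J X).
  rewrite JD !JZ /psi_form /phi_im.
  rewrite !(idotDl, idotZl, metricDl, metricZl).
  move: (idot _ _ / _) (metric _ _ _) => p q; ring.
rewrite christoffelE !(metricDr, metricZr, metricNr).
rewrite /psi_form /metric /phi_im /phi_re !dotE.
rewrite ?(rdotC X W) ?(rdotC zeta W) ?(rdotC zeta X) ?(rdotC z X) ?(rdotC z W) ?(rdotC z zeta).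
rewrite ?(idotC X W) ?(idotC zeta W) ?(idotC zeta X) ?(idotC z X) ?(idotC z W) ?(idotC z zeta).
move: k0.
move: (1 - rdot z z) (idot D z) (rdot D z) (rdot D zeta) (idot D zeta) (rdot W dz)
  (idot W dz) (rdot dz z) (idot dz z) (rdot W X) (idot W X) (rdot W zeta) (idot W zeta)
  (rdot X zeta) (idot X zeta) (rdot X z) (idot X z) (rdot W z) (idot W z) (rdot zeta z)
  (idot zeta z) => k d1 d2 d3 d4 e1 e2 e3 e4 w1 w2 w3 w4 x1 x2 x3 x4 w5 w6 z1 z2 k0.
by field.
Qed.

Lemma is_derive_ball_den (V : normedModType R) (F : V -> Cvec R n) (x v : V) X :
  CH (F x) -> is_derive x v F X -> is_derive x v (fun y => (1 - rdot (F y) (F y))^-1)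
    (2 * rdot (F x) X * (1 - rdot (F x) (F x))^-1 ^+ 2).
Proof.
move=> FC F'; have k0 := lt0r_neq0 (CH_gt0 FC).
have [d1 d2] := is_deriveB (is_derive_cst (1 : R) x v) (is_derive_rdot F' F').
split; first exact: (derivableV (f := fun y => 1 - rdot (F y) (F y)) k0 d1).
rewrite (deriveV (f := fun y => 1 - rdot (F y) (F y)) k0 d1) d2 /GRing.scale /=.
by rewrite (rdotC X) exprVn; ring.
Qed.

Lemma is_derive_psi (V : normedModType R) (F W zeta : V -> Cvec R n) (x v : V) X D dz :
  CH (F x) -> is_derive x v F X -> is_derive x v W D -> is_derive x v zeta dz ->
  is_derive x v (fun y => psi_form (F y) (zeta y) (W y))
    (psi_derivative (F x) X (W x) D (zeta x) dz).
Proof.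
move=> FC F' W' z'; have kd := is_derive_ball_den FC F'.
pose k y := (1 - rdot (F y) (F y))^-1.
rewrite (_ : (fun y => _) = (fun y => idot (W y) (F y)) * k + 2 *:
  ((fun y => rdot (W y) (zeta y)) * k +
   ((fun y => rdot (W y) (F y)) * (fun y => rdot (zeta y) (F y)) +
    (fun y => idot (W y) (F y)) * (fun y => idot (zeta y) (F y))) * (k * k))); last first.
  apply/funext => y; rewrite !fctE /psi_form /phi_im /metric /k /GRing.scale /=.
  rewrite -!exprVn; move: (1 - _)^-1 => c.
  by field.
have w1 := is_derive_idot W' F'. have w2 := is_derive_rdot W' z'.
have w3 := is_derive_rdot W' F'. have w4 := is_derive_rdot z' F'.
have w5 := is_derive_idot z' F'.
have kk := is_deriveM kd kd.
have H1 := is_deriveM (is_deriveD (is_deriveM w3 w4) (is_deriveM w1 w5)) kk.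
have H2 := is_deriveD (is_deriveM w1 kd) (is_deriveZ 2 (is_deriveD (is_deriveM w2 kd) H1)).
apply: is_derive_eq H2 _.
rewrite !fctE /GRing.scale /= /psi_derivative /k.
move: ((1 - rdot (F x) (F x))^-1) => c.
by ring.
Qed.

End PsiDerivative.

(** * Consequences of the form of II *)

Section Hypotheses.
Variables (R : realType) (n m : nat) (T : topologicalType) (f : T -> Cvec R n).
Variables (Z : T -> Cvec R n) (II : T -> Cvec R n -> Cvec R n -> Cvec R n).
Hypothesis fM : submanifold m f.
Hypothesis mn : (m < n + n)%N.
Hypothesis hreal : totally_real_normal_bundle m f.
Hypothesis hZ : smooth_field m f Z.
Hypothesis hZD : forall p, max_holomorphic m f p (Z p).
Hypothesis hZ1 : forall p, metric (f p) (Z p) (Z p) = 1.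
Hypothesis hII : second_fundamental_form m f II.
Hypothesis hIIZ : trivial_bilinear_extension m f Z II.

Let fC p : CH (f p) := submanifold_CH fM p.

Lemma J_normal_tangent p xi : normal m f p xi -> tangent m f p (J xi).
Proof. by move=> xiN; apply: (tangent_orth fM) => eta etaN; exact: hreal. Qed.

Lemma Z_tangent p : tangent m f p (Z p).
Proof. by have [] := hZD p. Qed.

Lemma JZ_tangent p : tangent m f p (J (Z p)).
Proof.
apply: (tangent_orth fM) => xi xiN; rewrite metricJl.
by have [_ ->] := hZD p; rewrite ?oppr0.
Qed.

Let a p X := metric (f p) X (Z p).

(** Each tangent W is decomposed as a(W) Z + J xi + W' with [xi] minus the normal part of J W and
    II(W', .) = 0. Thus the coefficient of II(Z, W) is xi / 2, and [xi] is congruent to - J W modulo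
    the tangent space. *)
Lemma second_form_mod_tangent p X Y : tangent m f p X -> tangent m f p Y ->
  tangent m f p (II p X Y + 2^-1 *: (a p X *: J Y + a p Y *: J X)).
Proof.
have [IIC IIP IIZ [IIZZ IIJJ] IID] := hIIZ p.
have splitW W : tangent m f p W -> exists xi W', [/\ normal m f p xi,
    tangent m f p (J W + xi), W = a p W *: Z p + (J xi + W'),
    tangent m f p W' & forall V, tangent m f p V -> II p W' V = 0].
  move=> Wt; have [t tT tN] := tangent_split fM p (J W).
  have xiN : normal m f p (t - J W).
    by move=> V Vt; rewrite -opprB metricNl tN ?oppr0.
  pose W' := W - J (t - J W) - a p W *: Z p.
  have JxiT := J_normal_tangent xiN.
  have W'T : tangent m f p W'.
    apply: (tangentB fM); last exact: (tangentZ fM _ (Z_tangent p)).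
    exact: (tangentB fM).
  exists (t - J W), W'; split=> //.
  - by rewrite addrC subrK.
  - by rewrite /W'; move: (a p W) (Z p) (J (t - J W)) => *; cvec_coord; ring.
  - move=> V Vt; apply: IID => //.
      split=> // eta etaN; rewrite -[LHS]opprK -metricJl.
      have -> : J W' = t - a p W *: J (Z p).
        rewrite /W' !JE; move: (a p W) (J (Z p)) (J W) => *.
        by cvec_coord; ring.
      rewrite metricC etaN ?oppr0 //; apply: (tangentB fM) => //.
      exact: (tangentZ fM _ (JZ_tangent p)).
    rewrite /W' !(metricDl, metricNl) metricZl hZ1 mulr1 -/(a p W).
    have [_ ZD] := hZD p.
    by rewrite (metricC (f p) (J (t - J W))) ZD // subr0 subrr.
move=> Xt Yt.
have [xi [X' [xiN JX XE X'T X'0]]] := splitW X Xt.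
have [eta [Y' [etaN JY YE Y'T Y'0]]] := splitW Y Yt.
have ZT := Z_tangent p.
have JxiT := J_normal_tangent xiN; have JetaT := J_normal_tangent etaN.
have half (v w : Cvec R n) : 2 *: v = w -> v = 2^-1 *: w.
  by move=> <-; rewrite scalerA mulVf ?scale1r // pnatr_eq0.
have IIDl V W U : tangent m f p V -> tangent m f p W -> tangent m f p U ->
    II p (V + W) U = II p V U + II p W U.
  by move=> Vt Wt Ut; have := IIP 1 V W U Vt Wt Ut; rewrite !scale1r.
have IIZY : II p Y (Z p) = 2^-1 *: eta.
  rewrite {1}YE IIP //; last exact: (tangentDD fM).
  rewrite IIZZ scaler0 add0r IIDl // Y'0 // addr0 IIC //.
  exact/half/IIZ.
have IIJY : II p Y (J xi) = a p Y *: (2^-1 *: xi).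
  rewrite {1}YE IIP //; last exact: (tangentDD fM).
  rewrite (half _ _ (IIZ _ xiN)) IIDl // Y'0 // addr0 IIJJ //.
  by rewrite addr0.
have -> : II p X Y = a p X *: (2^-1 *: eta) + a p Y *: (2^-1 *: xi).
  rewrite {1}XE IIP //; last exact: (tangentDD fM).
  by rewrite IIDl // X'0 // addr0 (IIC (Z p)) // IIZY (IIC (J xi)) // IIJY.
have -> : a p X *: (2^-1 *: eta) + a p Y *: (2^-1 *: xi) +
    2^-1 *: (a p X *: J Y + a p Y *: J X) =
  2^-1 *: (a p X *: (J Y + eta) + a p Y *: (J X + xi)).
  move: (a p X) (a p Y) (J X) (J Y) => b c JX' JY'.
  by cvec_coord; ring.
apply: (tangentZ fM); apply: (tangentD fM) => //.
exact: (tangentZ fM).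
Qed.

(* The imaginary part of the complex coefficient of the flat connection which
   preserves the tangent bundle. *)
Definition psi p X : R := phi_im (f p) X + metric (f p) X (Z p) / 2.

Section Param.
Variables (O : set 'rV[R]_m) (phi : 'rV[R]_m -> T).
Hypothesis Op : local_param f O phi.
Let F : 'rV[R]_m -> Cvec R n := f \o phi.

Lemma image_tangent u x : O x -> tangent m f (phi x) ('D_u F x).
Proof. by move=> Ox; apply/(tangentP _ Op Ox); exists u. Qed.

Lemma derive_param_smooth w : smooth_on O ('D_w F).
Proof.
move=> s x Ox.
have -> : foldr (fun v (g : 'rV[R]_m -> Cvec R n) => 'D_v g) ('D_w F) s =
   foldr (fun v (g : 'rV[R]_m -> Cvec R n) => 'D_v g) F (s ++ [:: w]) by rewrite foldr_cat.
exact: (local_param_smooth Op).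
Qed.

(** In the Gauss formula the real parts of the Christoffel terms multiply tangent vectors and drop
    out; the imaginary parts and II combine into psi. *)
Lemma second_derivative_mod_tangent u w x : O x -> tangent m f (phi x)
  ('D_u ('D_w F) x +
   J (psi (phi x) ('D_u F x) *: 'D_w F x + psi (phi x) ('D_w F x) *: 'D_u F x)).
Proof.
move=> Ox; have [_ hII2] := hII.
have := hII2 O phi ('D_w F) Op (derive_param_smooth w)
  (fun y Oy => image_tangent w Oy) x u Ox.
have := second_form_mod_tangent (image_tangent u Ox) (image_tangent w Ox).
rewrite /covariant_derivative christoffelE -/F.
have := image_tangent u Ox; have := image_tangent w Ox.
rewrite /psi /a.
move: (II (phi x) ('D_u F x) ('D_w F x)) => S.
move: ('D_u ('D_w F) x) ('D_w F x) ('D_u F x) => D W U.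
rewrite /phi_re; set p := rdot U _ / _; set q := rdot W _ / _.
rewrite -!/(phi_im _ _) => WT UT ST DT.
have := tangentB fM (tangentDD fM DT ST)
   (tangentDD fM (tangentZ fM p WT) (tangentZ fM q UT)).
congr (tangent m f (phi x) _); clear.
move: p q (phi_im _ _) (phi_im _ _) (metric _ _ _) (metric _ _ _) => p q r s b c.
rewrite !JE; move: (J W) (J U) => W' U'.
by cvec_coord; field.
Qed.

Lemma section_derivative (s : 'rV[R]_m -> Cvec R n) ds x u : O x ->
  (forall y, O y -> tangent m f (phi y) (s y)) -> is_derive x u s ds ->
  tangent m f (phi x)
    (ds + J (psi (phi x) ('D_u F x) *: s x + psi (phi x) (s x) *: 'D_u F x)).
Proof.
move=> Ox sT s'.
have [c sE] := (tangentP (s x) Op Ox).1 (sT x Ox).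
have H := second_derivative_mod_tangent u c Ox.
rewrite -/F in sE; rewrite sE.
have sT' : \forall y \near x, image_space F y (s y).
  by apply: filterS (param_near Op Ox) => y Oy; apply/(tangentP _ Op Oy); exact: sT.
have H1 := derive_section (param_near_d0 Op Ox) (fun d => @param_c1 _ _ _ _ _ _ _ Op d x Ox)
  (param_inj Op Ox) s' (differentiable_is_derive u (param_d1 Op c Ox)) sE sT'.
have {H1} := tangentDD fM ((tangentP _ Op Ox).2 H1) H.
by congr (tangent m f (phi x) _); rewrite addrA subrK.
Qed.

Lemma param_d3 t v w x : O x -> differentiable ('D_t ('D_v ('D_w F))) x.
Proof. by move=> Ox; exact: (local_param_smooth Op [:: t; v; w] Ox). Qed.

Lemma derive_sym2 u w x : O x -> 'D_u ('D_w F) x = 'D_w ('D_u F) x.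
Proof.
move=> Ox; apply: (@mixed_derivative_cvec R n m F O u w x (local_param_open Op) Ox) => [y|v y|v v'].
- exact: (param_d0 Op).
- exact: (param_d1 Op).
- exact: differentiable_continuous (param_d2 Op v v' Ox).
Qed.

Lemma derive_sym3 u v w x : O x -> 'D_u ('D_v ('D_w F)) x = 'D_v ('D_u ('D_w F)) x.
Proof.
move=> Ox; apply: (@mixed_derivative_cvec R n m ('D_w F) O u v x (local_param_open Op) Ox) => [y|t y|t v'].
- exact: (param_d1 Op).
- exact: (param_d2 Op).
- exact: differentiable_continuous (param_d3 t v' w Ox).
Qed.

Let zeta : 'rV[R]_m -> Cvec R n := Z \o phi.

Lemma zeta_derive v x : O x -> is_derive x v zeta ('D_v zeta x).
Proof. by move=> Ox; apply: differentiable_is_derive; exact: (@hZ O phi Op [::] x Ox). Qed.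

Definition param_defect v x : Cvec R n :=
  defect (F x) ('D_v F x) (zeta x) ('D_v zeta x).

Lemma psi_param_derive v w x : O x ->
  is_derive x v (fun y => psi (phi y) ('D_w F y))
    (psi_derivative (F x) ('D_v F x) ('D_w F x) ('D_v ('D_w F) x) (zeta x) ('D_v zeta x)).
Proof.
move=> Ox; apply: (is_derive_psi (fC (phi x))).
- exact: differentiable_is_derive (param_d0 Op Ox).
- exact: differentiable_is_derive (param_d1 Op w Ox).
- exact: zeta_derive.
Qed.

(** The tangent section [s u w] is differentiated along [v] by [section_derivative], and the result
    is antisymmetrised in [u] and [v]. *)
Lemma codazzi u v w x : O x ->
  let Psi v w := metric (F x) ('D_w F x) (param_defect v x) / 2 in
  tangent m f (phi x) ((Psi v u - Psi u v) *: J ('D_w F x)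
    + (Psi v w *: J ('D_u F x) - Psi u w *: J ('D_v F x))).
Proof.
move=> Ox Psi.
pose s u w y := 'D_u ('D_w F) y + J (psi (phi y) ('D_u F y) *: 'D_w F y
                                   + psi (phi y) ('D_w F y) *: 'D_u F y).
pose dp v w := psi_derivative (F x) ('D_v F x) ('D_w F x) ('D_v ('D_w F) x)
                 (zeta x) ('D_v zeta x).
pose p v := psi (phi x) ('D_v F x).
pose P u w := psi (phi x) (s u w x).
(* [A] and [B] are only given up to equality, so that both orders of differentiation can be written
   with the same mixed derivatives. *)
have Q v' u' A B : 'D_v' ('D_u' ('D_w F)) x = A -> 'D_v' ('D_u' F) x = B ->
   tangent m f (phi x)
   ((A + J ((dp v' u' *: 'D_w F x + p u' *: 'D_v' ('D_w F) x)
     + (dp v' w *: 'D_u' F x + p w *: B)))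
    + J (p v' *: ('D_u' ('D_w F) x + J (p u' *: 'D_w F x + p w *: 'D_u' F x))
         + P u' w *: 'D_v' F x)).
  move=> <- <-; apply: (section_derivative Ox).
    by move=> y Oy; exact: second_derivative_mod_tangent.
  apply: is_deriveD; first exact: differentiable_is_derive (param_d2 Op u' w Ox).
  apply: is_derive_J; apply: is_deriveD.
    apply: is_derive_scale; first exact: psi_param_derive.
    exact: differentiable_is_derive (param_d1 Op w Ox).
  apply: is_derive_scale; first exact: psi_param_derive.
  exact: differentiable_is_derive (param_d1 Op u' Ox).
have PsiE v' w' : Psi v' w' = dp v' w' - P v' w'.
  apply: esym; exact: (psi_derivative_defect _ _ _ _ _ (fC (phi x))).
have suv : s v u x = s u v x.
  exact: (congr2 +%R (derive_sym2 v u Ox) (congr1 (@J R n) (addrC _ _))).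
have Puv : P v u = P u v := congr1 (psi (phi x)) suv.
have H := tangentB fM (tangentB fM (Q v u _ _ erefl erefl)
   (Q u v _ _ (derive_sym3 u v w Ox) (derive_sym2 u v Ox)))
   (tangentB fM (tangentZ fM (p w * p u) (image_tangent v Ox))
                (tangentZ fM (p w * p v) (image_tangent u Ox))).
rewrite (PsiE v u) (PsiE u v) (PsiE v w) (PsiE u w) Puv.
apply: eq_rect H _ _; exact: codazzi_algebra.
Qed.

Lemma defect_tangent v x : O x -> tangent m f (phi x) (param_defect v x).
Proof.
move=> Ox; have ZT := Z_tangent (phi x); have XT := image_tangent v Ox.
have := section_derivative Ox (fun y _ => Z_tangent (phi y)) (zeta_derive v Ox).
rewrite /param_defect /defect christoffelE /psi hZ1 -[f (phi x)]/(F x) -[Z (phi x)]/(zeta x).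
rewrite -[Z (phi x)]/(zeta x) in ZT.
move: ('D_v zeta x) ('D_v F x) (zeta x) XT ZT => dz X z XT ZT H.
pose b := phi_re (F x) X - metric (F x) (J X) z / 2.
have := tangentDD fM H (tangentDD fM (tangentZ fM b ZT) (tangentZ fM (phi_re (F x) z) XT)).
congr (tangent m f (phi x) _); rewrite /b !JE.
move: (phi_re (F x) X) (phi_im (F x) X) (metric (F x) (J X) z) (phi_re (F x) z)
  (phi_im (F x) z) (metric (F x) X z) (J X) (J z) => *.
by cvec_coord; field.
Qed.

(** Since J Z is a tangent section as well as Z, the argument of [defect_tangent] applies to it.
    Together they place the defect in the maximal holomorphic subspace. *)
Lemma J_defect_tangent v x : O x -> tangent m f (phi x) (J (param_defect v x)).
Proof.
move=> Ox; have ZT := Z_tangent (phi x); have JZT := JZ_tangent (phi x).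
have XT := image_tangent v Ox.
have := section_derivative Ox (fun y _ => JZ_tangent (phi y))
  (is_derive_J (zeta_derive v Ox)).
rewrite /param_defect /defect christoffelE /psi -[f (phi x)]/(F x) -[Z (phi x)]/(zeta x).
rewrite -[Z (phi x)]/(zeta x) in ZT JZT.
have zz : metric (F x) (J (zeta x)) (zeta x) = 0.
  have := metricJl (F x) (zeta x) (zeta x); rewrite (metricC _ (zeta x) (J _)).
  by move: (metric _ _ _) => c; lra.
rewrite zz.
have -> : phi_im (F x) (J (zeta x)) = phi_re (F x) (zeta x) by rewrite /phi_im idotJl.
move: ('D_v zeta x) ('D_v F x) (zeta x) XT ZT JZT {zz} => dz X z XT ZT JZT H.
pose b := phi_re (F x) X - metric (F x) (J X) z / 2.
pose c := - (phi_im (F x) z + 2^-1).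
have := tangentDD fM H (tangentDD fM (tangentZ fM b JZT) (tangentZ fM c XT)).
congr (tangent m f (phi x) _); rewrite /b /c !JE.
move: (phi_re (F x) X) (phi_im (F x) X) (metric (F x) (J X) z) (phi_re (F x) z)
  (phi_im (F x) z) (metric (F x) X z) (J X) (J z) (J dz) => *.
by cvec_coord; field.
Qed.

Lemma tangent_coefficient p (b c d : R) X Y W :
  tangent m f p (d *: X + (b *: Y - c *: W)) -> tangent m f p X -> tangent m f p W ->
  tangent m f p (b *: Y).
Proof.
move=> H XT WT.
have := tangentDD fM (tangentB fM H (tangentZ fM d XT)) (tangentZ fM c WT).
by rewrite (addrC (d *: X)) addrK subrK.
Qed.

Lemma tangent_coefficient0 p (b c d : R) X W :
  tangent m f p ((b - d) *: X + (b *: X - c *: W)) -> b = 0 -> tangent m f p W ->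
  tangent m f p (d *: X).
Proof.
move=> H b0 WT; have := tangentDD fM H (tangentZ fM c WT).
by rewrite b0 scale0r !sub0r subrK scaleNr => /(tangentN fM); rewrite opprK.
Qed.

(** By tangency the defect equals some F_e, so [Psi v e] is half its squared length. The Codazzi
    relation is used to isolate this number as the coefficient of a vector that is not tangent. *)
Lemma param_defect0 v x : O x -> param_defect v x = 0.
Proof.
move=> Ox.
have [xi xiN xi0] := normal_nonzero fM (phi x) mn.
have [u0 u0E] := (tangentP _ Op Ox).1 (J_normal_tangent xiN).
rewrite -/F in u0E.
have notT (b : R) w : ~ tangent m f (phi x) w -> tangent m f (phi x) (b *: w) -> b = 0.
  move=> wT bw; apply: contrapT => /eqP b0; apply: wT.
  by have := tangentZ fM b^-1 bw; rewrite scalerA mulVf // scale1r.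
have xiT : ~ tangent m f (phi x) (J ('D_u0 F x)).
  rewrite -u0E JJ => xiT; have := xiN _ xiT; rewrite metricNr => /eqP; rewrite oppr_eq0 => /eqP.
  by move=> /(metric_eq0 (fC _))/eqP; rewrite (negPf xi0).
have errE w : exists2 e, param_defect w x = 'D_e F x & tangent m f (phi x) (J ('D_e F x)).
  have [e eE] := (tangentP _ Op Ox).1 (defect_tangent w Ox).
  by exists e => //; rewrite -[F]/(f \o phi) -eE; exact: J_defect_tangent.
have err0 w e : param_defect w x = 'D_e F x ->
    metric (F x) ('D_e F x) (param_defect w x) / 2 = 0 -> param_defect w x = 0.
  move=> <- /eqP; rewrite mulf_eq0 invr_eq0 pnatr_eq0 orbF => /eqP.
  exact: (metric_eq0 (fC (phi x))).
(* For holomorphic directions the vector is J F_u0, with F_u0 = J xi and [xi] a nonzero normal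
   vector; every other term is tangent. *)
have step1 w : tangent m f (phi x) (J ('D_w F x)) -> param_defect w x = 0.
  move=> wT; have [e eE eT] := errE w; apply: (err0 w e eE).
  apply: (notT _ _ xiT).
  exact: (tangent_coefficient (codazzi u0 w e Ox) eT wT).
have [vT|vT] := pselect (tangent m f (phi x) (J ('D_v F x))); first exact: step1.
have [e eE eT] := errE v; apply: (err0 v e eE).
apply: (notT _ _ vT).
(* If J F_v is not tangent it serves itself. The direction [e] is holomorphic, so [step1] removes
   the competing coefficient [Psi e v]. *)
have e0 : metric (F x) ('D_v F x) (param_defect e x) / 2 = 0.
  by rewrite (step1 e eT) metric0r mul0r.
exact: (tangent_coefficient0 (codazzi v e v Ox) e0 eT).
Qed.

End Param.
End Hypotheses.

(** * The ideal point *)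

Section IdealLimit.
Variables (R : realType) (n : nat).
Implicit Types (z X Z : Cvec R n).

(* [q = 1 - 2 i <Z, z> / (1 - |z|^2)] *)
Definition ideal_limit_qr z Z : R := 1 + 2 * phi_im z Z.
Definition ideal_limit_qi z Z : R := - (2 * phi_re z Z).

(* The point of the ideal boundary towards which the geodesic in the
   direction [- J Z] leaves [z]. *)
Definition ideal_limit z Z : Cvec R n :=
  z - cdiv (ideal_limit_qr z Z) (ideal_limit_qi z Z) (2 *: J Z).

Section Fixed.
Variables z Z : Cvec R n.
Hypotheses (zC : CH z) (Z1 : metric z Z Z = 1).
Let s0 : 1 - rdot z z != 0 := lt0r_neq0 (CH_gt0 zC).

Lemma metric_phi X Y : metric z X Y = 4 * (rdot X Y / (1 - rdot z z)
  + (phi_re z X * phi_re z Y + phi_im z X * phi_im z Y)).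
Proof. by rewrite /metric /phi_re /phi_im; field. Qed.

Let ZZ : rdot Z Z = (1 - rdot z z) * (1 / 4 - (phi_re z Z ^+ 2 + phi_im z Z ^+ 2)).
Proof.
move: Z1; rewrite metric_phi; move: (phi_re _ _) (phi_im _ _) => p r H.
have {H} : rdot Z Z / (1 - rdot z z) = 1 / 4 - (p ^+ 2 + r ^+ 2).
  rewrite !expr2; move: H; move: (rdot Z Z / _) (p * p + r * r) => c d; lra.
by move=> <-; rewrite mulrC divfK.
Qed.

Lemma ideal_limit_q0 : ideal_limit_qr z Z ^+ 2 + ideal_limit_qi z Z ^+ 2 != 0.
Proof.
apply/eqP => H; have := ZZ; have -> : 1 / 4 - (phi_re z Z ^+ 2 + phi_im z Z ^+ 2) = 0.
  move: H; rewrite /ideal_limit_qr /ideal_limit_qi => /eqP.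
  rewrite paddr_eq0 ?sqr_ge0 // !sqrf_eq0 => /andP[/eqP H1 /eqP H2].
  move: H1 H2; move: (phi_re _ _) (phi_im _ _) => p r H1 H2.
  have -> : p = 0 by lra.
  have -> : r = - (1 / 2) by lra.
  by field.
rewrite mulr0 => /rdot_eq0 Z0; move: Z1; rewrite Z0 metric0l => /eqP.
by rewrite eq_sym oner_eq0.
Qed.

Let zZr : rdot Z z = (1 - rdot z z) * phi_re z Z.
Proof. by rewrite /phi_re mulrC divfK. Qed.

Let zZi : idot Z z = (1 - rdot z z) * phi_im z Z.
Proof. by rewrite /phi_im mulrC divfK. Qed.

Lemma ideal_limit_norm : rdot (ideal_limit z Z) (ideal_limit z Z) = 1.
Proof.
have q0 := ideal_limit_q0; rewrite /ideal_limit rdotDl !rdotDr !rdotNr !rdotNl rdot_cdiv //.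
rewrite (rdotC z (cdiv _ _ _)) !rdot_cscalel !dotE zZr zZi ZZ.
move: q0; rewrite /ideal_limit_qr /ideal_limit_qi.
move: (phi_re _ _) (phi_im _ _) (rdot z z) => p r s q0.
by field.
Qed.

Lemma ideal_limit_denE : 1 - rdot z (ideal_limit z Z) =
    (1 - rdot z z) * ideal_limit_qr z Z / (ideal_limit_qr z Z ^+ 2 + ideal_limit_qi z Z ^+ 2) /\
  - idot z (ideal_limit z Z) =
    (1 - rdot z z) * ideal_limit_qi z Z / (ideal_limit_qr z Z ^+ 2 + ideal_limit_qi z Z ^+ 2).
Proof.
have q0 := ideal_limit_q0; rewrite rdotC idotC opprK /ideal_limit /cdiv.
rewrite rdotDl rdotNl idotDl idotNl rdot_cscalel idot_cscalel !dotE idotzz zZr zZi.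
move: q0; rewrite /ideal_limit_qr /ideal_limit_qi.
move: (phi_re _ _) (phi_im _ _) (rdot z z) => p r s q0.
by split; field.
Qed.

(** In complex form: <X, e> = (1 - <z, e>) (a + i psi), where a + i psi = phi(X) + i h(X, Z) / 2. *)
Lemma ideal_limit_form X (e := ideal_limit z Z) :
  let a := phi_re z X - metric z X (J Z) / 2 in
  rdot X e = (1 - rdot z e) * a + idot z e * psi_form z Z X /\
  idot X e = (1 - rdot z e) * psi_form z Z X - idot z e * a.
Proof.
have q0 := ideal_limit_q0; have [E1 E2] := ideal_limit_denE.
have E3 : idot z e = - ((1 - rdot z z) * ideal_limit_qi z Z / (ideal_limit_qr z Z ^+ 2 + ideal_limit_qi z Z ^+ 2)).
  by rewrite -E2 opprK.
rewrite /= E1 E3 {E1 E2 E3} /psi_form !metric_phi /e /ideal_limit /cdiv.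
rewrite rdotDr rdotNr idotDr idotNr rdot_cscaler idot_cscaler !dotE.
have -> : phi_re z (J Z) = - phi_im z Z by rewrite /phi_re rdotJl mulNr.
have -> : phi_im z (J Z) = phi_re z Z by rewrite /phi_im idotJl.
have -> : rdot X z = (1 - rdot z z) * phi_re z X by rewrite /phi_re mulrC divfK.
have -> : idot X z = (1 - rdot z z) * phi_im z X by rewrite /phi_im mulrC divfK.
move: q0 s0; rewrite /ideal_limit_qr /ideal_limit_qi.
move: (phi_re z Z) (phi_im z Z) (1 - rdot z z) (phi_re z X) (phi_im z X) (rdot X Z) (idot X Z)
  => p r s a b c d q0 s0'.
by split; field; rewrite q0 s0'.
Qed.

End Fixed.

Lemma is_derive_phi (V : normedModType R) (F zeta : V -> Cvec R n) (x v : V) X dz :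
  CH (F x) -> is_derive x v F X -> is_derive x v zeta dz ->
  let k := (1 - rdot (F x) (F x))^-1 in
  is_derive x v (fun y => phi_re (F y) (zeta y))
    ((rdot dz (F x) + rdot (zeta x) X) * k + rdot (zeta x) (F x) * (2 * rdot (F x) X * k ^+ 2)) /\
  is_derive x v (fun y => phi_im (F y) (zeta y))
    ((idot dz (F x) + idot (zeta x) X) * k + idot (zeta x) (F x) * (2 * rdot (F x) X * k ^+ 2)).
Proof.
move=> FC F' z' k; have kd := is_derive_ball_den FC F'.
split.
  have H := is_deriveM (is_derive_rdot z' F') kd.
  by apply: is_derive_eq H _; rewrite /GRing.scale /= -/k; ring.
have H := is_deriveM (is_derive_idot z' F') kd.
by apply: is_derive_eq H _; rewrite /GRing.scale /= -/k; ring.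
Qed.

(** With c = a + i b the conclusions read dz = - c Z - (i q / 2) X and dq = - c q, and these make
    the derivative of z - 2 i Z / q vanish. *)
Lemma ideal_limit_algebra z X Z dz : CH z -> defect z X Z dz = 0 ->
  let k := (1 - rdot z z)^-1 in
  let a := phi_re z X - metric z (J X) Z / 2 in
  let b := phi_im z X + metric z X Z / 2 in
  let p' := (rdot dz z + rdot Z X) * k + rdot Z z * (2 * rdot z X * k ^+ 2) in
  let r' := (idot dz z + idot Z X) * k + idot Z z * (2 * rdot z X * k ^+ 2) in
  [/\ dz = - cscale a b Z - cscale (- ideal_limit_qi z Z / 2) (ideal_limit_qr z Z / 2) X,
     - (a * ideal_limit_qr z Z - b * ideal_limit_qi z Z) = 2 * r' &
     - (a * ideal_limit_qi z Z + b * ideal_limit_qr z Z) = - (2 * p')].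
Proof.
move=> zC D0 k a b p' r'; have s0 := lt0r_neq0 (CH_gt0 zC).
have E : dz = - cscale a b Z - cscale (- ideal_limit_qi z Z / 2) (ideal_limit_qr z Z / 2) X.
  move: D0; rewrite /defect christoffelE => /eqP; rewrite -addrA addr_eq0 => /eqP ->.
  rewrite /a /b /ideal_limit_qr /ideal_limit_qi /cscale.
  move: (phi_re z X) (phi_im z X) (phi_re z Z) (phi_im z Z) (metric z X Z) (metric z (J X) Z)
    (J X) (J Z) => *.
  by cvec_coord; field.
split=> //; rewrite /p' /r' E ?rdotDl ?idotDl ?rdotNl ?idotNl ?(rdot_cscalel, idot_cscalel)
  /a /b /k /metric /ideal_limit_qr /ideal_limit_qi /phi_re /phi_im !dotE ?(rdotC Z X) ?(idotC Z X) (rdotC z X);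
  move: s0; move: (1 - rdot z z) (rdot X z) (idot X z) (rdot Z z) (idot Z z) (rdot X Z) (idot X Z)
    => s x1 x2 z1 z2 w1 w2 s0; by field.
Qed.

Lemma ideal_limit_derive (V : normedModType R) (F zeta : V -> Cvec R n) (x v : V) X dz :
  CH (F x) -> metric (F x) (zeta x) (zeta x) = 1 ->
  differentiable F x -> differentiable zeta x ->
  is_derive x v F X -> is_derive x v zeta dz ->
  defect (F x) X (zeta x) dz = 0 ->
  differentiable (fun y => ideal_limit (F y) (zeta y)) x /\
  is_derive x v (fun y => ideal_limit (F y) (zeta y)) 0.
Proof.
move=> FC Z1 Fd zd F' z' D0; have s0 := lt0r_neq0 (CH_gt0 FC).
have sd : differentiable (fun y => (1 - rdot (F y) (F y))^-1) x.
  apply: (@differentiableV _ _ (fun y => 1 - rdot (F y) (F y))) => //.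
  by apply: differentiableB; [exact: differentiable_cst|exact: differentiable_rdot].
have pd : differentiable (fun y => phi_re (F y) (zeta y)) x.
  by apply: (@differentiableM _ _ (fun y => rdot (zeta y) (F y))) => //; exact: differentiable_rdot.
have rd : differentiable (fun y => phi_im (F y) (zeta y)) x.
  by apply: (@differentiableM _ _ (fun y => idot (zeta y) (F y))) => //; exact: differentiable_idot.
have qrd : differentiable (fun y => ideal_limit_qr (F y) (zeta y)) x.
  apply: differentiableD; first exact: differentiable_cst.
  by apply: differentiableM => //; exact: differentiable_cst.
have qid : differentiable (fun y => ideal_limit_qi (F y) (zeta y)) x.
  apply: differentiableN; apply: differentiableM => //; exact: differentiable_cst.
have q0 := ideal_limit_q0 FC Z1.
have [p' r'] := is_derive_phi FC F' z'.
have [dzE E2 E3] := ideal_limit_algebra FC D0.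
have qr' := is_deriveD (is_derive_cst (1 : R) x v) (is_deriveZ 2 r').
have qi' := is_deriveN (is_deriveZ 2 p').
rewrite add0r -[2 *: _]/(2 * _) -E2 in qr'.
rewrite -[2 *: _]/(2 * _) -E3 in qi'.
have w' : is_derive x v (fun y => 2 *: J (zeta y)) (2 *: J dz).
  have := is_derive_scale (is_derive_cst (2 : R) x v) (is_derive_J z').
  by rewrite scale0r add0r.
have wd : differentiable (fun y => 2 *: J (zeta y)) x.
  by apply: differentiableZ; exact: differentiable_J.
split; first exact: (differentiableB Fd (differentiable_cdiv qrd qid wd q0)).
have H := is_deriveB F' (is_derive_cdiv qrd qid wd q0 qr' qi' w').
apply: is_derive_eq H _.
apply/eqP; rewrite subr_eq0 eq_sym; apply/eqP; apply: (cscale_inj q0); rewrite cdivK //.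
rewrite dzE; move: q0; move: (ideal_limit_qr _ _) (ideal_limit_qi _ _) => a b q0.
set c := phi_re _ _ - _; set d := phi_im _ _ + _; move: c d => c d.
rewrite /cdiv /cscale !JE; move: (J X) (J (zeta x)) => X' z1.
by cvec_coord; field.
Qed.

End IdealLimit.

Lemma zero_derivative_constant (R : realType) (m : nat) (g : 'rV[R]_m -> R)
    (x y : 'rV[R]_m) (r : R) : 0 < r ->
  (forall z, ball x r z -> differentiable g z) ->
  (forall z v, ball x r z -> 'D_v g z = 0) -> ball x r y -> g y = g x.
Proof.
move=> r0 gd g0 By; have Bx : ball x r x by exact: ballxx.
have [s s01] := @mean_value R _ g x (y - x) (fun s s01 => gd _ (ball_segment Bx By s01)).
rewrite (g0 _ _ (ball_segment Bx By s01)) subrK => /eqP.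
by rewrite subr_eq0 => /eqP.
Qed.

Lemma zero_derivative_constant_cvec (R : realType) (n m : nat) (g : 'rV[R]_m -> Cvec R n)
    (x y : 'rV[R]_m) (r : R) : 0 < r ->
  (forall z, ball x r z -> differentiable g z) ->
  (forall z v, ball x r z -> 'D_v g z = 0) -> ball x r y -> g y = g x.
Proof.
move=> r0 gd g0 By; apply: rdot_ext => t; rewrite !(rdotC _ t).
apply: (@zero_derivative_constant R m (fun y => rdot t (g y)) x y r) => // [z Bz|z v Bz].
  by apply: differentiable_rdot_cst; exact: gd.
have [_ ->] := is_derive_rdot_cst t (differentiable_is_derive v (gd z Bz)).
by rewrite (g0 z v Bz) rdot0r.
Qed.

(** The local hypothesis is symmetric in [q] and [q'], so [P] and its complement are both open. *)
Lemma connected_induction (T : topologicalType) (P : T -> Prop) :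
  connected [set: T] ->
  (forall p : T, exists2 U : set T, nbhs p U & forall q q', U q -> U q' -> P q -> P q') ->
  forall p q, P p -> P q.
Proof.
move=> Tc loc p q Pp.
have opP (Q : T -> Prop) :
    (forall p : T, exists2 U : set T, nbhs p U & forall q q', U q -> U q' -> Q q -> Q q') -> open [set x | Q x].
  move=> Ql; rewrite openE => x Qx; have [U xU UQ] := Ql x.
  have Ux := nbhs_singleton xU.
  by apply: filterS xU => y Uy; exact: UQ Ux Uy Qx.
have : [set x | P x] = setT.
  apply: Tc; first by exists p.
    by exists [set x | P x]; [exact: opP|rewrite setTI].
  exists [set x | P x]; last by rewrite setTI.
  rewrite -(setCK [set x | P x]); apply: open_closedC; apply: opP => x.
  have [U xU UP] := loc x; exists U => // y y' Uy Uy' Py Py'.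
  by apply: Py; exact: UP Py'.
by move=> PT; have : setT q by []; rewrite -PT.
Qed.

Section OrthonormalComplement.
Variables (R : realType) (n : nat).

Lemma unit_normal m (A : {linear 'rV[R]_m -> Cvec R n}) v : (forall d, v <> A d) ->
  exists2 xi, rdot xi xi = 1 & forall d, rdot xi (A d) = 0.
Proof.
move=> vA.
have [d dP] := @orth_proj R _ (@rdot R n) m A v (@rdotC R n) (@rdotDl R n)
   (@rdotZl R n) (@rdot_eq0 R n).
have w0 : v - A d != 0 by rewrite subr_eq0; apply/eqP.
move: (v - A d) w0 dP => w w0 dP.
have ww : 0 < rdot w w.
  by rewrite lt0r rdot_ge0 andbT; apply: contra_neq w0; exact: rdot_eq0.
exists ((Num.sqrt (rdot w w))^-1 *: w).
  rewrite rdotZl rdotZr mulrA -invfM -expr2 sqr_sqrtr ?ltW // mulVf //.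
  by rewrite lt0r_neq0.
by move=> d'; rewrite rdotZl dP mulr0.
Qed.

(** A unit normal is adjoined to [A] as an additional direction, and the induction continues with
    the enlarged map; the later vectors are then orthogonal to it automatically. *)
Lemma orthonormal_complement j m (A : {linear 'rV[R]_m -> Cvec R n}) : (m + j = n + n)%N ->
  (forall d, A d = 0 -> d = 0) ->
  exists s : nat -> Cvec R n,
  [/\ forall a b, (a < j)%N -> (b < j)%N -> rdot (s a) (s b) = (a == b)%:R,
      forall a d, (a < j)%N -> rdot (s a) (A d) = 0 &
      forall v, (forall a, (a < j)%N -> rdot (s a) v = 0) -> exists d, v = A d].
Proof.
have extend m' (B : {linear 'rV[R]_m' -> Cvec R n}) xi : (forall d, B d = 0 -> d = 0) ->
    rdot xi xi = 1 -> (forall d, rdot xi (B d) = 0) ->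
    exists2 B' : {linear 'rV[R]_(m' + 1) -> Cvec R n},
      (forall d, B' d = 0 -> d = 0) & forall d c, B' (row_mx d c) = B d + c 0 0 *: xi.
  move=> Bi xi1 xiB.
  pose B1 (d : 'rV[R]_(m' + 1)) : Cvec R n := B (lsubmx d) + rsubmx d 0 0 *: xi.
  have B1l : linear B1.
    move=> a d d'; rewrite /B1 !linearP /= mxE [X in (X + _) *: _]mxE.
    by rewrite scalerDl scalerDr -scalerA addrACA.
  pose B' : {linear 'rV[R]_(m' + 1) -> Cvec R n} :=
    HB.pack B1 (GRing.isLinear.Build _ _ _ _ _ B1l).
  exists B'; last by move=> d c; rewrite -[LHS]/(B1 _) /B1 row_mxKl row_mxKr.
  move=> d; rewrite -[B' d]/(B1 d) => B0.
  have d0 : rsubmx d 0 0 = 0.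
    have := congr1 (rdot xi) B0; rewrite /B1 rdotDr xiB rdotZr xi1 rdot0r add0r.
    by rewrite mulr1.
  move: B0; rewrite /B1 d0 scale0r addr0 => /Bi l0.
  rewrite -(hsubmxK d) l0; have -> : rsubmx d = 0.
    by apply/rowP => i; rewrite (ord1 i) d0 mxE.
  by rewrite row_mx0.
have notsurj m' (B : {linear 'rV[R]_m' -> Cvec R n}) : (forall d, B d = 0 -> d = 0) ->
    (forall v, exists d, v = B d) -> (n + n <= m')%N.
  move=> Bi Bs; have [|L _ LK] := @linear_left_inverse R n m' B; first exact: Bi.
  have [] // := @injective_dim R (n + n) m' (L \o @cvec_of_rv R n).
  move=> v /= Lv; have [d dE] := Bs (cvec_of_rv v).
  have d0 : d = 0 by rewrite -(LK d) -dE.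
  by rewrite -(cvec_of_rvK v) dE d0 !linear0.
elim: j m A => [|j IH] m A mj Ai.
  exists (fun=> 0); split=> // v _.
  (* A vector outside the image would enlarge [A] to an injection of a space of dimension 2n + 1
     into one of dimension 2n. *)
  apply: contrapT => /forallNP vA.
  have [xi xi1 xiA] := unit_normal vA.
  have [B' B'i _] := extend m A xi Ai xi1 xiA.
  have [+ _] := @injective_dim R (m + 1) (n + n) (@rv_of_cvec R n \o B')
    (fun x H => B'i _ (etrans (esym (rv_of_cvecK _)) (etrans (congr1 (@cvec_of_rv R n) H) (linear0 _)))).
  by rewrite -mj addn0 addn1 ltnn.
have [v vA] : exists v, forall d, v <> A d.
  apply: contrapT => /forallNP H.
  have surj v : exists d, v = A d by apply: contrapT => /forallNP; exact: H.
  by have := notsurj m A Ai surj; rewrite -mj leqNgt addnS ltnS leq_addr.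
have [xi xi1 xiA] := unit_normal vA.
have [B' B'i B'E] := extend m A xi Ai xi1 xiA.
have [|s [ss sB sv]] := IH _ B' _ B'i; first by rewrite -addnA add1n.
have sxi a : (a < j)%N -> rdot (s a) xi = 0.
  move=> aj; have := sB a (row_mx 0 1) aj.
  by rewrite B'E linear0 add0r mxE scale1r.
exists (fun a => if a is a'.+1 then s a' else xi); split.
- case=> [|a] [|b] //= aj bj.
  + by rewrite rdotC sxi.
  + by rewrite sxi.
  + exact: ss.
- case=> [|a] d aj //=.
  by have := sB a (row_mx d 0) aj; rewrite B'E mxE scale0r addr0.
move=> w wP; have [|d dE] := sv w; first by move=> a aj; exact: (wP a.+1).
exists (lsubmx d); move: dE; rewrite -(hsubmxK d) B'E row_mxKl => dE.
have := wP 0%N isT; rewrite dE rdotDr xiA rdotZr xi1 mulr1 add0r => ->.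
by rewrite scale0r addr0.
Qed.

End OrthonormalComplement.

(** * The image of the immersion in the chart *)

Section ChartDerivative.
Variables (R : realType) (n : nat) (e : Cvec R n).
Hypothesis ee : rdot e e = 1.
Implicit Types (z X Y eta : Cvec R n).

Definition dchart z X : Cvec R n :=
  cdiv (1 - rdot z e) (- idot z e) (X + cscale (rdot X e) (idot X e) (chart e z)).

Lemma cscaleP (a b c : R) X Y :
  cscale a b (c *: X + Y) = c *: cscale a b X + cscale a b Y.
Proof. by rewrite /cscale !JE; move: (J X) (J Y) => *; cvec_coord; ring. Qed.

Lemma cscaleN (a b : R) X : cscale (- a) (- b) X = - cscale a b X.
Proof. by rewrite /cscale !scaleNr opprD. Qed.

Lemma cdivD (a b : R) X Y : cdiv a b (X + Y) = cdiv a b X + cdiv a b Y.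
Proof. by have := cscaleP (a / (a ^+ 2 + b ^+ 2)) (- b / (a ^+ 2 + b ^+ 2)) 1 X Y; rewrite !scale1r. Qed.

Lemma cdiv_cscale (a b c d : R) X : a ^+ 2 + b ^+ 2 != 0 ->
  cdiv a b (cscale (a * c - b * d) (a * d + b * c) X) = c *: X + d *: J X.
Proof.
move=> d0; rewrite /cdiv /cscale !JE; move: (J X) => X'.
by cvec_coord; field.
Qed.

Lemma cscaleJ (a b : R) X : cscale a b (J X) = J (cscale a b X).
Proof. by rewrite /cscale !JE; move: (J X) => *; cvec_coord; ring. Qed.

Lemma dchartP z a X Y : dchart z (a *: X + Y) = a *: dchart z X + dchart z Y.
Proof.
rewrite /dchart /cdiv -cscaleP; congr (cscale _ _ _).
rewrite !dotE /cscale; move: (J (chart e z)) (chart e z) => g' g.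
move: (rdot X e) (idot X e) (rdot Y e) (idot Y e) => *.
by cvec_coord; ring.
Qed.

HB.instance Definition _ z := GRing.isLinear.Build R (Cvec R n) (Cvec R n) _
  (dchart z) (dchartP z).

Lemma dchartD z X Y : dchart z (X + Y) = dchart z X + dchart z Y.
Proof. by rewrite linearD. Qed.

Lemma dchartZ z a X : dchart z (a *: X) = a *: dchart z X.
Proof. by rewrite linearZ. Qed.

Lemma dchartJ z X : dchart z (J X) = J (dchart z X).
Proof.
rewrite /dchart /cdiv -cscaleJ; congr (cscale _ _ _).
rewrite !dotE /cscale; move: (chart e z) => g; rewrite !JE.
move: (J X) (J g) (rdot X e) (idot X e) => *.
by cvec_coord; ring.
Qed.

Lemma dchart_cscale z a b X : dchart z (cscale a b X) = cscale a b (dchart z X).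
Proof. by rewrite /cscale dchartD !dchartZ dchartJ. Qed.

Section AtPoint.
Variable z : Cvec R n.
Hypothesis zC : CH z.
Let d0 := chart_den ee zC.

Lemma rdot_dchart X (a := 1 - rdot z e) (b := - idot z e) :
  rdot (dchart z X) e =
    (rdot X e * (a ^+ 2 - b ^+ 2) + idot X e * (2 * a * b)) / (a ^+ 2 + b ^+ 2) ^+ 2 /\
  idot (dchart z X) e =
    (idot X e * (a ^+ 2 - b ^+ 2) - rdot X e * (2 * a * b)) / (a ^+ 2 + b ^+ 2) ^+ 2.
Proof.
have := d0; rewrite {}/a {}/b /dchart /chart /cdiv !rdot_cscalel !idot_cscalel.
rewrite !(rdotDl X) !(idotDl X) !(rdot_cscalel, idot_cscalel).
by move: (rdot X e) (idot X e) (rdot z e) (idot z e) => a b c d d1; split; field.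
Qed.

Lemma dchartK X (U := dchart z X) : X =
  cscale (1 - rdot z e) (- idot z e) (U - cscale (rdot U e) (idot U e) z).
Proof.
have [Ur Ui] := rdot_dchart X; rewrite {}/U Ur Ui {Ur Ui}.
have -> : dchart z X = cdiv (1 - rdot z e) (- idot z e)
   (X + cscale (rdot X e) (idot X e) (chart e z)) by [].
rewrite /chart; move: d0; rewrite /cdiv /cscale.
move: (1 - rdot z e) (- idot z e) (rdot X e) (idot X e) => a b c d d1.
rewrite !JE; move: (J X) (J z) => X' z'.
by cvec_coord; field.
Qed.

Lemma dchart_inj X : dchart z X = 0 -> X = 0.
Proof.
by move=> X0; rewrite (dchartK X) X0 /cscale !dotE !scale0r addr0 subr0 J0 !scaler0 addr0.
Qed.

(** The chart makes the complex lines through [e] parallel to [e]. *)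
Lemma dchart_ideal : dchart z (e - z) = cdiv (1 - rdot z e) (- idot z e) e.
Proof.
rewrite /dchart; congr cdiv.
have := cdivK z d0; rewrite -/(chart e z) => GE.
rewrite rdotDl rdotNl ee idotDl idotNl idotzz add0r GE.
by rewrite subrK.
Qed.

(* [Y] represents the linear form [rdot (dchart z _) eta]: the chart maps the
   orthogonal complement of a horizontal eta to that of [Y]. *)
Lemma conformal eta : rdot eta e = 0 -> idot eta e = 0 ->
  let G := chart e z in
  let Y := cscale (1 - rdot z e) (- idot z e)
     (eta + cscale (rdot eta G) (idot eta G) (e - z)) in
  forall X, metric z X Y =
    4 * ((1 - rdot z e) ^+ 2 + idot z e ^+ 2) / (1 - rdot z z) * rdot (dchart z X) eta.
Proof.
move=> re ie G Y X; have s0 := lt0r_neq0 (CH_gt0 zC).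
have er : rdot e eta = 0 by rewrite rdotC.
have ei : idot e eta = 0 by rewrite idotC ie oppr0.
rewrite /Y /G /metric /dchart /chart /cdiv.
rewrite !(rdot_cscalel, idot_cscalel, rdot_cscaler, idot_cscaler).
rewrite !(rdotDl X, rdotDr eta, idotDl X, idotDr eta, rdotDl eta, idotDl eta).
rewrite !(rdot_cscalel, idot_cscalel, rdot_cscaler, idot_cscaler) !dotE ?idotzz.
rewrite (rdotC eta z) (idotC eta z) (rdotC e z) (idotC e z).
move: d0 s0; move: (rdot z z) (rdot X e) (idot X e) (rdot z e) (idot z e)
  (rdot z eta) (idot z eta) (rdot X eta) (idot X eta) (rdot X z) (idot X z).
by move=> s x1 x2 z1 z2 h1 h2 y1 y2 x3 x4 d1 s1; field; rewrite d1 s1.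
Qed.

End AtPoint.

Section AlongMap.
Variables (V : normedModType R) (F : V -> Cvec R n) (x : V).
Hypotheses (FC : CH (F x)) (Fd : differentiable F x).

Lemma differentiable_chart_re : differentiable (fun y => 1 - rdot (F y) e) x.
Proof.
apply: differentiableB; first exact: differentiable_cst.
by apply: differentiable_rdot; [exact: Fd|exact: differentiable_cst].
Qed.

Lemma differentiable_chart_im : differentiable (fun y => - idot (F y) e) x.
Proof.
apply: differentiableN.
by apply: differentiable_idot; [exact: Fd|exact: differentiable_cst].
Qed.

Lemma differentiable_chart : differentiable (fun y => chart e (F y)) x.
Proof. exact: (differentiable_cdiv differentiable_chart_re differentiable_chart_im Fd (chart_den ee FC)). Qed.

Let rd (W : V -> Cvec R n) v D : is_derive x v W D ->
  is_derive x v (fun y => rdot (W y) e) (rdot D e) /\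
  is_derive x v (fun y => idot (W y) e) (idot D e).
Proof.
move=> W'; have c := is_derive_cst e x v; split.
  by apply: is_derive_eq (is_derive_rdot W' c) _; rewrite rdot0r addr0.
by apply: is_derive_eq (is_derive_idot W' c) _; rewrite idot0r addr0.
Qed.

Let den' v X : is_derive x v F X ->
  is_derive x v (fun y => 1 - rdot (F y) e) (- rdot X e) /\
  is_derive x v (fun y => - idot (F y) e) (- idot X e).
Proof.
move=> /rd[r' i']; split; last exact: is_deriveN i'.
by apply: is_derive_eq (is_deriveB (is_derive_cst (1 : R) x v) r') _; rewrite sub0r.
Qed.

Lemma is_derive_chart v X : is_derive x v F X ->
  is_derive x v (fun y => chart e (F y)) (dchart (F x) X).
Proof.
move=> F'; have [r' i'] := den' F'.
apply: is_derive_eq (is_derive_cdiv differentiable_chart_re differentiable_chart_im Fd (chart_den ee FC) r' i' F') _.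
by rewrite /dchart cscaleN opprK.
Qed.

Lemma differentiable_dchart (W : V -> Cvec R n) : differentiable W x ->
  differentiable (fun y => dchart (F y) (W y)) x.
Proof.
move=> Wd; have ed : differentiable (cst e : V -> Cvec R n) x by exact: differentiable_cst.
have Gd := differentiable_cscale (differentiable_rdot Wd ed) (differentiable_idot Wd ed)
  differentiable_chart.
exact: (differentiable_cdiv differentiable_chart_re differentiable_chart_im (differentiableD Wd Gd) (chart_den ee FC)).
Qed.

Lemma is_derive_dchart (W : V -> Cvec R n) v X (D : Cvec R n) :
  is_derive x v F X -> is_derive x v W D -> differentiable W x ->
  is_derive x v (fun y => dchart (F y) (W y))
    (dchart (F x) D
     + cdiv (1 - rdot (F x) e) (- idot (F x) e)
         (cscale (rdot (W x) e) (idot (W x) e) (dchart (F x) X))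
     + cdiv (1 - rdot (F x) e) (- idot (F x) e)
         (cscale (rdot X e) (idot X e) (dchart (F x) (W x)))).
Proof.
move=> F' W' Wd.
have [r' i'] := den' F'; have [Wr' Wi'] := rd W'.
have G' := is_derive_chart F'.
have cG' := is_derive_cscale Wr' Wi' G'.
have cGd : differentiable (fun y => cscale (rdot (W y) e) (idot (W y) e) (chart e (F y))) x.
  by apply: differentiable_cscale; [apply: differentiable_rdot|apply: differentiable_idot
    |exact: differentiable_chart]; rewrite //; exact: differentiable_cst.
have H := is_derive_cdiv differentiable_chart_re differentiable_chart_im (differentiableD Wd cGd) (chart_den ee FC) r' i'
  (is_deriveD W' cG').
apply: is_derive_eq H _.
have split3 (p q : R) (A1 A2 A3 : Cvec R n) :
    cdiv p q (D + (A1 + A2) + A3) = cdiv p q (D + A1) + cdiv p q A2 + cdiv p q A3.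
  by rewrite (cdivD p q _ A3) (addrA D A1 A2) (cdivD p q _ A2).
rewrite cscaleN opprK; apply: etrans (split3 _ _ _ _ _) _.
by rewrite -[X in X + _ + _ = _]/(dchart (F x) D).
Qed.

End AlongMap.

(* [a + i b] and [c + i d] are the values at [X] and [W] of the connection form
   <., e> / (1 - <z, e>); their real parts only contribute tangential terms. *)
Lemma dchart_second z (X W D : Cvec R n) (a b c d : R) : CH z ->
  rdot X e = (1 - rdot z e) * a + idot z e * b ->
  idot X e = (1 - rdot z e) * b - idot z e * a ->
  rdot W e = (1 - rdot z e) * c + idot z e * d ->
  idot W e = (1 - rdot z e) * d - idot z e * c ->
  dchart z D + cdiv (1 - rdot z e) (- idot z e) (cscale (rdot W e) (idot W e) (dchart z X))
    + cdiv (1 - rdot z e) (- idot z e) (cscale (rdot X e) (idot X e) (dchart z W))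
  = dchart z (D + J (b *: W + d *: X)) + (a *: dchart z W + c *: dchart z X).
Proof.
move=> zC Xr Xi Wr Wi.
have E (u1 u2 : R) Y : rdot Y e = (1 - rdot z e) * u1 + idot z e * u2 ->
    idot Y e = (1 - rdot z e) * u2 - idot z e * u1 ->
    forall U : Cvec R n, cdiv (1 - rdot z e) (- idot z e) (cscale (rdot Y e) (idot Y e) U)
      = u1 *: U + u2 *: J U.
  move=> Yr Yi U; have H1 := cdiv_cscale u1 u2 U (chart_den ee zC).
  apply: etrans _ H1.
  by rewrite Yr Yi !mulNr opprK.
have EX := E a b X Xr Xi (dchart z W).
have EW := E c d W Wr Wi (dchart z X).
have EL : dchart z (D + J (b *: W + d *: X)) =
  dchart z D + (b *: J (dchart z W) + d *: J (dchart z X)).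
  apply: etrans (dchartD _ _ _) (congr1 (+%R _) _).
  apply: etrans (dchartJ _ _) _; rewrite -!JZ -JD; congr J.
  by rewrite dchartP dchartZ.
rewrite EL; apply: etrans (congr2 +%R (congr1 (+%R _) EW) EX) _.
move: (dchart z D) (dchart z W) (dchart z X) => U1 U2 U3.
move: (J U2) (J U3) => U4 U5; clear.
by cvec_coord; ring.
Qed.

End ChartDerivative.

Lemma near_eq_differentiable (R : realType) (V W : normedModType R) (f g : V -> W) x :
  (\near x, f x = g x) -> differentiable f x -> differentiable g x.
Proof.
move=> fg fd; have fc := diff_continuous fd.
have H : g \o shift x = cst (g x) + 'd f x +o_ (0 : V) id.
  apply/eqaddoP => eps e0.
  have /eqaddoP/(_ eps e0) Hf := diff_locally fd.
  have fg0 : \forall h \near (0 : V), f (h + x) = g (h + x).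
    by move: fg; rewrite (near_shift 0) subr0.
  apply: filterS2 fg0 Hf => h fgh.
  rewrite -[(_ - (_ + _)) _]/((f \o shift x) h - (f x + 'd f x h)).
  rewrite -[(_ - (_ + _)) _]/((g \o shift x) h - (g x + 'd f x h)).
  by rewrite /= fgh (nbhs_singleton fg).
have E := diff_unique fc H.
by apply/diff_locallyP; rewrite E.
Qed.

(** * Constancy of the ideal point and of the normal space *)

Section Global.
Variables (R : realType) (n m : nat) (T : topologicalType) (f : T -> Cvec R n).
Variables (Z : T -> Cvec R n) (II : T -> Cvec R n -> Cvec R n -> Cvec R n).
Hypothesis fM : submanifold m f.
Hypothesis mn : (m < n + n)%N.
Hypothesis Tc : connected [set: T].
Hypothesis hreal : totally_real_normal_bundle m f.
Hypothesis hZ : smooth_field m f Z.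
Hypothesis hZD : forall p, max_holomorphic m f p (Z p).
Hypothesis hZ1 : forall p, metric (f p) (Z p) (Z p) = 1.
Hypothesis hII : second_fundamental_form m f II.
Hypothesis hIIZ : trivial_bilinear_extension m f Z II.

Let fC p : CH (f p) := submanifold_CH fM p.

Lemma param_ball p : exists (O : set 'rV[R]_m) (phi : 'rV[R]_m -> T) x,
  [/\ local_param f O phi, O x, phi x = p &
   forall r0 : R, 0 < r0 -> exists2 r, 0 < r <= r0 &
     ball x r `<=` O /\ nbhs p (phi @` ball x r)].
Proof.
have [A [phi [x [Op Ax xp]]]] := paramP fM p.
exists A, phi, x; split=> // r0 r00.
have /nbhs_ballP[r /= r_gt0 rA] := param_near Op Ax.
exists (Num.min r r0); first by rewrite lt_min r_gt0 r00 ge_min lexx orbT.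
have sub : ball x (Num.min r r0) `<=` A.
  by apply: subset_trans rA; apply: le_ball; rewrite ge_min lexx.
split=> //; rewrite -xp.
have Bx : nbhs x (ball x (Num.min r r0)) by apply: nbhsx_ballx; rewrite lt_min r_gt0.
apply: filterS (param_nbhs Op Ax Bx).
by apply: image_subset => y [].
Qed.

Lemma ideal_limit_constant p q : ideal_limit (f q) (Z q) = ideal_limit (f p) (Z p).
Proof.
apply: (@connected_induction T (fun q => ideal_limit (f q) (Z q) = ideal_limit (f p) (Z p)) Tc _ p) => // {}q.
have [A [phi [x [Op Ax xq H]]]] := param_ball q.
have [r /andP[r0 _] [BA Bq]] := H 1 ltr01.
exists (phi @` ball x r) => // _ _ [y By <-] [y' By' <-].
pose g y := ideal_limit (f (phi y)) (Z (phi y)).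
have gd z v : ball x r z -> differentiable g z /\ is_derive z v g 0.
  move=> /BA Oz.
  have zd : differentiable (Z \o phi) z by exact: (@hZ A phi Op [::] z Oz).
  have fd := param_d0 Op Oz.
  exact: (ideal_limit_derive (F := f \o phi) (zeta := Z \o phi) (fC (phi z)) (hZ1 (phi z)) fd zd
     (differentiable_is_derive v fd) (differentiable_is_derive v zd)
     (param_defect0 fM mn hreal hZ hZD hZ1 hII hIIZ Op v Oz)).
have gc z : ball x r z -> g z = g x.
  apply: (zero_derivative_constant_cvec r0) => [w Bw|w v Bw].
    by have [] := gd w 0 Bw.
  by have [_ [_ ->]] := gd w v Bw.
by rewrite -/(g y) -/(g y') (gc y By) (gc y' By').
Qed.

Section IdealPoint.
Variable e : Cvec R n.
Hypothesis ee : rdot e e = 1.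
Hypothesis he : forall p, ideal_limit (f p) (Z p) = e.

Let a p X := phi_re (f p) X - metric (f p) X (J (Z p)) / 2.

Lemma ideal_form p X :
  rdot X e = (1 - rdot (f p) e) * a p X + idot (f p) e * psi f Z p X /\
  idot X e = (1 - rdot (f p) e) * psi f Z p X - idot (f p) e * a p X.
Proof. by have := ideal_limit_form (fC p) (hZ1 p) X; rewrite he. Qed.

Section Param.
Variables (A : set 'rV[R]_m) (phi : 'rV[R]_m -> T).
Hypothesis Op : local_param f A phi.
Let F : 'rV[R]_m -> Cvec R n := f \o phi.
Let G : 'rV[R]_m -> Cvec R n := fun y => chart e (F y).

Let dF u y : A y -> is_derive y u F ('D_u F y).
Proof. by move=> Ay; exact: differentiable_is_derive (param_d0 Op Ay). Qed.

Lemma chart_param_d0 y : A y -> differentiable G y.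
Proof. by move=> Ay; exact: (differentiable_chart ee (fC (phi y)) (param_d0 Op Ay)). Qed.

Lemma chart_param_derive u y : A y -> 'D_u G y = dchart e (F y) ('D_u F y).
Proof.
move=> Ay.
by have [_ ->] := is_derive_chart ee (F := F) (fC (phi y)) (param_d0 Op Ay) (dF u Ay).
Qed.

Lemma chart_param_inj d y : A y -> 'D_d G y = 0 -> d = 0.
Proof.
move=> Ay; rewrite (chart_param_derive d Ay) => /(dchart_inj ee (fC (phi y))).
exact: (param_inj Op Ay).
Qed.

Let near_derive u y : A y -> \near y, dchart e (F y) ('D_u F y) = 'D_u G y.
Proof.
by move=> /(param_near Op); apply: filterS => z Az; rewrite (chart_param_derive u Az).
Qed.

Lemma chart_param_d1 u y : A y -> differentiable ('D_u G) y.
Proof.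
move=> Ay; apply: (near_eq_differentiable (near_derive u Ay)).
exact: (differentiable_dchart ee (F := F) (fC (phi y)) (param_d0 Op Ay) (param_d1 Op u Ay)).
Qed.

Let S u w y := dchart e (F y) ('D_u ('D_w F) y)
  + cdiv (1 - rdot (F y) e) (- idot (F y) e)
      (cscale (rdot ('D_w F y) e) (idot ('D_w F y) e) (dchart e (F y) ('D_u F y)))
  + cdiv (1 - rdot (F y) e) (- idot (F y) e)
      (cscale (rdot ('D_u F y) e) (idot ('D_u F y) e) (dchart e (F y) ('D_w F y))).

Lemma chart_param_derive2 u w y : A y -> 'D_u ('D_w G) y = S u w y.
Proof.
move=> Ay; rewrite -(near_eq_derive u (near_derive w Ay)).
by have [_ ->] := is_derive_dchart ee (F := F) (fC (phi y)) (param_d0 Op Ay) (dF u Ay)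
  (differentiable_is_derive u (param_d1 Op w Ay)) (param_d1 Op w Ay).
Qed.

Lemma chart_param_c2 u w y : A y -> {for y, continuous ('D_u ('D_w G))}.
Proof.
move=> Ay; apply: differentiable_continuous.
have ed : differentiable (cst e : 'rV[R]_m -> Cvec R n) y by exact: differentiable_cst.
have part u' w' : differentiable (fun y => cdiv (1 - rdot (F y) e) (- idot (F y) e)
    (cscale (rdot ('D_w' F y) e) (idot ('D_w' F y) e) (dchart e (F y) ('D_u' F y)))) y.
  have Wd := param_d1 Op w' Ay; have Fd := param_d0 Op Ay.
  have cd := differentiable_cscale (differentiable_rdot Wd ed) (differentiable_idot Wd ed)
    (differentiable_dchart ee (F := F) (fC (phi y)) Fd (param_d1 Op u' Ay)).
  exact: (differentiable_cdiv (differentiable_chart_re e Fd) (differentiable_chart_im e Fd)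
    cd (chart_den ee (fC (phi y)))).
have Sd : differentiable (S u w) y.
  apply: differentiableD; last exact: part.
  apply: differentiableD; last exact: part.
  exact: (differentiable_dchart ee (F := F) (fC (phi y)) (param_d0 Op Ay) (param_d2 Op u w Ay)).
apply: near_eq_differentiable Sd.
by apply: filterS (param_near Op Ay) => z Az; rewrite chart_param_derive2.
Qed.

Lemma chart_param_flat u w y : A y -> image_space G y ('D_u ('D_w G) y).
Proof.
move=> Ay; rewrite (chart_param_derive2 u w Ay) /S.
have [Xr Xi] := ideal_form (phi y) ('D_u F y).
have [Wr Wi] := ideal_form (phi y) ('D_w F y).
rewrite (dchart_second ee _ (fC (phi y)) Xr Xi Wr Wi).
have H := second_derivative_mod_tangent fM hreal hZD hZ1 hII hIIZ Op u w Ay.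
(* The real parts [a] of the connection form are restored here; they only add tangent vectors. *)
have H1 := tangentDD fM H (tangentDD fM
  (tangentZ fM (a (phi y) ('D_u F y)) (image_tangent Op w Ay))
  (tangentZ fM (a (phi y) ('D_w F y)) (image_tangent Op u Ay))).
have [c cE] := (tangentP _ Op Ay).1 H1.
exists c; rewrite (chart_param_derive c Ay) -[F]/(f \o phi) -cE.
have lin (P W U : Cvec R n) (p q : R) : dchart e (F y) (P + (p *: W + q *: U)) =
    dchart e (F y) P + (p *: dchart e (F y) W + q *: dchart e (F y) U).
  by rewrite !dchartD !dchartZ.
exact: esym (lin _ _ _ _ _).
Qed.

Lemma chart_tangent_local x : A x -> exists2 r : R, 0 < r &
  forall y y' t, ball x r y -> ball x r y' -> A y -> A y' ->
    (forall X, tangent m f (phi y) X -> rdot (dchart e (f (phi y)) X) t = 0) ->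
    (forall X, tangent m f (phi y') X -> rdot (dchart e (f (phi y')) X) t = 0).
Proof.
move=> Ax; have near := param_near Op Ax.
have [|d||||r r0 H] := @image_space_locally_constant R n m G x.
- by apply: filterS near => y; exact: chart_param_d0.
- by apply: filterS near => y; exact: chart_param_d1.
- by move=> d d'; exact: chart_param_c2.
- by move=> d; exact: (chart_param_inj Ax).
- by apply: filterS near => y Ay d d'; exact: chart_param_flat.
exists r => // y y' t By By' Ay Ay' Ht X /(tangentP _ Op Ay')[d ->].
rewrite -(chart_param_derive d Ay'); apply: H By By' _ d => d.
by rewrite (chart_param_derive d Ay); exact: Ht _ (image_tangent Op d Ay).
Qed.

End Param.

(** The Euclidean normal space of the image in the chart, which unlike [normal] turns out not to
    vary with [p]. *)
Definition chart_normal p t := forall X, tangent m f p X -> rdot (dchart e (f p) X) t = 0.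

Lemma chart_normal_constant t p q : chart_normal p t -> chart_normal q t.
Proof.
apply: (@connected_induction T (chart_normal^~ t) Tc _ p q) => {}p.
have [A [phi [x [Op Ax xp H]]]] := param_ball p.
have [r0 r00 Hr] := chart_tangent_local Op Ax.
have [r /andP[r_gt0 rr0] [BA Bp]] := H r0 r00.
exists (phi @` ball x r) => // _ _ [y By <-] [y' By' <-].
by apply: Hr; rewrite ?(BA y) ?(BA y') //; [exact: le_ball By|exact: le_ball By'|exact: BA|exact: BA].
Qed.

Lemma chart_component_constant t p q : chart_normal p t ->
  rdot (chart e (f q)) t = rdot (chart e (f p)) t.
Proof.
move=> pt.
apply: (@connected_induction T (fun q => rdot (chart e (f q)) t = rdot (chart e (f p)) t)
  Tc _ p) => // {}q.
have [A [phi [x [Op Ax xq H]]]] := param_ball q.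
have [r /andP[r0 _] [BA Bq]] := H 1 ltr01.
exists (phi @` ball x r) => // _ _ [y By <-] [y' By' <-].
pose g y := rdot t (chart e (f (phi y))).
have gc z : ball x r z -> g z = g x.
  apply: (zero_derivative_constant r0) => [w Bw|w v Bw].
    by apply: differentiable_rdot_cst; exact: (chart_param_d0 Op (BA w Bw)).
  have wd := chart_param_d0 Op (BA w Bw).
  have [_ ->] := is_derive_rdot_cst t (differentiable_is_derive v wd).
  rewrite (chart_param_derive Op v (BA w Bw)) rdotC.
  by apply: (chart_normal_constant pt); exact: (image_tangent Op v (BA w Bw)).
rewrite ![rdot _ t]rdotC -/(g y) -/(g y').
by rewrite (gc y By) (gc y' By').
Qed.

End IdealPoint.
End Global.

(** * The normal space and the congruence *)

Section NormalSpace.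
Variables (R : realType) (n m : nat) (T : topologicalType) (f : T -> Cvec R n).
Variables (Z : T -> Cvec R n) (II : T -> Cvec R n -> Cvec R n -> Cvec R n).
Hypothesis fM : submanifold m f.
Hypothesis mn : (m < n + n)%N.
Hypothesis Tc : connected [set: T].
Hypothesis hreal : totally_real_normal_bundle m f.
Hypothesis hZ : smooth_field m f Z.
Hypothesis hZD : forall p, max_holomorphic m f p (Z p).
Hypothesis hZ1 : forall p, metric (f p) (Z p) (Z p) = 1.
Hypothesis hII : second_fundamental_form m f II.
Hypothesis hIIZ : trivial_bilinear_extension m f Z II.
Variable e : Cvec R n.
Hypothesis ee : rdot e e = 1.
Hypothesis he : forall p, ideal_limit (f p) (Z p) = e.

Let fC p : CH (f p) := submanifold_CH fM p.
Let chart_normal := chart_normal m f e.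
Let chart_normal_constant := chart_normal_constant fM Tc hreal hZD hZ1 hII hIIZ ee he.
Let chart_component_constant := chart_component_constant fM Tc hreal hZD hZ1 hII hIIZ ee he.

(* [e - z] is a complex multiple of [Z]. *)
Lemma chart_normal_ideal p t : chart_normal p t -> rdot t e = 0 /\ idot t e = 0.
Proof.
move=> tN; have d0 := chart_den ee (fC p); have q0 := ideal_limit_q0 (fC p) (hZ1 p).
have Ut := tN _ (Z_tangent hZD p).
have JUt := tN _ (JZ_tangent fM hZD p); rewrite dchartJ in JUt.
have {}JUt : idot (dchart e (f p) (Z p)) t = 0.
  by apply/eqP; rewrite -oppr_eq0 -rdotJl JUt.
have eE : e = cscale (1 - rdot (f p) e) (- idot (f p) e) (dchart e (f p) (e - f p)).
  by rewrite dchart_ideal // cdivK.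
have eZ : e - f p = - cdiv (ideal_limit_qr (f p) (Z p)) (ideal_limit_qi (f p) (Z p)) (2 *: J (Z p)).
  by rewrite -{1}(he p) /ideal_limit addrC addrA addNr add0r.
have [a [b H0]] : exists a b,
    dchart e (f p) (e - f p) = - cscale a b (2 *: J (dchart e (f p) (Z p))).
  exists (ideal_limit_qr (f p) (Z p) / (ideal_limit_qr (f p) (Z p) ^+ 2 + ideal_limit_qi (f p) (Z p) ^+ 2)).
  exists (- ideal_limit_qi (f p) (Z p) / (ideal_limit_qr (f p) (Z p) ^+ 2 + ideal_limit_qi (f p) (Z p) ^+ 2)).
  by rewrite eZ linearN /= /cdiv dchart_cscale dchartZ dchartJ.
have H : rdot e t = 0 /\ idot e t = 0.
  move: eE; rewrite H0; move: (dchart e (f p) (Z p)) Ut JUt => U Ut JUt.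
  move: (1 - _) (- idot _ _) => c d ->.
  by rewrite rdot_cscalel idot_cscalel rdotNl idotNl rdot_cscalel idot_cscalel !dotE Ut JUt;
    split; ring.
by have [H1 H2] := H; rewrite rdotC H1 idotC H2 oppr0.
Qed.

(** By [conformal], a chart normal [u] gives the metric normal [Y u], and [dchart] maps [Y s] to [s]
    plus a complex multiple of [e]. The multiple is invisible to [t], so total reality of the metric
    normals passes to the chart. *)
Lemma chart_normal_real p s t : chart_normal p s -> chart_normal p t -> rdot s (J t) = 0.
Proof.
move=> sN tN; have [se sie] := chart_normal_ideal sN; have [te tie] := chart_normal_ideal tN.
have d0 := chart_den ee (fC p).
pose Y (u : Cvec R n) := cscale (1 - rdot (f p) e) (- idot (f p) e)
  (u + cscale (rdot u (chart e (f p))) (idot u (chart e (f p))) (e - f p)).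
pose K := 4 * ((1 - rdot (f p) e) ^+ 2 + idot (f p) e ^+ 2) / (1 - rdot (f p) (f p)).
have YE (u : Cvec R n) : rdot u e = 0 -> idot u e = 0 ->
    forall X, metric (f p) X (Y u) = K * rdot (dchart e (f p) X) u.
  by move=> ue uie X; exact: (conformal ee (fC p) ue uie).
have YN u : chart_normal p u -> normal m f p (Y u).
  move=> uN X XT; have [ue uie] := chart_normal_ideal uN.
  by rewrite metricC (YE u ue uie) (uN X XT) mulr0.
have := hreal (YN _ sN) (YN _ tN); rewrite (YE t te tie).
have k0 : K != 0.
  rewrite !mulf_neq0 ?invr_eq0 ?pnatr_eq0 //; last exact/lt0r_neq0/CH_gt0/fC.
  by move: d0; rewrite sqrrN.
move=> /eqP; rewrite mulf_eq0 (negPf k0) /= dchartJ => /eqP.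
rewrite /Y dchart_cscale dchartD dchart_cscale dchart_ideal //.
have -> : dchart e (f p) s = cdiv (1 - rdot (f p) e) (- idot (f p) e) s.
  by rewrite /dchart se sie /cscale !scale0r addr0 addr0.
rewrite rdotJl => /eqP; rewrite oppr_eq0 => /eqP.
move: (rdot s (chart _ _)) (idot s (chart _ _)) => a b.
have et : rdot e t = 0 by rewrite rdotC.
have eit : idot e t = 0 by rewrite idotC tie oppr0.
rewrite -[rdot s (J t)]/(idot s t).
move: d0; rewrite /cdiv; move: (1 - _) (- idot _ _) => c d d0.
rewrite idot_cscalel (idotDl (cscale _ _ s)) (rdotDl (cscale _ _ s)).
rewrite !(rdot_cscalel, idot_cscalel) et eit.
move: (rdot s t) (idot s t) => u v.
by move=> H; rewrite -{}H; field.
Qed.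

Variable p0 : T.
Variable k : nat.
Hypothesis mk : (m + k = n + n)%N.

Lemma chart_normal_basis : exists s : nat -> Cvec R n,
  [/\ forall a b, (a < k)%N -> (b < k)%N -> rdot (s a) (s b) = (a == b)%:R,
      forall a, (a < k)%N -> chart_normal p0 (s a) &
      forall v, (forall a, (a < k)%N -> rdot (s a) v = 0) ->
        exists2 X, tangent m f p0 X & v = dchart e (f p0) X].
Proof.
have [A [phi [x [Op Ax xp]]]] := paramP fM p0.
pose G y := chart e (f (phi y)).
have Gd : differentiable G x by exact: (chart_param_d0 fM ee Op Ax).
have GE d : 'D_d G x = dchart e (f p0) ('D_d (f \o phi) x).
  by rewrite (chart_param_derive fM ee Op d Ax) /= xp.
have GdE d : 'D_d G x = 'd G x d by exact: deriveE.
have Gi d : 'd G x d = 0 -> d = 0.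
  by rewrite -GdE; exact: (chart_param_inj fM ee Op Ax).
have [s [ss sG sv]] := @orthonormal_complement R n k m ('d G x) mk Gi.
exists s; split=> // [a ak X|v vs].
  rewrite -xp => /(tangentP _ Op Ax)[d ->].
  by rewrite xp -GE GdE rdotC sG.
have [d dE] := sv v vs; exists ('D_d (f \o phi) x).
  by rewrite -xp; exact: (image_tangent Op d Ax).
by rewrite -GE GdE.
Qed.

(** [local_surjectivity] supplies x' whose chart image agrees with that of [y] under [L]. Their
    difference has no normal components, so it is tangent, and [L] is injective on tangent
    vectors. *)
Lemma local_model (s : nat -> Cvec R n) p : 
  (forall a, (a < k)%N -> chart_normal p0 (s a)) ->
  (forall v, (forall a, (a < k)%N -> rdot (s a) v = 0) ->
        exists2 X, tangent m f p0 X & v = dchart e (f p0) X) ->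
  \forall y \near f p, CH y ->
    (forall a, (a < k)%N -> rdot (chart e y) (s a) = rdot (chart e (f p0)) (s a)) ->
    exists q, f q = y.
Proof.
move=> sN sv; have [A [phi [x [Op Ax xp]]]] := paramP fM p.
pose G y := chart e (f (phi y)).
have Gd : \forall y \near x, differentiable G y.
  by apply: filterS (param_near Op Ax) => y Ay; exact: (chart_param_d0 fM ee Op Ay).
have Gc d : {for x, continuous ('D_d G)}.
  by apply: differentiable_continuous; exact: (chart_param_d1 fM ee Op d Ax).
have Gi d : 'D_d G x = 0 -> d = 0 by exact: (chart_param_inj fM ee Op Ax).
have [L LK HL] := local_surjectivity Gd Gc Gi (param_near Op Ax).
have cc : {for f p, continuous (chart e)}.
  by apply: differentiable_continuous; exact: (differentiable_chart ee (F := id) (fC p)).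
rewrite /G xp in HL.
have {}HL : \forall y \near f p, exists2 x', A x' & L (G x') = L (chart e y) := cc _ HL.
apply: filterS HL => y [x' Ax' LE] yC yE; exists (phi x').
apply: (chart_inj ee (fC _) yC).
have vs a : (a < k)%N -> rdot (s a) (G x' - chart e y) = 0.
  move=> ak; rewrite rdotDr rdotNr !(rdotC (s a)) yE //.
  by rewrite (chart_component_constant (phi x') (sN a ak)) subrr.
have [X XT vE] := sv _ vs.
have [|d dE] := image_space_orth Gd (X := G x' - chart e y).
  move=> t tG; rewrite vE; apply: (@chart_normal_constant t p p0) XT.
  move=> W; rewrite -xp => /(tangentP _ Op Ax)[d ->].
  by rewrite -(chart_param_derive fM ee Op d Ax).
have d0 : d = 0 by rewrite -(LK d) -dE linearB /= LE subrr.
by apply/eqP; rewrite -subr_eq0; apply/eqP; rewrite -/(G x') dE d0 derive0.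
Qed.

End NormalSpace.

(** * The isometry onto the standard model *)

Section Congruence.
Variables (R : realType) (n k : nat).
Hypothesis kn : (k < n)%N.

Let i0 : 'I_n := Ordinal (leq_ltn_trans (leq0n k) kn).

(** Position 0 holds the ideal point; the others hold the imaginary directions because
    [ruled_minimalP] is stated with these. The default of [insubd] is not reached for indices at
    most [k]. *)
Definition ruled_frame (j : nat) : Cvec R n :=
  if j is j'.+1 then im_vec R (insubd i0 j) else ideal_point R n.

Lemma ruled_frame_orthonormal : hermitian_orthonormal k.+1 ruled_frame.
Proof.
have val_i j : (j < k.+1)%N -> nat_of_ord (insubd i0 j) = j.
  by move=> jk; rewrite val_insubd (leq_trans jk kn).
have J_im (j : 'I_n) : J (im_vec R j) = - re_vec R j by rewrite -J_re_vec JJ.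
have e_im (j : 'I_n) : (0 < j)%N -> rdot (ideal_point R n) (im_vec R j) = 0 /\
    idot (ideal_point R n) (im_vec R j) = 0.
  move=> j0; rewrite rdot_im_vec mxE; split=> //.
  by rewrite /idot J_im rdotNr rdot_re_vec mxE gtn_eqF ?oppr0.
case=> [|a] [|b] ak bk /=.
- by rewrite (ideal_point_norm _ kn) idotzz.
- by apply: e_im; rewrite val_i.
- have [|H1 H2] := e_im (insubd i0 a.+1); first by rewrite val_i.
  by rewrite rdotC H1 idotC H2 oppr0.
rewrite rdot_im_vec /= mxE eqxx /= /idot J_im rdotNr rdot_re_vec /= mxE oppr0; split=> //.
by rewrite -(inj_eq val_inj) /= !val_i // eq_sym.
Qed.

Variables (e : Cvec R n) (s : nat -> Cvec R n) (c : nat -> R).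
Hypothesis es : hermitian_orthonormal k.+1 (fun j => if j is j'.+1 then s j' else e).

Lemma congruence : exists F G : Cvec R n -> Cvec R n, isometry_pair F G /\
  forall q, CH q -> @ruled_minimal R n k (F q) <->
    (forall a, (a < k)%N -> rdot (chart e q) (s a) = c a).
Proof.
have ee : rdot e e = 1 by have [] := es (ltn0Sn k) (ltn0Sn k).
have se a : (a < k)%N -> rdot e (s a) = 0 /\ idot e (s a) = 0.
  by move=> ak; exact: (@es 0%N a.+1).
have ss a b : (a < k)%N -> (b < k)%N -> rdot (s a) (s b) = (a == b)%:R.
  by move=> ak bk; have [] := @es a.+1 b.+1 ak bk.
(* This translation moves the affine subspace of constants [c] to the parallel one of constants 0;
   the unitary map then aligns the frames. *)
pose tau : Cvec R n := - \sum_(a < k) c a *: s a.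
have tauE w : rdot w tau = - \sum_(a < k) c a * rdot w (s a).
  rewrite rdotNr (linear_sum (rdot w)) /=; congr (- _).
  by apply: eq_bigr => a _; rewrite rdotZr.
have te : rdot tau e = 0.
  rewrite rdotC tauE big1 ?oppr0 // => a _.
  by rewrite (se a (ltn_ord a)).1 mulr0.
have ite : idot tau e = 0.
  rewrite /idot rdotC tauE big1 ?oppr0 // => a _.
  by rewrite rdotJl (se a (ltn_ord a)).2 oppr0 mulr0.
have ts b : (b < k)%N -> rdot tau (s b) = - c b.
  move=> bk; rewrite rdotC tauE (bigD1 (Ordinal bk)) //= ss // eqxx mulr1 big1 ?addr0 //.
  by move=> a ab; rewrite ss // eq_sym (_ : _ == _ = false) ?mulr0 //; apply/negbTE.
have [A [B [Au Bu AK BK At]]] := unitary_transport es ruled_frame_orthonormal.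
have [Al AJ Ar] := Au.
exists (A \o heis e tau), (heis e (- tau) \o B); split.
  apply: isometry_pair_comp; first exact: heis_isometry_pair.
  exact: unitary_isometry_pair.
move=> q qC; have hC : CH (heis e tau q) := heis_CH ee te ite qC.
have FC : CH (A (heis e tau q)) by rewrite /CH /= Ar.
have chartE b : (b < k)%N ->
    rdot (chart (ideal_point R n) (A (heis e tau q))) (ruled_frame b.+1) =
    rdot (chart e q) (s b) - c b.
  move=> bk; rewrite -[ideal_point R n]/(ruled_frame 0) -(At 0%N (ltn0Sn k)) -(At b.+1 bk) chart_unitary // Ar.
  by rewrite chart_heis ?ts //; have [] := se b bk.
split=> [/(ruled_minimalP kn)[_ H] b bk|H].
  apply/eqP; rewrite -subr_eq0 -chartE //; apply/eqP; apply: H.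
  by rewrite val_insubd (leq_ltn_trans _ kn) ?bk.
apply/(ruled_minimalP kn); split=> // j /andP[j0 jk].
have jE : j = insubd i0 j by rewrite valKd.
have jk' : (j.-1 < k)%N by rewrite prednK.
by have := chartE _ jk'; rewrite /ruled_frame prednK // -jE H // subrr.
Qed.

End Congruence.

Lemma open_part (R : realType) n (F G : Cvec R n -> Cvec R n) (S V : set (Cvec R n)) :
  isometry_pair F G -> S `<=` @CH R n -> V `<=` @CH R n ->
  (forall q, V q -> S (F q)) ->
  (forall q, V q -> \forall y \near q, CH y -> S (F y) -> V y) ->
  exists U, open U /\ F @` V = S `&` U.
Proof.
move=> FG SC VC VS Vn; have [FC GC FK GK Fi Gi] := FG.
(* The image need not be open in the ambient space, so the implication from [S] is used: its
   interior meets [S] exactly in the image. *)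
pose U := [set y | S y -> (F @` V) y]^°.
exists U; split; first exact: open_interior.
apply/seteqP; split=> [_ [q Vq <-]|y [Sy /interior_subset H]]; last exact: H.
split; first exact: VS.
have qC := VC q Vq.
have [L [Gd _ _ _]] := Gi _ (FC q qC).
have := Vn q Vq; rewrite -{1}(FK q qC) => /(differentiable_continuous Gd).
rewrite /nbhs/=; apply: filterS => y /= H Sy; exists (G y).
  by apply: H; [exact/GC/SC|rewrite GK //; exact: SC].
by rewrite GK //; exact: SC.
Qed.

Unset Implicit Arguments.

Theorem theorem3p1 (R : realType) (n k : nat) (T : topologicalType)
    (f : T -> Cvec R n) (Z : T -> Cvec R n)
    (II : T -> Cvec R n -> Cvec R n -> Cvec R n)
    (hn : (3 <= n)%N) (hk : (1 <= k <= n - 1)%N)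
    (hM : submanifold (2 * n - k) f)
    (hconn : connected [set: T])
    (hreal : totally_real_normal_bundle (2 * n - k) f)
    (hZ : smooth_field (2 * n - k) f Z)
    (hZD : forall p, max_holomorphic (2 * n - k) f p (Z p))
    (hZ1 : forall p, metric (f p) (Z p) (Z p) = 1)
    (hII : second_fundamental_form (2 * n - k) f II)
    (hIIZ : trivial_bilinear_extension (2 * n - k) f Z II) :
  exists g : Cvec R n -> Cvec R n, holomorphic_isometry g /\
  exists U : set (Cvec R n), open U /\
    g @` range f = @ruled_minimal R n k `&` U.
Proof.
have /andP[k0 kn1] := hk.
have kn : (k < n)%N by rewrite (leq_ltn_trans kn1) // subn1 prednK // (leq_trans _ hn).
have k2n : (k <= 2 * n)%N by rewrite (leq_trans (ltnW kn)) // leq_pmull.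
have mk : (2 * n - k + k = n + n)%N by rewrite subnK // mul2n addnn.
have mn : (2 * n - k < n + n)%N by rewrite -mk -addn1 leq_add2l.
(* An empty [T] also satisfies the hypotheses; it corresponds to the empty open part. *)
have [[p0 _]|T0] := pselect (exists p : T, True); last first.
  exists id; split; first exact: (isometry_pair_holomorphic (isometry_pair_id R n)).
  exists set0; split; first exact: open0.
  rewrite setI0; apply/seteqP; split=> // z [w [p _ _] _].
  by apply: T0; exists p.
pose e := ideal_limit (f p0) (Z p0).
have ee : rdot e e = 1 := ideal_limit_norm (submanifold_CH hM p0) (hZ1 p0).
have he p : ideal_limit (f p) (Z p) = e.
  exact: (ideal_limit_constant hM mn hconn hreal hZ hZD hZ1 hII hIIZ p0 p).
have [s [ss sN sv]] := chart_normal_basis hM ee p0 mk.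
have es : hermitian_orthonormal k.+1 (fun j => if j is j'.+1 then s j' else e).
  have se a : (a < k)%N -> rdot (s a) e = 0 /\ idot (s a) e = 0.
    by move=> ak; exact: (chart_normal_ideal hM hZD hZ1 ee he (sN a ak)).
  case=> [|a] [|b] ak bk /=.
  - by rewrite ee idotzz.
  - by have [H1 H2] := se b bk; rewrite rdotC H1 idotC H2 oppr0.
  - exact: se.
  split; first by rewrite ss.
  exact: (chart_normal_real hM hreal hZD hZ1 ee he (sN a ak) (sN b bk)).
pose c a := rdot (chart e (f p0)) (s a).
have [F [G [FG ruledE]]] := congruence kn c es.
exists F; split; first exact: isometry_pair_holomorphic FG.
apply: (open_part FG).
- by move=> q [].
- by move=> _ [p _ <-]; exact: (submanifold_CH hM).
- move=> _ [p _ <-]; apply/(ruledE _ (submanifold_CH hM p)) => a ak.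
  exact: (chart_component_constant hM hconn hreal hZD hZ1 hII hIIZ ee he p (sN a ak)).
move=> _ [p _ <-].
have := local_model hM hconn hreal hZD hZ1 hII hIIZ ee he p sN sv.
apply: filterS => y H yC /(ruledE y yC) Hy.
by have [q <-] := H yC Hy; exists q.
Qed.
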